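(* Let $f\colon\mathbb N\to\mathbb U\setminus\{0\}$ be a completely multiplicative function with $f\sim\chi$ for some primitive Dirichlet character $\chi$ with conductor $q$, and let $(X,\mu,T)$ be a Furstenberg system of $f$ for Cesàro or logarithmic averages. Then $\mathrm{Spec}(X,\mu,T)$ is equal to the subgroup $\Lambda$ of $\mathbb T$ generated by $\{1/p^s\colon p\in A,\ s\in\mathbb N\}$, where $A:=\{p\in\mathbb P\colon \text{either } p\mid q\text{ or }f(p)\neq\chi(p)\}$.
   Context: $\mathbb N=\{1,2,\ldots\}$, $\mathbb P$ is the set of primes, $\mathbb U$ is the closed complex unit disc, $e(t)=e^{2\pi i t}$, $[N]=\{1,\ldots,N\}$, $\mathbb T=\mathbb R/\mathbb Z$ identified with $[0,1)$. A function $f\colon\mathbb N\to\mathbb U$ is completely multiplicative if $f(mn)=f(m)f(n)$ for all $m,n\in\mathbb N$. For multiplicative $f,g\colon\mathbb N\to\mathbb U$ let $\mathbb D^2(f,g)=\sum_{p\in\mathbb P}\frac1p\big(1-\mathrm{Re}(f(p)\overline{g(p)})\big)$ and write $f\sim g$ if $\mathbb D(f,g)<+\infty$. The constant $\chi=1$ is regarded as a primitive Dirichlet character with conductor $q=1$. For a finite non-empty $A\subset\mathbb N$, $\mathbb E_{n\in A}a(n)=\frac1{|A|}\sum_{n\in A}a(n)$ (Cesàro average) and $\mathbb E^{\log}_{n\in A}a(n)=\big(\sum_{n\in A}\frac1n\big)^{-1}\sum_{n\in A}\frac{a(n)}n$ (logarithmic average); these also act on measures. Let $X=\mathbb U^{\mathbb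 Z}$ with the product topology and let $T\colon X\to X$ be the shift $(Tx)(k)=x(k+1)$. A sequence $a\colon\mathbb N\to\mathbb U$ is extended to $\mathbb Z$ arbitrarily (the extension does not matter) and viewed as a point of $X$. If $(N_k)$ is a strictly increasing sequence of positive integers and the weak-star limit $\mu=\lim_{k\to\infty}\mathbb E_{n\in[N_k]}\delta_{T^na}$ exists, then $(X,\mu,T)$ is called the Furstenberg system of $a$ along $(N_k)$ for Cesàro averages. With $\mathbb E^{\log}$ in place of $\mathbb E$ one gets the Furstenberg system of $a$ along $(N_k)$ for logarithmic averages. A Furstenberg system of $a$ is one obtained along some $(N_k)$. The spectrum $\mathrm{Spec}(X,\mu,T)$ is the set of $\alpha\in[0,1)$ (viewed as a subset of $\mathbb T$) for which there is a non-zero $g\in L^2(\mu)$ with $g\circ T=e(\alpha)\,g$. *)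

(* Defs.v *)
From HB Require Import structures.
From mathcomp Require Import all_boot all_order all_algebra.
From mathcomp Require Import complex.
From mathcomp Require Import all_classical all_reals all_analysis.

Set Implicit Arguments.
Unset Strict Implicit.
Unset Printing Implicit Defensive.

Import Order.TTheory GRing.Theory Num.Theory.
Import numFieldNormedType.Exports.

Local Open Scope classical_set_scope.
Local Open Scope ring_scope.

(* The topology of the norm on the complex numbers. *)
HB.instance Definition _ (R : realType) :=
  PseudoPointedMetric.copy R[i] (R[i])^o.

Definition circle_exp (R : realType) (t : R) : R[i] :=
  Complex (cos (2 * pi * t)) (sin (2 * pi * t)).

(* A sequence indexed by the positive integers is a function on nat whose
   value at 0 is never used. *)

Definition completely_multiplicative (R : realType) (f : nat -> R[i]) : Prop :=
  forall m n : nat, (0 < m)%N -> (0 < n)%N -> f (m * n)%N = f m * f n.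

(* Characters modulo q are lifted to nat, with the usual value 0 at the
   integers that are not coprime to q. *)
Definition dirichlet_character (R : realType) (q : nat) (chi : nat -> R[i])
    : Prop :=
  [/\ (0 < q)%N,
      forall m n : nat, chi (m * n)%N = chi m * chi n,
      forall n : nat, chi (n + q)%N = chi n &
      forall n : nat, chi n != 0 <-> coprime n q].

(* A primitive character modulo q, i.e. a character with conductor q, is one
   that is not induced by a character modulo a proper divisor of q. *)
Definition primitive_dirichlet_character (R : realType) (q : nat)
    (chi : nat -> R[i]) : Prop :=
  dirichlet_character q chi /\
  forall (d : nat) (psi : nat -> R[i]),
    (d %| q)%N -> (d < q)%N -> dirichlet_character d psi ->
    ~ (forall n : nat, coprime n q -> chi n = psi n).

(* The square of the distance; it is finite exactly when the distance is. *)
Definition pretentious_dist2 (R : realType) (f g : nat -> R[i]) : \bar R :=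
  (\sum_(0 <= p <oo | prime p)
     (p%:R^-1 * (1 - complex.Re (f p * (g p)^*)))%:E)%E.

Definition pretends (R : realType) (f g : nat -> R[i]) : Prop :=
  (pretentious_dist2 f g < +oo)%E.

Definition unit_disc (R : realType) : Type :=
  set_type [set z : R[i] | `|z| <= 1].

HB.instance Definition _ (R : realType) := Uniform.on (unit_disc R).

Fact unit_disc0_subproof (R : realType) :
  (0 : R[i]) \in [set z : R[i] | `|z| <= 1].
Proof. by rewrite inE /= normr0 ler01. Qed.

HB.instance Definition _ (R : realType) :=
  isPointed.Build (unit_disc R) (exist _ 0 (unit_disc0_subproof R)).

Definition disc_seq (R : realType) : Type := {ptws int -> unit_disc R}.

HB.instance Definition _ (R : realType) := Uniform.on (disc_seq R).
HB.instance Definition _ (R : realType) :=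
  isPointed.Build (disc_seq R) (fun=> point).

Definition borel (T : ptopologicalType) := g_sigma_algebraType (@open T).

HB.instance Definition _ (T : ptopologicalType) := Measurable.on (borel T).

Definition disc_shift (R : realType) (x : disc_seq R) : disc_seq R :=
  fun k : int => x (k + 1).

Section averages.
Context d (T : measurableType d) (R : realType).
Variable m : {measure set T -> \bar R}^nat.

(* Both means run over the indices 1, ..., N: the summation index n of msum
   starts at 0 and stands for n.+1. *)
Definition cesaro_mean (N : nat) : {measure set T -> \bar R} :=
  mscale (N%:R^-1)%:nng (msum (fun n => m n.+1) N).

Fact log_weight_ge0_subproof (N : nat) :
  0 <= (\sum_(n < N) n.+1%:R^-1 : R)^-1.
Proof. by rewrite invr_ge0 sumr_ge0. Qed.

Definition log_mean (N : nat) : {measure set T -> \bar R} :=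
  mscale (NngNum (log_weight_ge0_subproof N))
    (msum (fun n => mscale (n.+1%:R^-1)%:nng (m n.+1)) N).

End averages.

(* Meant for a compact T, where the continuous functions are bounded. *)
Definition weak_star_cvg (T : ptopologicalType) (R : realType)
    (mu_ : {measure set (borel T) -> \bar R}^nat)
    (mu : {measure set (borel T) -> \bar R}) : Prop :=
  forall F : T -> R, continuous F ->
    (\int[mu_ k]_x F x)%R @[k --> \oo] --> (\int[mu]_x F x)%R.

Section furstenberg.
Variable R : realType.
Local Notation X := (borel (disc_seq R)).

Definition extends_to_int (f : nat -> R[i]) (a : disc_seq R) : Prop :=
  forall n : nat, (0 < n)%N -> val (a n%:Z) = f n.

Definition orbit_dirac (a : disc_seq R) : {measure set X -> \bar R}^nat :=
  fun n => \d_(iter n (@disc_shift R) a : X).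

Definition furstenberg_system
    (mean : {measure set X -> \bar R}^nat -> {measure set X -> \bar R}^nat)
    (f : nat -> R[i]) (mu : probability X R) : Prop :=
  exists (a : disc_seq R) (N_ : nat -> nat),
    [/\ extends_to_int f a,
        forall k, (0 < N_ k)%N,
        {homo N_ : i j / (i < j)%N} &
        weak_star_cvg (fun k => mean (orbit_dirac a) (N_ k)) mu].

End furstenberg.

Definition L2 d (T : measurableType d) (R : realType)
    (mu : {measure set T -> \bar R}) (g : T -> R[i]) : Prop :=
  measurable_fun setT (g : T -> borel R[i]) /\
  (\int[mu]_x ((ComplexField.Normc.normc (g x)) ^+ 2)%:E < +oo)%E.

Definition spectrum d (T : measurableType d) (R : realType)
    (mu : {measure set T -> \bar R}) (S : T -> T) : set R :=
  [set alpha | 0 <= alpha < 1 /\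
     exists g : T -> R[i],
       [/\ L2 mu g,
           ~ (\forall x \ae mu, g x = 0) &
           \forall x \ae mu, g (S x) = circle_exp alpha * g x]].

Definition frac (R : realType) (x : R) : R := x - (Num.floor x)%:~R.

(* The circle R/Z is identified with [0,1[, with addition modulo 1. *)
Definition circle_subgroup (R : realType) (H : set R) : Prop :=
  [/\ H `<=` `[0, 1[, H 0 & forall x y, H x -> H y -> H (frac (x - y))].

Definition circle_generated (R : realType) (G : set R) : set R :=
  smallest (@circle_subgroup R) G.

(* Main.v *)
Require Import Defs.
From HB Require Import structures.
From mathcomp Require Import all_boot all_order all_algebra.
From mathcomp Require Import complex.
From mathcomp Require Import all_classical all_reals all_analysis.
From mathcomp Require cyclic. From mathcomp Require Import measurable_realfun ring lra zify.

Set Implicit Arguments.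
Unset Strict Implicit.
Unset Printing Implicit Defensive.

Import Order.TTheory GRing.Theory Num.Theory.
Import numFieldNormedType.Exports.

Local Open Scope classical_set_scope.
Local Open Scope ring_scope.

(** Call a prime [p] exceptional when [f p] differs from [chi p]. Since [f] does
    not vanish, the prime divisors of the conductor [q] are exceptional, so these
    are the primes whose powers appear in the theorem.

    The function [f] is almost periodic up to a phase. Its periodic model
    [truncation D] equals [f] on the part of [n] that divides [D], a product of
    powers [p ^ L] of the exceptional primes [p <= K], and equals [chi] on the
    cofactor; its period is [q * D]. For most [n] the quotient of [f n] by the
    model is the product of the twists [f p * (chi p)^*] over the primes
    [p > K] that divide [n]. As [f] pretends to be [chi], the sum of
    [(1 - Re twist) / p] converges, so that each twist may be replaced by the
    unimodular number whose argument is its imaginary part, and the argument of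
    the product becomes an additive function of [n]. The Turan-Kubilius
    inequality concentrates this function around a constant. Hence on [1, N]
    the function [f] is close in mean to [W * truncation D] for one unimodular
    number [W] depending on [N] (lemma [periodic_approx]). Logarithmic means are
    averages of Cesaro means, so Furstenberg systems of both kinds inherit such
    estimates (lemma [furstenberg_integral_le]).

    The spectrum is contained in the group. The phase [W] cancels when [f] is
    compared with its shift by a multiple of [q * D]; therefore every Borel set
    is almost invariant under all multiples of some [Q] whose prime factors are
    exceptional (lemma [all_almost_periodic]). If [g] is an eigenfunction for
    [alpha] and [Q * alpha] is not an integer, some multiple of [Q] rotates the
    values of [g] by more than a right angle, which moves a set where [g] takes
    its values in a quarter plane off itself (lemma [eigenvalue_denominator]).
    So [Q * alpha] is an integer, and Bezout decomposes [alpha].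

    The group is contained in the spectrum. Eigenvalues of eigenfunctions that
    vanish almost nowhere form a group, and [1 / p^s] is a multiple of
    [1 / (q * p^s)], so eigenfunctions at the latter frequencies suffice. They
    are limits of Fourier averages of the coordinates (lemma
    [fourier_avg_eigenfunction]), which are close to [W] times a Fourier
    coefficient of the model. That coefficient is a product of three factors:
    one at [p], nonzero because [f p] is neither [0] nor [chi p]; one at each
    other exceptional prime, their product being bounded below uniformly in [K]
    and [L] because [f] pretends to be [chi]; and the Gauss sum of [chi],
    nonzero because [chi] is primitive (lemma [fourier_lower_bound]). The
    uniform bound is what keeps the limit from vanishing. *)

(** * Complex modulus and the circle *)

Section complex_modulus.
Variable R : realType.
Implicit Types z w : R[i].

(** The norm of [R[i]] takes its values in [R[i]]; this is its real value. *)
Definition nrm z : R := ComplexField.Normc.normc z.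

Lemma nrmE z : nrm z = Num.sqrt (complex.Re z ^+ 2 + complex.Im z ^+ 2).
Proof. by case: z. Qed.

Lemma nrm_normr z : `|z| = (nrm z)%:C%C.
Proof. by []. Qed.

Lemma nrm_ge0 z : 0 <= nrm z.
Proof. by rewrite nrmE sqrtr_ge0. Qed.

Lemma nrm_sqr z : nrm z ^+ 2 = complex.Re z ^+ 2 + complex.Im z ^+ 2.
Proof. by rewrite nrmE sqr_sqrtr // addr_ge0 // sqr_ge0. Qed.

Lemma nrm0 : nrm 0 = 0. Proof. exact: ComplexField.Normc.normc0. Qed.
Lemma nrm1 : nrm 1 = 1. Proof. exact: ComplexField.Normc.normc1. Qed.
Lemma nrmM z w : nrm (z * w) = nrm z * nrm w.
Proof. exact: ComplexField.Normc.normcM. Qed.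
Lemma nrmV z : nrm z^-1 = (nrm z)^-1.
Proof. exact: ComplexField.Normc.normcV. Qed.
Lemma nrmN z : nrm (- z) = nrm z.
Proof. by rewrite !nrmE !raddfN !sqrrN. Qed.

Lemma nrmD z w : nrm (z + w) <= nrm z + nrm w.
Proof. by have := ler_normD z w; rewrite !nrm_normr -rmorphD /= lecR. Qed.

Lemma nrm_eq0 z : (nrm z == 0) = (z == 0).
Proof. by rewrite -[RHS]normr_eq0 nrm_normr eq_complex /= eqxx andbT. Qed.

Lemma nrm_le1 z : (`|z| <= 1) = (nrm z <= 1).
Proof. by rewrite nrm_normr -lecR. Qed.

Lemma nrm_ltc z (e : R) : (`|z| < e%:C%C) = (nrm z < e).
Proof. by rewrite nrm_normr ltcR. Qed.

Lemma nrmX z n : nrm (z ^+ n) = nrm z ^+ n.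
Proof. by elim: n => [|n IH]; rewrite ?expr0 ?nrm1// !exprS nrmM IH. Qed.

Lemma nrmB_sym z w : nrm (z - w) = nrm (w - z).
Proof. by rewrite -nrmN opprB. Qed.

Lemma nrmB z w : nrm (z - w) <= nrm z + nrm w.
Proof. by rewrite -(nrmN w) nrmD. Qed.

Lemma nrm_tri z w t : nrm (z - t) <= nrm (z - w) + nrm (w - t).
Proof. by apply: le_trans (nrmD _ _); rewrite addrA subrK. Qed.

Lemma nrm_lbound z w : nrm z - nrm w <= nrm (z - w).
Proof. by have := nrmD (z - w) w; rewrite subrK; lra. Qed.

Lemma nrm_lip z w : `|nrm z - nrm w| <= nrm (z - w).
Proof.
have := nrm_lbound z w; have := nrm_lbound w z; rewrite (nrmB_sym w z) => h1 h2.
by rewrite ler_norml; apply/andP; split; lra.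
Qed.

Lemma nrm_sum I (r : seq I) (P : pred I) (F : I -> R[i]) :
  nrm (\sum_(i <- r | P i) F i) <= \sum_(i <- r | P i) nrm (F i).
Proof.
elim/big_ind2: _ => [|x1 x2 y1 y2 h1 h2|//]; first by rewrite nrm0.
by apply: le_trans (nrmD _ _) _; apply: lerD.
Qed.

Lemma nrm_real (a : R) : nrm a%:C%C = `|a|.
Proof. by rewrite nrmE /= expr0n addr0 sqrtr_sqr. Qed.

Lemma nrm_nat n : nrm n%:R = n%:R.
Proof.
have -> : n%:R = (n%:R : R)%:C%C :> R[i] by rewrite rmorph_nat.
by rewrite nrm_real ger0_norm.
Qed.

Lemma nrm_conj z : nrm z^* = nrm z.
Proof. by case: z => a b; rewrite !nrmE /= sqrrN. Qed.

Lemma abs_Re_le z : `|complex.Re z| <= nrm z.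
Proof. by rewrite nrmE -sqrtr_sqr ler_wsqrtr // lerDl sqr_ge0. Qed.

Lemma abs_Im_le z : `|complex.Im z| <= nrm z.
Proof. by rewrite nrmE -sqrtr_sqr ler_wsqrtr // lerDr sqr_ge0. Qed.

Lemma nrm_ReIm z : nrm z <= `|complex.Re z| + `|complex.Im z|.
Proof.
rewrite -(@ler_pXn2r _ 2) ?nnegrE ?nrm_ge0 ?addr_ge0 // nrm_sqr.
rewrite sqrrD !real_normK ?num_real // lerD2r lerDl.
by rewrite mulrn_wge0 // mulr_ge0.
Qed.

Lemma mul_conj_nrm z : z * z^* = ((nrm z) ^+ 2)%:C%C.
Proof.
rewrite nrm_sqr; case: z => a b; apply/eqP; rewrite eq_complex /=.
by apply/andP; split; apply/eqP => /=; rewrite ?expr2; ring.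
Qed.

Lemma conj_unit z : nrm z = 1 -> z^* = z^-1.
Proof.
move=> z1; have z0 : z != 0 by rewrite -nrm_eq0 z1 oner_eq0.
by apply: (mulfI z0); rewrite mul_conj_nrm z1 expr1n mulfV.
Qed.

Lemma nrm_prod_le1 I (r : seq I) (P : pred I) (F : I -> R[i]) :
  (forall i, P i -> nrm (F i) <= 1) -> nrm (\prod_(i <- r | P i) F i) <= 1.
Proof.
move=> F1; elim/big_ind: _ => [|x y hx hy|j Pj]; rewrite ?nrm1 ?F1 //.
by rewrite nrmM mulr_ile1 ?nrm_ge0.
Qed.

(** Telescoping: the factors are exchanged one at a time, and the others have
    modulus at most 1. *)
Lemma nrm_prod_lip I (r : seq I) (P : pred I) (F G : I -> R[i]) :
  (forall i, P i -> nrm (F i) <= 1) -> (forall i, P i -> nrm (G i) <= 1) ->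
  nrm (\prod_(i <- r | P i) F i - \prod_(i <- r | P i) G i)
  <= \sum_(i <- r | P i) nrm (F i - G i).
Proof.
move=> F1 G1; elim: r => [|i r IH]; first by rewrite !big_nil subrr nrm0.
rewrite !big_cons; case: ifP => // Pi.
set a := \prod_(_ <- r | _) F _; set b := \prod_(_ <- r | _) G _.
have -> : F i * a - G i * b = (F i - G i) * a + G i * (a - b) by ring.
have a1 : nrm a <= 1 by exact: nrm_prod_le1.
apply: le_trans (nrmD _ _) _; rewrite !nrmM; apply: lerD.
  by rewrite ler_piMr ?nrm_ge0.
by apply: le_trans IH; rewrite ler_piMl ?nrm_ge0 ?G1.
Qed.

End complex_modulus.

Section circle.
Variable R : realType.
Implicit Types x y t : R.

(** The angle is in radians: the phases that approximate [f] are sums of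
    imaginary parts, without the factor [2 * pi] of [circle_exp]. *)
Definition cis t : R[i] := (cos t +i* sin t)%C.

Lemma circle_exp_cis t : circle_exp t = cis (2 * pi * t).
Proof. by []. Qed.

Lemma cisD x y : cis (x + y) = cis x * cis y.
Proof.
apply/eqP; rewrite eq_complex /= sinD cosD.
by apply/andP; split; apply/eqP => //; rewrite addrC mulrC [X in _ + X]mulrC addrC; ring.
Qed.

Lemma cis0 : cis 0 = 1.
Proof. by rewrite /cis cos0 sin0. Qed.

Lemma nrm_cis t : nrm (cis t) = 1.
Proof. by rewrite nrmE /= cos2Dsin2 sqrtr1. Qed.

Lemma cis_lip x y : nrm (cis x - cis y) <= 2 * `|x - y|.
Proof.
wlog lexy : x y / y <= x.
  by move=> H; have [/H//|/ltW/H] := leP y x; rewrite nrmB_sym distrC.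
have dcos (z : R) : derivable (@cos R) z 1 by exact: ex_derive.
have dsin (z : R) : derivable (@sin R) z 1 by exact: ex_derive.
apply: le_trans (nrm_ReIm _) _; rewrite mulr_natl mulr2n; apply: lerD => /=.
- have [c _ ->] := @MVT_segment R cos (- sin)%R y x lexy
    (fun z _ => is_derive_cos z) (continuous_subspaceT (@continuous_cos R)).
  rewrite normrM ler_piMl //= normrN ler_norml sin_geN1 sin_le1 //.
- have [c _ ->] := @MVT_segment R sin cos y x lexy
    (fun z _ => is_derive_sin z) (continuous_subspaceT (@continuous_sin R)).
  by rewrite normrM ler_piMl //= ler_norml cos_geN1 cos_le1.
Qed.

Lemma circle_expD x y : circle_exp (x + y) = circle_exp x * circle_exp y.
Proof. by rewrite !circle_exp_cis mulrDr cisD. Qed.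

Lemma circle_exp0 : circle_exp (0 : R) = 1.
Proof. by rewrite circle_exp_cis mulr0 cis0. Qed.

Lemma nrm_circle_exp t : nrm (circle_exp t) = 1.
Proof. by rewrite circle_exp_cis nrm_cis. Qed.

Lemma circle_exp_neq0 t : circle_exp t != 0.
Proof. by rewrite -nrm_eq0 nrm_circle_exp oner_eq0. Qed.

Lemma circle_expN t : circle_exp (- t) = (circle_exp t)^-1.
Proof.
by apply: (mulfI (circle_exp_neq0 t)); rewrite -circle_expD subrr circle_exp0
  mulfV ?circle_exp_neq0.
Qed.

Lemma circle_expMn t n : circle_exp (n%:R * t) = circle_exp t ^+ n.
Proof.
elim: n => [|n IH]; first by rewrite mul0r circle_exp0.
by rewrite -natr1 mulrDl mul1r circle_expD IH exprSr.
Qed.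

Lemma circle_exp1 : circle_exp (1 : R) = 1.
Proof. by rewrite /circle_exp mulr1 mulr_natl cos2pi sin2pi. Qed.

Lemma circle_exp_int (m : int) : circle_exp (m%:~R : R) = 1.
Proof.
case: m => n; first by rewrite -[_%:~R]mulr1 circle_expMn circle_exp1 expr1n.
by rewrite NegzE mulrNz circle_expN -[_%:~R]mulr1 circle_expMn circle_exp1 expr1n invr1.
Qed.

Lemma circle_exp_frac t : circle_exp (Defs.frac t) = circle_exp t.
Proof.
by rewrite /Defs.frac circle_expD circle_expN circle_exp_int invr1 mulr1.
Qed.

Lemma frac_bounds t : 0 <= Defs.frac t < 1.
Proof.
rewrite /Defs.frac subr_ge0 Num.Theory.floor_le ltrBlDr addrC.
by have := floorD1_gt t; rewrite intrD.
Qed.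

Lemma circle_exp_eq1 t : circle_exp t = 1 -> Defs.frac t = 0.
Proof.
rewrite -circle_exp_frac; have /andP[] := frac_bounds t.
move: (Defs.frac t) => u u0 u1 e1; apply/eqP/negPn/negP => un0.
have {}u0 : 0 < u by rewrite lt_neqAle eq_sym un0.
have pp := pi_gt0 R.
have : sin (pi * u) = 0.
  apply/eqP; have := congr1 (@complex.Re R) e1; rewrite /= -mulrA mulr_natl mulr2n.
  rewrite cosD -!expr2 cos2sin2 => h.
  by rewrite -sqrf_eq0; apply/eqP; lra.
have : 0 < sin (pi * u).
  by apply: sin_gt0_pi; rewrite mulr_gt0 //= gtr_pMr.
by move=> /lt0r_neq0/eqP.
Qed.

End circle.

(** * Topology of the sequence space *)

Section continuity_to_R.
Variable R : realType.

(** The balls of [R[i]] have radii in [R[i]]; real radii suffice. *)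
Lemma nbhs_complexP (z : R[i]) (V : set R[i]) :
  nbhs z V <-> exists2 e : R, 0 < e & [set w | nrm (z - w) < e] `<=` V.
Proof.
split=> [/nbhs_ballP [e /= e0 eV]|[e e0 eV]].
  have eE : e = (complex.Re e)%:C%C.
    by case: e e0 {eV} => a b; rewrite ltcE /= => /andP[/eqP -> _].
  exists (complex.Re e); first by move: e0; rewrite {1}eE ltcR.
  by move=> w /= zw; apply: eV; change (`|z - w| < e); rewrite eE nrm_ltc.
apply/nbhs_ballP; exists e%:C%C; first by rewrite /= ltcR.
by move=> w; change (`|z - w| < e%:C%C -> V w); rewrite nrm_ltc; apply: eV.
Qed.

Lemma lipschitz_continuous_complex (h : R[i] -> R) :
  (forall z w, `|h z - h w| <= nrm (z - w)) -> continuous h.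
Proof.
move=> hL z A /nbhs_ballP [e /= e0 eA]; apply/nbhs_complexP; exists e => //.
move=> w /= zw; apply: eA; rewrite -ball_normE /=.
exact: le_lt_trans (hL _ _) zw.
Qed.

Lemma continuous_Re : continuous (@complex.Re R).
Proof.
by apply: lipschitz_continuous_complex => z w; rewrite -raddfB abs_Re_le.
Qed.

Lemma continuous_Im : continuous (@complex.Im R).
Proof.
by apply: lipschitz_continuous_complex => z w; rewrite -raddfB abs_Im_le.
Qed.

Lemma continuous_nrm : continuous (@nrm R).
Proof. exact/lipschitz_continuous_complex/nrm_lip. Qed.

End continuity_to_R.

Section sequence_space.
Variable R : realType.
Local Notation X := (disc_seq R).

Definition coord (k : int) (x : X) : R[i] := val (x k).

Lemma nrm_coord k x : nrm (coord k x) <= 1.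
Proof. by rewrite -nrm_le1; have := valP (x k); rewrite inE. Qed.

Lemma continuous_val : continuous (fun u : unit_disc R => val u : R[i]).
Proof. exact: initial_continuous. Qed.

Lemma continuous_coord k : continuous (coord k).
Proof.
move=> x; apply: (@continuous_comp X (unit_disc R) R[i] (fun x : X => x k) val).
  exact: (@proj_continuous int (fun=> unit_disc R) k).
exact: continuous_val.
Qed.

(** Convergence in the product topology is coordinatewise. *)
Lemma nbhs_disc_seq (F : set_system X) (x : X) : Filter F ->
  (forall k (V : set R[i]), nbhs (coord k x) V -> F [set y | V (coord k y)]) ->
  forall U : set X, nbhs x U -> F U.
Proof.
move=> FF H; suff : F --> x by [].
apply/cvg_sup => k A [B [[C oC <-] /= Cx] BA].
apply: (@filterS _ F FF _ _ BA).
have [D oD DC] : exists2 D : set R[i], open D & val @^-1` D = C by exact: oC.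
have Dx : nbhs (coord k x) D.
  by apply: open_nbhs_nbhs; split => //; move: Cx; rewrite -DC.
by have := H k _ Dx; rewrite /= -DC; apply: (@filterS _ F FF) => y; exact.
Qed.

End sequence_space.

(** * Cylinders and measurability *)

Section rational_cylinders.
Variable R : realType.
Local Notation X := (disc_seq R).

Definition rat_complex (c : rat * rat) : R[i] := (ratr c.1 +i* ratr c.2)%C.

Lemma rat_approx (z : R[i]) (e : R) : 0 < e ->
  exists (c : rat * rat) (r : rat),
    nrm (z - rat_complex c) < ratr r /\ ratr r < e.
Proof.
move=> e0; have e2 : 0 < e / 2 by rewrite divr_gt0.
have lt_mid (a : R) : a - e / 4 < a + e / 4 by lra.
have [a /[!in_itv]/= /andP[a1 a2]] := rat_in_itvoo (lt_mid (complex.Re z)).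
have [b /[!in_itv]/= /andP[b1 b2]] := rat_in_itvoo (lt_mid (complex.Im z)).
have [r /[!in_itv]/= /andP[r1 r2]] : exists r : rat, ratr r \in `]e / 2, e[.
  by apply: rat_in_itvoo; lra.
exists (a, b), r; split => //; apply: lt_trans r1.
apply: le_lt_trans (nrm_ReIm _) _; rewrite !raddfB /=.
have : `|complex.Re z - ratr a| < e / 4 by rewrite ltr_norml; apply/andP; split; lra.
have : `|complex.Im z - ratr b| < e / 4 by rewrite ltr_norml; apply/andP; split; lra.
lra.
Qed.

(** Rational centres and radii make the cylinders countable, and the minimum
    [slack] describes each of them as the positivity set of one continuous
    function. *)
Definition cylinder_code := seq (int * (rat * rat) * rat).

Definition constraint_slack (t : int * (rat * rat) * rat) (x : X) : R :=
  ratr t.2 - nrm (coord t.1.1 x - rat_complex t.1.2).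

Definition slack (s : cylinder_code) (x : X) : R :=
  foldr (fun t m => Num.min (constraint_slack t x) m) 1 s.

Definition cylinder (s : cylinder_code) : set X := [set x | 0 < slack s x].

Lemma continuous_constraint_slack t : continuous (constraint_slack t).
Proof.
move=> x; apply: (@continuous_comp X R[i] R (coord t.1.1)
   (fun z => ratr t.2 - nrm (z - rat_complex t.1.2))); first exact: continuous_coord.
apply: lipschitz_continuous_complex => z w.
rewrite opprB addrC addrA subrK distrC; apply: le_trans (nrm_lip _ _) _.
by rewrite opprB addrA subrK.
Qed.

Lemma continuous_slack s : continuous (slack s).
Proof.
elim: s => [|t s IH] x.
  by rewrite (_ : slack [::] = cst 1); [exact: cst_continuous|apply/funext].
rewrite (_ : slack (t :: s) = constraint_slack t \min slack s); last exact/funext.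
by apply: continuous_min; [exact: continuous_constraint_slack|exact: IH].
Qed.

Lemma cylinder_cons t s :
  cylinder (t :: s) = [set x | 0 < constraint_slack t x] `&` cylinder s.
Proof. by apply/seteqP; split=> x /=; rewrite /cylinder /= lt_min => /andP. Qed.

Lemma cylinder_nil : cylinder [::] = setT.
Proof. by apply/seteqP; split=> x //= _; rewrite /cylinder /= ltr01. Qed.

Lemma cylinder_cat s1 s2 : cylinder (s1 ++ s2) = cylinder s1 `&` cylinder s2.
Proof.
elim: s1 => [|t s IH]; first by rewrite cylinder_nil setTI.
by rewrite /= !cylinder_cons IH setIA.
Qed.

(** Cylinders form a base: the filter that the cylinders around [x] generate
    converges coordinatewise to [x]. *)
Lemma open_cylinder_ex (U : set X) (x : X) : open U -> U x ->
  exists2 s, cylinder s x & cylinder s `<=` U.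
Proof.
move=> oU Ux; pose F := filter_from [set s | cylinder s x] cylinder.
have FF : Filter F.
  apply: filter_from_filter; first by exists [::]; rewrite /= cylinder_nil.
  move=> s1 s2 /= x1 x2; exists (s1 ++ s2); first by rewrite /= cylinder_cat.
  by rewrite cylinder_cat.
have FU : F U; last by have [s xs sU] := FU; exists s.
apply: (@nbhs_disc_seq R F x FF); last by apply: open_nbhs_nbhs.
move=> k V /nbhs_complexP [e e0 eV].
have e2 : 0 < e / 2 by rewrite divr_gt0.
have [c [r [cr re]]] := rat_approx (coord k x) e2.
exists [:: (k, c, r)]; rewrite /= cylinder_cons cylinder_nil setIT /=.
  by rewrite /constraint_slack /= subr_gt0.
move=> y; rewrite /= /constraint_slack /= subr_gt0 => yr; apply: eV => /=.
apply: le_lt_trans (nrm_tri _ (rat_complex c) _) _.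
rewrite (nrmB_sym _ (coord k y)).
by have := lt_trans cr re; have := lt_trans yr re; lra.
Qed.

Lemma open_bigcup_cylinder (U : set X) : open U ->
  U = \bigcup_(s in [set s | cylinder s `<=` U]) cylinder s.
Proof.
move=> oU; apply/seteqP; split=> [x Ux|x [s /= sU]]; last exact: sU.
by have [s xs sU] := open_cylinder_ex oU Ux; exists s.
Qed.

End rational_cylinders.

Section borel_measurability.
Variable R : realType.

Lemma open_measurable_borel (T : ptopologicalType) (U : set T) :
  open U -> measurable (U : set (borel T)).
Proof. by move=> oU; apply: sub_sigma_algebra. Qed.

Lemma continuous_measurable_borel (T : ptopologicalType) (h : T -> R) :
  continuous h -> measurable_fun setT (h : borel T -> R).
Proof.
move=> ch; apply: (measurability _ (RGenOInfty.measurableE R)) => //.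
move=> _ [_ [a ->] <-]; rewrite setTI; apply: open_measurable_borel.
by apply: open_comp => // x _; exact: ch.
Qed.

Lemma continuous_measurable_borel_map (T U : ptopologicalType) (h : T -> U) :
  continuous h -> measurable_fun setT (h : borel T -> borel U).
Proof.
move=> ch; apply: (@measurability _ _ (borel T) (borel U) setT h (@open U)) => //.
move=> _ [V oV <-]; rewrite setTI; apply: open_measurable_borel.
by apply: open_comp => // x _; exact: ch.
Qed.

Lemma measurable_Re d (T : measurableType d) (g : T -> R[i]) :
  measurable_fun setT (g : T -> borel R[i]) ->
  measurable_fun setT (fun x => complex.Re (g x)).
Proof.
move=> mg; apply: (@measurable_comp _ _ _ T (borel R[i]) R setT) => //.
exact: continuous_measurable_borel (@continuous_Re R).
Qed.

Lemma measurable_Im d (T : measurableType d) (g : T -> R[i]) :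
  measurable_fun setT (g : T -> borel R[i]) ->
  measurable_fun setT (fun x => complex.Im (g x)).
Proof.
move=> mg; apply: (@measurable_comp _ _ _ T (borel R[i]) R setT) => //.
exact: continuous_measurable_borel (@continuous_Im R).
Qed.

Lemma measurable_nrm d (T : measurableType d) (g : T -> R[i]) :
  measurable_fun setT (fun x => complex.Re (g x)) ->
  measurable_fun setT (fun x => complex.Im (g x)) ->
  measurable_fun setT (fun x => nrm (g x)).
Proof.
move=> mr mi.
have -> : (fun x => nrm (g x)) =
   (@Num.sqrt R) \o (fun x => complex.Re (g x) ^+ 2 + complex.Im (g x) ^+ 2).
  by apply/funext => x /=; rewrite nrmE.
apply: measurableT_comp.
  by apply: continuous_measurable_fun; exact: sqrt_continuous.
by apply: measurable_funD; apply: measurable_funX.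
Qed.

Lemma measurable_ge_cst d (T : measurableType d) (h : T -> R) (c : R) :
  measurable_fun setT h -> measurable [set x | c <= h x].
Proof.
move=> mh; rewrite (_ : [set x | _] = h @^-1` `[c, +oo[).
  by rewrite -[_ @^-1` _]setTI; exact: mh.
by apply/seteqP; split=> x /=; rewrite in_itv /= andbT.
Qed.

Lemma measurable_le_cst d (T : measurableType d) (h : T -> R) (c : R) :
  measurable_fun setT h -> measurable [set x | h x <= c].
Proof.
move=> mh; rewrite (_ : [set x | _] = h @^-1` `]-oo, c]).
  by rewrite -[_ @^-1` _]setTI; exact: mh.
by apply/seteqP; split=> x /=; rewrite in_itv.
Qed.

Lemma measurable_gt_cst d (T : measurableType d) (h : T -> R) (c : R) :
  measurable_fun setT h -> measurable [set x | c < h x].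
Proof.
move=> mh; rewrite (_ : [set x | _] = h @^-1` `]c, +oo[).
  by rewrite -[_ @^-1` _]setTI; exact: mh.
by apply/seteqP; split=> x /=; rewrite in_itv /= andbT.
Qed.

(** Every open subset of the plane is a union of rational discs, which are
    countably many. *)
Lemma measurable_complex d (T : measurableType d) (g : T -> R[i]) :
  measurable_fun setT (fun x => complex.Re (g x)) ->
  measurable_fun setT (fun x => complex.Im (g x)) ->
  measurable_fun setT (g : T -> borel R[i]).
Proof.
move=> mr mi.
apply: (@measurability _ _ T (borel R[i]) setT g (@open R[i])) => //.
move=> _ [V oV <-]; rewrite setTI.
pose D (p : (rat * rat) * rat) := [set w : R[i] | nrm (w - rat_complex R p.1) < ratr p.2].
have -> : g @^-1` V = \bigcup_(p in [set p | D p `<=` V]) g @^-1` D p.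
  apply/seteqP; split => [x /= Vx|x [p /= pV px]]; last exact: pV.
  have /nbhs_complexP [e e0 eV] : nbhs (g x) V by apply: open_nbhs_nbhs.
  have e2 : 0 < e / 2 by rewrite divr_gt0.
  have [c [r [cr re]]] := rat_approx (g x) e2.
  exists (c, r) => //= y; rewrite /D /= => yr; apply: eV => /=.
  apply: le_lt_trans (nrm_tri _ (rat_complex R c) _) _.
  rewrite (nrmB_sym _ y).
  by have := lt_trans cr re; have := lt_trans yr re; lra.
rewrite bigcup_mkcond; apply: countable_bigcupT_measurable => // p.
case: ifP => // _.
have -> : g @^-1` D p = (fun x => nrm (g x - rat_complex R p.1)) @^-1` `]-oo, ratr p.2[.
  by apply/seteqP; split => x /=; rewrite /D /= in_itv.
rewrite -[_ @^-1` _]setTI; apply: measurable_nrm => //.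
  under eq_fun do rewrite raddfB /=.
  by apply: measurable_funB.
under eq_fun do rewrite raddfB /=.
by apply: measurable_funB.
Qed.

End borel_measurability.

(** * Cesaro and logarithmic averages *)

Section averages.
Variable R : realType.

Definition cesaro_limsup_le (b : nat -> R) (c : R) : Prop :=
  forall e : R, 0 < e -> exists N0 : nat, forall N : nat, (N0 <= N)%N ->
    \sum_(n < N) b n.+1 <= (c + e) * N%:R.

Definition harmonic_sum (N : nat) : R := \sum_(n < N) n.+1%:R^-1.

Lemma harmonic_sumS N : harmonic_sum N.+1 = harmonic_sum N + N.+1%:R^-1.
Proof. exact: big_ord_recr. Qed.

Lemma harmonic_sum_unbounded (K : R) :
  exists N0 : nat, forall N, (N0 <= N)%N -> K <= harmonic_sum N.
Proof.
have nd : nondecreasing_seq (series (@harmonic R)).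
  by apply: nondecreasing_series => n _ _; rewrite harmonic_ge0.
have := nondecreasing_dvgn_lt nd (@dvg_harmonic R).
move=> /cvgryPge /(_ K) [N0 _ H]; exists N0 => N NN.
by have := H N NN; rewrite /series /= big_mkord.
Qed.

(** Logarithmic means are averages of the Cesaro means over all shorter
    ranges, by summation by parts; hence a bound that holds for all long
    Cesaro means holds for long logarithmic means. *)
Lemma log_mean_le_cesaro (b : nat -> R) (c : R) : 0 <= c ->
  cesaro_limsup_le b c ->
  forall e : R, 0 < e -> exists N0 : nat, forall N : nat, (N0 <= N)%N ->
    (harmonic_sum N)^-1 * (\sum_(n < N) n.+1%:R^-1 * b n.+1) <= c + e.
Proof.
move=> c0 bc e e0; have e2 : 0 < e / 2 by rewrite divr_gt0.
have [N0 HN0] := bc _ e2; set c' := c + e / 2 in HN0.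
have c'0 : 0 <= c' by rewrite addr_ge0 // ltW.
pose S N := \sum_(n < N) b n.+1.
pose L N := \sum_(n < N) n.+1%:R^-1 * b n.+1.
(* Summation by parts: [Phi] grows by Cesaro means weighted by [1 / N.+1]. *)
pose Phi N := L N - S N / N%:R.
have step N : (0 < N)%N -> Phi N.+1 - Phi N = S N / N%:R / N.+1%:R.
  move=> N0'; rewrite /Phi /L /S !big_ord_recr /= -/(L N) -/(S N).
  have nz : (N%:R : R) != 0 by rewrite pnatr_eq0 -lt0n.
  have nz1 : (1 + N%:R : R) != 0 by rewrite addrC natr1 pnatr_eq0.
  by rewrite -!natr1 ![_ + 1]addrC; field; rewrite nz nz1.
pose M := maxn N0 1.
have M0 : (0 < M)%N by rewrite /M leq_max orbT.
have PhiB k : Phi (M + k)%N <= Phi M + c' * (harmonic_sum (M + k)%N - harmonic_sum M).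
  elim: k => [|k IH]; first by rewrite addn0 subrr mulr0 addr0.
  have Mk : (0 < M + k)%N by rewrite addn_gt0 M0.
  have := step _ Mk; rewrite addnS => st.
  have : S (M + k)%N / (M + k)%N%:R / (M + k).+1%:R <= c' / (M + k).+1%:R.
    rewrite ler_pM2r ?invr_gt0 ?ltr0n // ler_pdivrMr ?ltr0n //.
    by apply: HN0; rewrite (leq_trans _ (leq_addr _ _)) // leq_maxl.
  rewrite harmonic_sumS mulrBr mulrDr.
  move: IH; rewrite mulrBr; move: st; clearbody Phi S c'.
  move: (c' / _) (S _ / _ / _) (Phi _) (Phi _) (Phi _) => u v w x y; lra.
have [N1 HN1] := harmonic_sum_unbounded (Num.max 1 (2 * (c' + `|Phi M|) / e)).
exists (maxn M N1) => N; rewrite geq_max => /andP[MN NN1].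
have := HN1 _ NN1; rewrite ge_max => /andP[h1 h2].
have h0 : 0 < harmonic_sum N by apply: lt_le_trans h1.
rewrite mulrC ler_pdivrMr // -/(L N).
have := PhiB (N - M)%N; rewrite subnKC // mulrBr.
have -> : Phi N = L N - S N / N%:R by [].
have HM : 0 <= c' * harmonic_sum M.
  by rewrite mulr_ge0 // /harmonic_sum sumr_ge0.
have SN : S N / N%:R <= c'.
  rewrite ler_pdivrMr; first by apply: HN0; rewrite (leq_trans _ MN) // leq_maxl.
  by rewrite ltr0n (leq_trans M0).
move: h2; rewrite ler_pdivrMr //.
have := ler_norm (Phi M).
have -> : c' * harmonic_sum N = c * harmonic_sum N + harmonic_sum N * e / 2.
  by rewrite /c' mulrDl; congr (_ + _); ring.
move: HM SN; clearbody Phi S L c'.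
move=> *; lra.
Qed.

End averages.

Section furstenberg_bounds.
Variable R : realType.
Local Notation X := (disc_seq R).
Local Notation T := (@disc_shift R).

Lemma integral_orbit_dirac (a : X) (F : X -> R) n : continuous F ->
  (\int[orbit_dirac a n]_x (F x)%:E)%E = (F (iter n T a))%:E.
Proof.
move=> cF; have mF : measurable_fun setT (EFin \o F : borel X -> \bar R).
  by apply/measurable_EFinP; exact: (continuous_measurable_borel cF).
have := @integral_dirac _ (borel X) (iter n T a) R setT measurableT _ mF.
by rewrite diracT mul1e.
Qed.

Lemma integral_bounded_fin_num (mu : probability (borel X) R) (F : X -> R) (B : R) :
  continuous F -> (forall x, 0 <= F x <= B) ->
  (\int[mu]_x (F x)%:E \is a fin_num)%E.
Proof.
move=> cF F0B; rewrite ge0_fin_numE; last first.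
  by apply: integral_ge0 => x _; rewrite lee_fin; have /andP[] := F0B x.
apply: (@le_lt_trans _ _ (\int[mu]_x (cst B%:E x))%E); last first.
  by rewrite integral_cst //= probability_setT mule1 ltry.
apply: ge0_le_integral => //.
- by move=> x _; rewrite lee_fin; have /andP[] := F0B x.
- by apply/measurable_EFinP; exact: (continuous_measurable_borel cF).
- by move=> x _; rewrite lee_fin; have /andP[] := F0B x.
Qed.

Lemma integral_cesaro_mean (a : X) (F : X -> R) N : continuous F ->
  (forall x, 0 <= F x) ->
  (\int[cesaro_mean (orbit_dirac a) N]_x F x)%R =
  N%:R^-1 * \sum_(n < N) F (iter n.+1 T a).
Proof.
move=> cF F0; have mF := continuous_measurable_borel cF.
have mF' : measurable_fun setT (EFin \o F : borel X -> \bar R).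
  exact/measurable_EFinP.
rewrite /Rintegral ge0_integral_mscale //=; last first.
  by move=> x _; rewrite lee_fin.
rewrite ge0_integral_measure_sum //; last by move=> x _; rewrite lee_fin.
rewrite (eq_bigr _ (fun (n : 'I_N) _ => integral_orbit_dirac a n.+1 cF)).
by rewrite sumEFin.
Qed.

Lemma integral_log_mean (a : X) (F : X -> R) N : continuous F ->
  (forall x, 0 <= F x) ->
  (\int[log_mean (orbit_dirac a) N]_x F x)%R =
  (harmonic_sum R N)^-1 * \sum_(n < N) n.+1%:R^-1 * F (iter n.+1 T a).
Proof.
move=> cF F0; have mF := continuous_measurable_borel cF.
have mF' : measurable_fun setT (EFin \o F : borel X -> \bar R).
  exact/measurable_EFinP.
rewrite /Rintegral ge0_integral_mscale //=; last first.
  by move=> x _; rewrite lee_fin.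
rewrite ge0_integral_measure_sum //; last by move=> x _; rewrite lee_fin.
have E (k : {nonneg R}) n :
    (\int[mscale k (orbit_dirac a n)]_x (F x)%:E)%E = (k%:num * F (iter n T a))%:E.
  rewrite (@ge0_integral_mscale _ (borel X) R _ setT measurableT k _ mF') /=.
    by rewrite EFinM -(integral_orbit_dirac a n cF).
  by move=> x _; rewrite lee_fin.
by rewrite (eq_bigr _ (fun (n : 'I_N) _ => E _ n.+1)) sumEFin.
Qed.

(** What the two kinds of systems have in common: upper bounds for all long
    Cesaro averages along the orbit pass to the limit measure. *)
Lemma furstenberg_integral_le (f : nat -> R[i]) (mu : probability (borel X) R) :
  furstenberg_system (@cesaro_mean _ _ R) f mu \/
  furstenberg_system (@log_mean _ _ R) f mu ->
  exists2 a : X, extends_to_int f a &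
    forall (F : X -> R) (B c : R), continuous F -> (forall x, 0 <= F x <= B) ->
      0 <= c -> cesaro_limsup_le (fun n => F (iter n T a)) c ->
      (\int[mu]_x (F x)%:E <= c%:E)%E.
Proof.
have fin (F : X -> R) (B c : R) : continuous F -> (forall x, 0 <= F x <= B) ->
    (\int[mu]_x F x)%R <= c -> (\int[mu]_x (F x)%:E <= c%:E)%E.
  by move=> cF F0B; rewrite /Rintegral -lee_fin fineK //; exact: integral_bounded_fin_num F0B.
have ge_N (N_ : nat -> nat) k : {homo N_ : i j / (i < j)%N} -> (k <= N_ k)%N.
  by move=> hN; elim: k => // k IH; apply: leq_ltn_trans IH _; exact: hN.
case=> -[a [N_ [ea N0 hN wc]]]; exists a => // F B c cF F0B c0 Fc; apply: (fin F B) => //.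
- have F0 x : 0 <= F x by have /andP[] := F0B x.
  apply/ler_addgt0Pl => e e0.
  have [M HM] := Fc _ e0; rewrite addrC.
  apply: (@cvgr_to_le _ _ _ _ _ _ _ (wc F cF)).
  exists M => // k /= Mk; rewrite integral_cesaro_mean //.
  rewrite mulrC ler_pdivrMr ?ltr0n //; apply: HM.
  exact: leq_trans Mk (ge_N _ _ hN).
- have F0 x : 0 <= F x by have /andP[] := F0B x.
  apply/ler_addgt0Pl => e e0.
  have [M HM] := log_mean_le_cesaro c0 Fc e0; rewrite addrC.
  apply: (@cvgr_to_le _ _ _ _ _ _ _ (wc F cF)).
  exists M => // k /= Mk; rewrite integral_log_mean //; apply: HM.
  exact: leq_trans Mk (ge_N _ _ hN).
Qed.

End furstenberg_bounds.

(** * Invariance of the limit measure *)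

Section continuity.
Variable R : realType.

Lemma continuous_compT (U V W : topologicalType) (g : V -> W) (f : U -> V) :
  continuous f -> continuous g -> continuous (g \o f).
Proof. by move=> cf cg x; apply: continuous_comp; [exact: cf|exact: cg]. Qed.

Lemma continuous_sub_add (U : topologicalType) (G H : U -> R) (B : R) :
  continuous G -> continuous H -> continuous (fun x => G x - H x + B).
Proof.
move=> cG cH x; apply: cvgD; last exact: cvg_cst.
by apply: cvgB; [exact: cG|exact: cH].
Qed.

Lemma continuous_truncation (n : R) :
  continuous (fun u : R => Num.min 1 (n * Num.max u 0)).
Proof.
move=> u; apply: (@continuous_min _ R (cst 1) (fun u => n * Num.max u 0)).
  exact: cvg_cst.
apply: cvgM; first exact: cvg_cst.
by apply: (@continuous_max _ R id (cst 0)); [exact: cvg_id|exact: cvg_cst].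
Qed.

End continuity.

Section real_valued_probability.
Context d (T : measurableType d) (R : realType) (mu : probability T R).
Implicit Types A B : set T.

Definition pr A : R := fine (mu A).

Lemma prE A : measurable A -> mu A = (pr A)%:E.
Proof. by move=> mA; rewrite fineK // fin_num_measure. Qed.

Lemma pr_ge0 A : 0 <= pr A.
Proof. exact: fine_ge0. Qed.

Lemma pr0 : pr set0 = 0.
Proof. by rewrite /pr measure0. Qed.

Lemma pr_mono A B : measurable A -> measurable B -> A `<=` B -> pr A <= pr B.
Proof.
by move=> mA mB AB; rewrite -lee_fin -!prE // le_measure // inE.
Qed.

Lemma pr_le2 A B C : measurable A -> measurable B -> measurable C ->
  A `<=` B `|` C -> pr A <= pr B + pr C.
Proof.
move=> mA mB mC ABC; rewrite -lee_fin EFinD -!prE //.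
apply: le_trans (measureU2 _ mB mC).
by apply: le_measure; rewrite ?inE //; exact: measurableU.
Qed.

Lemma pr_bigU (n : nat) (F : nat -> set T) : (forall i, measurable (F i)) ->
  pr (\bigcup_(i < n) F i) <= \sum_(i < n) pr (F i).
Proof.
move=> mF; elim: n => [|n IH].
  by rewrite big_ord0 (_ : \bigcup_(i < 0) _ = set0) ?pr0 // -subset0 => x [].
have mb k : measurable (\bigcup_(i < k) F i) by exact: bigcup_measurable.
rewrite big_ord_recr /=; apply: le_trans (lerD IH (lexx _)).
apply: pr_le2 => // x [i /=]; rewrite ltnS leq_eqVlt => /orP[/eqP -> ?|? ?]; first by right.
by left; exists i.
Qed.

Lemma pr_small (F : nat -> set T) : (forall i, measurable (F i)) ->
  nonincreasing_seq F -> \bigcap_n F n = set0 ->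
  forall e : R, 0 < e -> exists n, pr (F n) < e.
Proof.
move=> mF niF F0 e e0.
have : mu \o F @ \oo --> mu (\bigcap_n F n).
  apply: nonincreasing_cvg_mu => //; last by rewrite F0.
  by rewrite [X in (X < _)%E](prE (mF 0%N)) ltry.
rewrite F0 measure0 => /fine_cvgP [_ /cvgrPdist_lt /(_ e e0) [n _ H]].
exists n; have := H n (leqnn n); rewrite sub0r normrN ger0_norm //.
exact: fine_ge0.
Qed.

Lemma pr_gt0_nonnegligible A : measurable A -> ~ mu.-negligible A -> 0 < pr A.
Proof.
move=> mA nA; rewrite lt_neqAle pr_ge0 andbT eq_sym; apply/eqP => A0.
by apply: nA; apply/negligibleP => //; exact: etrans (prE mA) (congr1 EFin A0).
Qed.

Lemma pr_markov (F : T -> R) (c eta : R) : measurable_fun setT F ->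
  (forall x, 0 <= F x) -> (\int[mu]_x (F x)%:E <= c%:E)%E -> 0 < eta ->
  pr [set x | eta <= F x] <= c / eta.
Proof.
move=> mF F0 Fc eta0; set E := [set x | _].
have mE : measurable E by exact: measurable_ge_cst.
rewrite ler_pdivlMr // -lee_fin mulrC EFinM -prE //; apply: le_trans Fc.
rewrite -integral_cst //.
have mF' : measurable_fun setT (EFin \o F) by exact/measurable_EFinP.
apply: (@le_trans _ _ (\int[mu]_(x in E) (F x)%:E)%E).
  apply: ge0_le_integral => //.
  - by move=> x _; rewrite lee_fin ltW.
  - exact: measurable_funS mF'.
apply: ge0_subset_integral => //.
by move=> x _; rewrite lee_fin.
Qed.

Lemma integral_le_pr (F : T -> R) A : measurable A -> measurable_fun setT F ->
  (forall x, 0 <= F x <= 1) -> (forall x, ~ A x -> F x = 0) ->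
  (\int[mu]_x (F x)%:E <= (pr A)%:E)%E.
Proof.
move=> mA mF F01 FA; have /= <- := prE mA.
have -> : mu A = (\int[mu]_x (\1_A x)%:E)%E by rewrite integral_indic // setIT.
apply: ge0_le_integral => //.
- by move=> x _; rewrite lee_fin; have /andP[] := F01 x.
- exact/measurable_EFinP.
- by apply/measurable_EFinP; exact: measurable_indic.
- move=> x _; rewrite lee_fin indicE; case: (pselect (A x)) => [Ax|nA].
    by rewrite mem_set //; have /andP[] := F01 x.
  by rewrite FA // memNset.
Qed.

End real_valued_probability.

Section shift.
Variable R : realType.
Local Notation X := (disc_seq R).
Local Notation T := (@disc_shift R).

Lemma coord_shift k (x : X) : coord k (T x) = coord (k + 1) x.
Proof. by []. Qed.

Lemma coord_iter k n (x : X) : coord k (iter n T x) = coord (k + n%:Z) x.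
Proof.
elim: n k => [|n IH] k; first by rewrite addr0.
by rewrite iterS coord_shift IH -addrA -intS.
Qed.

Lemma nbhs_shift (x : X) (U : set X) : nbhs (T x) U -> nbhs x (T @^-1` U).
Proof.
have FF : Filter (fun A : set X => nbhs x (T @^-1` A)).
  split; first by rewrite preimage_setT; exact: filterT.
    by move=> A B; rewrite preimage_setI; exact: filterI.
  by move=> A B AB; apply: filterS; exact: preimage_subset.
apply: (@nbhs_disc_seq R _ (T x) FF) => k V kV.
exact: (@continuous_coord R (k + 1) x V kV).
Qed.

Lemma continuous_shift : continuous T.
Proof. by move=> x U; exact: nbhs_shift.
Qed.

Lemma continuous_iter_shift n : continuous (iter n T).
Proof.
elim: n => [|n IH]; first by move=> x; exact: cvg_id.
exact: (continuous_compT IH continuous_shift).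
Qed.

Lemma measurable_shift : measurable_fun setT (T : borel X -> borel X).
Proof. exact: (continuous_measurable_borel_map continuous_shift). Qed.

Lemma measurable_preimage_shift n (A : set (borel X)) :
  measurable A -> measurable (iter n T @^-1` A : set (borel X)).
Proof.
move=> mA; rewrite -[_ @^-1` _]setTI.
exact: (continuous_measurable_borel_map (@continuous_iter_shift n)).
Qed.

Definition borel_shift (x : borel X) : borel X := T x.

HB.instance Definition _ :=
  isMeasurableFun.Build _ _ (borel X) (borel X) borel_shift measurable_shift.

(** Every open set is a union of cylinders, and these are countably many. *)
Lemma measurable_cylinders (A : set (borel X)) :
  measurable A -> <<s [set cylinder s | s in [set: cylinder_code]] >> A.
Proof.
apply: smallest_sub; first exact: smallest_sigma_algebra.
move=> U /open_bigcup_cylinder ->; rewrite bigcup_mkcond.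
set G := [set _ | _ in _].
apply: (@countable_bigcupT_measurable _ (g_sigma_algebraType G)).
  exact: (@countableP (seq (int * (rat * rat) * rat)) setT).
move=> s; case: ifP => _; last exact: measurable0.
by apply: sub_sigma_algebra; exists s.
Qed.

End shift.

Section invariance.
Variable R : realType.
Local Notation X := (disc_seq R).
Local Notation T := (@disc_shift R).
Variables (a : X) (mu : probability (borel X) R).
Hypothesis mu_le : forall (F : X -> R) (B c : R), continuous F ->
  (forall x, 0 <= F x <= B) -> 0 <= c ->
  cesaro_limsup_le (fun n => F (iter n T a)) c ->
  (\int[mu]_x (F x)%:E <= c%:E)%E.

Lemma cesaro_telescope (b : nat -> R) (B : R) (s : R) :
  (forall n, `|b n| <= B) -> `|s| = 1 ->
  cesaro_limsup_le (fun n => s * (b n.+1 - b n) + B) B.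
Proof.
move=> bB s1 e e0.
exists (Num.bound `|2 * B / e|) => N NN.
have -> : \sum_(n < N) (s * (b n.+2 - b n.+1) + B) = s * (b N.+1 - b 1) + B * N%:R.
  elim: {NN} N => [|N IH]; first by rewrite big_ord0 subrr !mulr0 addr0.
  by rewrite big_ord_recr /= IH -natr1; ring.
rewrite mulrDl addrC lerD2l.
have h1 : s * (b N.+1 - b 1) <= 2 * B.
  apply: le_trans (ler_norm _) _; rewrite normrM s1 mul1r.
  by apply: le_trans (ler_normB _ _) _; have := bB N.+1; have := bB 1%N; lra.
apply: le_trans h1 _; rewrite -ler_pdivrMl // mulrC.
apply: le_trans (ler_norm _) _.
apply: ltW; apply: (lt_le_trans (archi_boundP (normr_ge0 _))).
by rewrite ler_nat.
Qed.

(** The averages of [F \o T - F] telescope; adding the constant [B] makes the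
    function nonnegative, as the bounds on [mu] require. *)
Lemma integral_shift (F : X -> R) (B : R) : continuous F ->
  (forall x, 0 <= F x <= B) ->
  (\int[mu]_x (F (T x))%:E = \int[mu]_x (F x)%:E)%E.
Proof.
move=> cF F0B.
have F0 x : 0 <= F x by have /andP[] := F0B x.
have FB x : F x <= B by have /andP[] := F0B x.
have B0 : 0 <= B by apply: le_trans (F0 a) (FB a).
have cFT : continuous (F \o T).
  exact: (continuous_compT (@continuous_shift R) cF).
have main (G H : X -> R) : continuous G -> continuous H ->
    (forall x, 0 <= G x <= B) -> (forall x, 0 <= H x <= B) ->
    cesaro_limsup_le (fun n => G (iter n T a) - H (iter n T a) + B) B ->
    (\int[mu]_x (G x)%:E <= \int[mu]_x (H x)%:E)%E.
  move=> cG cH G0B H0B ces.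
  have cGH : continuous (fun x => G x - H x + B).
    exact: continuous_sub_add.
  have cBH : continuous (fun x => B - H x).
    rewrite (_ : (fun x => _) = (fun x => cst 0 x - H x + B)).
      by apply: continuous_sub_add => //; exact: cst_continuous.
    by apply/funext => x /=; ring.
  have := @mu_le _ (2 * B) B cGH _ B0 ces.
  have mG := continuous_measurable_borel cG.
  have mH := continuous_measurable_borel cH.
  have mBH := continuous_measurable_borel cBH.
  have BH0B x : 0 <= B - H x <= B by have := H0B x; lra.
  have -> : (\int[mu]_x (G x - H x + B)%:E =
             \int[mu]_x (G x)%:E + \int[mu]_x (B - H x)%:E)%E.
    rewrite -ge0_integralD //.
    - by apply: eq_integral => x _; rewrite -EFinD; congr (_%:E); ring.
    - by move=> x _; rewrite lee_fin; have /andP[] := G0B x.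
    - exact/measurable_EFinP.
    - by move=> x _; rewrite lee_fin; have /andP[] := BH0B x.
    - exact/measurable_EFinP.
  have -> : B%:E = (\int[mu]_x (H x)%:E + \int[mu]_x (B - H x)%:E)%E.
    rewrite -ge0_integralD //.
    - under eq_integral => x _ do rewrite -EFinD addrC subrK.
      by rewrite integral_cst //= probability_setT mule1.
    - by move=> x _; rewrite lee_fin; have /andP[] := H0B x.
    - exact/measurable_EFinP.
    - by move=> x _; rewrite lee_fin; have /andP[] := BH0B x.
    - exact/measurable_EFinP.
  rewrite leeD2rE; last exact: integral_bounded_fin_num BH0B.
  by apply => x; have := G0B x; have := H0B x; lra.
have bB n : `|F (iter n T a)| <= B by rewrite ger0_norm.
apply/eqP; rewrite eq_le; apply/andP; split.
- apply: (main (F \o T) F cFT cF (fun x => F0B (T x)) F0B).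
  move=> e e0; have [N0 H] := cesaro_telescope bB (normr1 R) e0.
  exists N0 => N /H; apply: le_trans; apply: ler_sum => n _.
  by rewrite mul1r.
- apply: (main F (F \o T) cF cFT F0B (fun x => F0B (T x))).
  have s1 : `|-1 : R| = 1 by rewrite normrN normr1.
  move=> e e0; have [N0 H] := cesaro_telescope bB s1 e0.
  exists N0 => N /H; apply: le_trans; apply: ler_sum => n _.
  by rewrite mulN1r opprB.
Qed.

(** A set where a continuous function is positive is exhausted by sets that
    bounded continuous functions separate from its complement. *)
Lemma pr_shift_positive (phi : X -> R) : continuous phi ->
  pr mu (T @^-1` [set x | 0 < phi x]) = pr mu [set x | 0 < phi x].
Proof.
move=> cphi; have mphi := continuous_measurable_borel cphi.
have cphiT : continuous (phi \o T).
  exact: (continuous_compT (@continuous_shift R) cphi).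
have mphiT := continuous_measurable_borel cphiT.
have mpos (psi : X -> R) : continuous psi ->
    measurable ([set x | 0 < psi x] : set (borel X)).
  by move=> cpsi; exact: measurable_gt_cst (continuous_measurable_borel cpsi).
have mge (psi : X -> R) c : continuous psi ->
    measurable ([set x | c <= psi x] : set (borel X)).
  by move=> cpsi; exact: measurable_ge_cst (continuous_measurable_borel cpsi).
pose F (n : nat) x := Num.min 1 (n.+1%:R * Num.max (phi x) 0).
have cF n : continuous (F n).
  exact: (continuous_compT cphi (@continuous_truncation R n.+1%:R)).
have cFT n : continuous (F n \o T).
  exact: (continuous_compT (@continuous_shift R) (cF n)).
have F01 n x : 0 <= F n x <= 1.
  by rewrite /F ge_min lexx le_min ler01 mulr_ge0 //= le_max lexx orbT.
have F1 n x : n.+1%:R^-1 <= phi x -> F n x = 1.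
  move=> h; apply/min_idPl; rewrite -ler_pdivrMl // mulr1.
  by rewrite le_max h.
have F0 n x : ~ 0 < phi x -> F n x = 0.
  move=> /negP; rewrite -leNgt => h; rewrite /F (max_idPr h) mulr0.
  by apply/min_idPr.
have upper n : (\int[mu]_x (F n x)%:E <= (pr mu [set x | 0 < phi x])%:E)%E.
  apply: integral_le_pr => //; first exact: mpos.
    exact: (continuous_measurable_borel (cF n)).
  exact: F0.
have upperT n : (\int[mu]_x (F n (T x))%:E <= (pr mu (T @^-1` [set x | 0 < phi x]))%:E)%E.
  apply: integral_le_pr; [exact: (mpos _ cphiT) | | by move=> x; exact: F01 |].
    exact: (continuous_measurable_borel (cFT n)).
  by move=> x; exact: F0.
have lower (psi : X -> R) (c : R) : continuous psi ->
    (forall n, pr mu [set x | n.+1%:R^-1 <= psi x] <= c) -> pr mu [set x | 0 < psi x] <= c.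
  move=> cpsi H; apply/ler_addgt0Pl => e e0.
  have [|||n hn] := @pr_small _ _ _ mu (fun n => [set x : borel X | 0 < psi x] `\`
      [set x | n.+1%:R^-1 <= psi x]) _ _ _ _ e0.
  - by move=> i; apply: measurableD; [exact: mpos|exact: mge].
  - move=> i j ij; apply/subsetPset => x /= [p np]; split => // q; apply: np.
    by apply: le_trans q; rewrite lef_pV2 ?posrE ?ltr0n // ler_nat.
  - rewrite -subset0 => x /= h; have [p _] := h 0%N I.
    have [n _ hn] := @near_infty_natSinv_lt R (PosNum p).
    have [_ np] := h n I; apply: np => /=; apply: ltW.
    by have := hn n (leqnn n).
  apply: le_trans (lerD (ltW hn) (H n)); apply: pr_le2.
  - exact: mpos.
  - by apply: measurableD; [exact: mpos|exact: mge].
  - exact: mge.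
  - by move=> x p; have [q|q] := pselect (n.+1%:R^-1 <= psi x); [right|left].
apply/eqP; rewrite eq_le; apply/andP; split.
- apply: (lower (phi \o T)) => // n.
  have := @pr_markov _ _ _ mu (F n \o T) (pr mu [set x | 0 < phi x]) 1.
  rewrite divr1; set c := pr mu [set x | 0 < phi x] => H.
  apply: (@le_trans _ _ (pr mu [set x | 1 <= (F n \o T) x])).
    apply: pr_mono; [exact: mge| |by move=> x /= h; rewrite F1].
    exact: mge.
  apply: H => //.
  + exact: (continuous_measurable_borel (cFT n)).
  + by move=> x; have /andP[] := F01 n (T x).
  + by rewrite /= (@integral_shift (F n) 1 (cF n) (F01 n)).
- apply: lower => // n.
  have := @pr_markov _ _ _ mu (F n) (pr mu (T @^-1` [set x | 0 < phi x])) 1.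
  rewrite divr1 => H.
  apply: (@le_trans _ _ (pr mu [set x | 1 <= F n x])).
    by apply: pr_mono; [exact: mge|exact: mge|move=> x /= h; rewrite F1].
  apply: H => //.
  + exact: (continuous_measurable_borel (cF n)).
  + by move=> x; have /andP[] := F01 n x.
  + by rewrite -(@integral_shift (F n) 1 (cF n) (F01 n)).
Qed.

(** The cylinders are stable under intersection and generate the Borel sets, so
    that two finite measures that agree on them are equal. *)
Lemma pr_shift (A : set (borel X)) : measurable A ->
  pr mu (T @^-1` A) = pr mu A.
Proof.
move=> mA; rewrite /pr; congr fine.
pose S : {mfun borel X >-> borel X} := @borel_shift R.
pose G := [set cylinder s | s in [set: @cylinder_code]] : set (set (borel X)).
have -> : mu (T @^-1` A) = distribution mu S A by [].
have mcyl s : measurable (cylinder s : set (borel X)).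
  exact: measurable_gt_cst (continuous_measurable_borel (@continuous_slack R s)).
apply: (@g_sigma_algebra_measure_unique _ R (borel X) G _ (fun=> setT)) => //.
- by move=> _ [s _ <-].
- by move=> _; exists [::] => //; rewrite cylinder_nil.
- by rewrite bigcup_const.
- by move=> _ _ [s _ <-] [t _ <-]; exists (s ++ t) => //; rewrite cylinder_cat.
- move=> _ [s _ <-]; rewrite /distribution /pushforward.
  have mS : measurable (T @^-1` cylinder s : set (borel X)).
    exact: (measurable_preimage_shift 1).
  rewrite [LHS](prE mu mS) [RHS](prE mu (mcyl s)).
  by rewrite -(@pr_shift_positive (slack s)) //; exact: continuous_slack.
- by move=> _; rewrite /= probability_setT ltry.
- exact: measurable_cylinders.
Qed.

Lemma pr_iter_shift n (A : set (borel X)) : measurable A ->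
  pr mu (iter n T @^-1` A) = pr mu A.
Proof.
move=> mA; elim: n => [|n IH]; first by [].
rewrite -IH -[RHS]pr_shift; last exact: measurable_preimage_shift.
by congr pr; apply/seteqP; split=> x /=; rewrite -iterS iterSr.
Qed.

End invariance.

(** * Almost periodic sets and eigenvalues *)

Section almost_periodic_sets.
Variable R : realType.
Local Notation X := (disc_seq R).
Local Notation T := (@disc_shift R).
Variable mu : probability (borel X) R.
Hypothesis mu_inv : forall n (A : set (borel X)), measurable A ->
  pr mu (iter n T @^-1` A) = pr mu A.
Variable P : nat -> Prop.
Hypothesis P1 : P 1.
Hypothesis PM : forall m n, P m -> P n -> P (m * n)%N.

Definition symdiff (A B : set (borel X)) := (A `\` B) `|` (B `\` A).

(** Asking for all multiples of one period, instead of some sequence of shifts,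
    gives any two almost periodic sets a common period, the product of theirs. *)
Definition almost_periodic_set (A : set (borel X)) :=
  measurable A /\ forall e : R, 0 < e -> exists Q : nat, P Q /\
    forall j, pr mu (symdiff A (iter (j * Q) T @^-1` A)) <= e.

Lemma measurable_symdiff A n : measurable A ->
  measurable (symdiff A (iter n T @^-1` A)).
Proof.
move=> mA; have mAn := measurable_preimage_shift n mA.
by apply: measurableU; apply: measurableD.
Qed.

Lemma almost_periodic_common (A : nat -> set (borel X)) :
  (forall i, almost_periodic_set (A i)) -> forall (n : nat) (e : R), 0 < e ->
  exists Q : nat, P Q /\ forall i j, (i < n)%N ->
    pr mu (symdiff (A i) (iter (j * Q) T @^-1` A i)) <= e.
Proof.
move=> apA n e e0; elim: n => [|n [Q [PQ HQ]]]; first by exists 1%N.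
have [_ /(_ e e0) [Q' [PQ' HQ']]] := apA n.
exists (Q * Q')%N; split; first exact: PM.
move=> i j; rewrite ltnS leq_eqVlt => /orP[/eqP ->|lin].
  by rewrite mulnA; exact: HQ'.
by rewrite (mulnC Q) mulnA; exact: HQ.
Qed.

(** A countable union is close in measure to a finite one, and finitely many
    sets have a common period. *)
Lemma almost_periodic_sigma_algebra : sigma_algebra setT almost_periodic_set.
Proof.
split.
- split => // e e0; exists 1%N; split => // j.
  by rewrite /symdiff preimage_set0 setD0 setU0 pr0 ltW.
- move=> A [mA apA]; split; first exact: measurableD.
  move=> e e0; have [Q [PQ HQ]] := apA e e0; exists Q; split => // j.
  rewrite (_ : symdiff _ _ = symdiff A (iter (j * Q) T @^-1` A)) //.
  rewrite /symdiff !setTD preimage_setC.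
  by rewrite !setDE !setCK [in LHS]setUC [_ `&` A]setIC (setIC _ (_ @^-1` A)).
- move=> A apA; have mA i : measurable (A i) by have [] := apA i.
  have mU : measurable (\bigcup_k A k) by exact: bigcupT_measurable.
  split => // e e0; have e4 : 0 < e / 4 by rewrite divr_gt0.
  pose V n : set (borel X) := \bigcup_(i < n) A i.
  have mV n : measurable (V n) by exact: bigcup_measurable.
  have mUV n : measurable ((\bigcup_k A k) `\` V n) by exact: measurableD.
  have [|||n hn] := @pr_small _ _ _ mu (fun n => (\bigcup_k A k) `\` V n) _ _ _ _ e4.
  + exact: mUV.
  + move=> i j ij; apply/subsetPset => x [Ux nV]; split => // -[k /= ki Ak].
    by apply: nV; exists k => //=; apply: leq_trans ij.
  + rewrite -subset0 => x h; have [[k _ Ak] _] := h 0%N I.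
    by have [_] := h k.+1 I; apply; exists k => /=.
  have en : 0 < e / (2 * n.+1%:R) by rewrite divr_gt0 // mulr_gt0.
  have [Q [PQ HQ]] := almost_periodic_common apA n en.
  exists Q; split => // j; set m := (j * Q)%N.
  pose S i := symdiff (A i) (iter m T @^-1` A i).
  have mS i : measurable (S i) by exact: measurable_symdiff.
  have mbS : measurable (\bigcup_(i < n) S i) by exact: bigcup_measurable.
  set D := (\bigcup_k A k) `\` V n.
  have mD : measurable D by exact: mUV.
  have mTD : measurable (iter m T @^-1` D : set (borel X)) by exact: measurable_preimage_shift.
  have sub : symdiff (\bigcup_k A k) (iter m T @^-1` (\bigcup_k A k)) `<=`
      (\bigcup_(i < n) S i) `|` (D `|` iter m T @^-1` D).
    move=> x [[Ux nTx]|[Tx nUx]].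
    - case: (pselect (V n x)) => [[i /= lin Ai]|nV]; last by right; left.
      by left; exists i => //=; left; split => // Ti; apply: nTx; exists i.
    - case: (pselect (V n (iter m T x))) => [[i /= lin Ai]|nV]; last by right; right.
      by left; exists i => //=; right; split => // Ti; apply: nUx; exists i.
  have h1 : pr mu (symdiff (\bigcup_k A k) (iter m T @^-1` (\bigcup_k A k))) <=
      pr mu (\bigcup_(i < n) S i) + pr mu (D `|` iter m T @^-1` D).
    by apply: pr_le2 => //; [exact: measurable_symdiff|exact: measurableU].
  have h2 : pr mu (D `|` iter m T @^-1` D) <= pr mu D + pr mu (iter m T @^-1` D).
    by apply: pr_le2 => //; exact: measurableU.
  have h3 : pr mu (\bigcup_(i < n) S i) <= e / 2.
    apply: le_trans (pr_bigU _ _ mS) _.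
    apply: (@le_trans _ _ (\sum_(i < n) e / (2 * n.+1%:R))).
      by apply: ler_sum => i _; exact: HQ.
    rewrite sumr_const card_ord -[leLHS]mulr_natr.
    have n0 : (n.+1%:R : R) != 0 by rewrite pnatr_eq0.
    have -> : e / (2 * n.+1%:R) * n%:R = e / 2 * (n%:R / n.+1%:R) by field.
    apply: ler_piMr; first by rewrite divr_ge0 // ltW.
    by rewrite ler_pdivrMr ?ltr0n // mul1r ler_nat leqnSn.
  move: h2; rewrite mu_inv // => h2; move: hn; rewrite -/D => hn; lra.
Qed.

Hypothesis coord_almost_periodic : forall e : R, 0 < e ->
  exists Q : nat, P Q /\ forall j (eta : R), 0 < eta ->
    pr mu [set x | eta <= nrm (coord 0 (iter (j * Q) T x) - coord 0 x)] <= e / eta.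

Lemma measurable_coord_dist m k (eta : R) :
  measurable ([set x | eta <= nrm (coord k (iter m T x) - coord k x)] : set (borel X)).
Proof.
have mc l : measurable_fun setT (coord l : borel X -> borel R[i]).
  exact: (continuous_measurable_borel_map (@continuous_coord R l)).
have mF : measurable_fun setT
    (fun x : borel X => nrm (coord k (iter m T x) - coord k x)).
  under eq_fun do rewrite coord_iter.
  apply: measurable_nrm; under eq_fun do rewrite raddfB /=.
    by apply: measurable_funB; apply: measurable_Re.
  by apply: measurable_funB; apply: measurable_Im.
exact: measurable_ge_cst mF.
Qed.

(** The measure is invariant, and powers of the shift move each coordinate to
    the coordinate 0 or back. *)
Lemma pr_coord_dist m k (eta : R) :
  pr mu [set x | eta <= nrm (coord k (iter m T x) - coord k x)] =
  pr mu [set x | eta <= nrm (coord 0 (iter m T x) - coord 0 x)].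
Proof.
have shiftE l n : iter n T @^-1`
    [set x | eta <= nrm (coord l (iter m T x) - coord l x)] =
    [set x | eta <= nrm (coord (l + n%:Z) (iter m T x) - coord (l + n%:Z) x)].
  apply/seteqP; split=> x /=; rewrite -iterD addnC iterD !coord_iter;
  by rewrite -!addrA [n%:Z + _]addrC.
case: k => n.
  rewrite -[LHS]/(pr mu [set x | eta <= nrm (coord n%:Z (iter m T x) - coord n%:Z x)]).
  rewrite -[n%:Z]add0r -shiftE mu_inv //; exact: measurable_coord_dist.
have <- := @mu_inv n.+1 _ (measurable_coord_dist m (Negz n) eta).
by rewrite shiftE NegzE addNr.
Qed.

(** A shift that moves the coordinate by less than [1 / n.+1] changes the sign
    of the slack only where the slack is at most [1 / n.+1], before or after
    the shift; this set has small measure for large [n]. *)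
Lemma constraint_almost_periodic t :
  almost_periodic_set [set x | 0 < constraint_slack t x].
Proof.
have mh : measurable_fun setT (constraint_slack t : borel X -> R).
  exact: (continuous_measurable_borel (@continuous_constraint_slack R t)).
have mpos : measurable ([set x | 0 < constraint_slack t x] : set (borel X))
  by exact: measurable_gt_cst.
split => // e e0; have e4 : 0 < e / 4 by rewrite divr_gt0.
pose B (n : nat) : set (borel X) := [set x | 0 < constraint_slack t x <= n.+1%:R^-1].
have mB n : measurable (B n).
  rewrite (_ : B n = constraint_slack t @^-1` `]0, n.+1%:R^-1]).
    by rewrite -[_ @^-1` _]setTI; exact: mh.
  by apply/seteqP; split=> x /=; rewrite in_itv.
have [||n hn] := pr_small mu mB _ _ e4.
- move=> i j ij; apply/subsetPset => x /andP[x0 xj]; apply/andP; split => //.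
  by apply: le_trans xj _; rewrite lef_pV2 ?posrE ?ltr0n // ler_nat.
- rewrite -subset0 => x h; have /andP[x0 _] := h 0%N I.
  have [n _ hn] := @near_infty_natSinv_lt R (PosNum x0).
  have /andP[_] := h n I; rewrite leNgt => /negP; apply.
  by have := hn n (leqnn n).
have eta0 : 0 < n.+1%:R^-1 :> R by rewrite invr_gt0.
have [Q [PQ HQ]] := coord_almost_periodic (mulr_gt0 e4 eta0).
exists Q; split => // j; set m := (j * Q)%N.
set D := [set x | n.+1%:R^-1 <= nrm (coord t.1.1 (iter m T x) - coord t.1.1 x)].
have mD : measurable (D : set (borel X)) by exact: measurable_coord_dist.
have prD : pr mu D <= e / 4.
  rewrite /D pr_coord_dist; apply: le_trans (HQ j _ eta0) _.
  by rewrite mulfK // gt_eqF.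
have mTB : measurable (iter m T @^-1` B n : set (borel X)) by exact: measurable_preimage_shift.
have sub : symdiff [set x | 0 < constraint_slack t x]
   (iter m T @^-1` [set x | 0 < constraint_slack t x]) `<=`
   D `|` (B n `|` iter m T @^-1` B n).
  move=> x; have close : ~ D x ->
      `|constraint_slack t (iter m T x) - constraint_slack t x| < n.+1%:R^-1.
    move=> /negP; rewrite -ltNge; apply: le_lt_trans.
    rewrite /constraint_slack opprB addrC addrA subrK distrC.
    by apply: le_trans (nrm_lip _ _) _; rewrite opprB addrA subrK.
  case: (pselect (D x)) => [?|/close]; first by left.
  rewrite ltr_norml => /andP[h1 h2] [[/= x0 /negP]|[/= x0 /negP]];
    rewrite -leNgt => x1; right; [left|right]; rewrite /B /= x0 /=;
    move: h1 h2 x0 x1; move: (n.+1%:R^-1) (constraint_slack t x)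
      (constraint_slack t (iter m T x)) => u v w *; lra.
have mU : measurable (B n `|` iter m T @^-1` B n : set (borel X)) by exact: measurableU.
have := pr_le2 mu (measurable_symdiff m mpos) mD mU sub.
have := pr_le2 mu mU (mB n) mTB (fun x => id).
by rewrite mu_inv //; move: prD hn; lra.
Qed.

Lemma all_almost_periodic (A : set (borel X)) :
  measurable A -> almost_periodic_set A.
Proof.
move=> /measurable_cylinders; apply: smallest_sub.
  exact: almost_periodic_sigma_algebra.
move=> _ [s _ <-].
have [h0 hC hU] := almost_periodic_sigma_algebra.
have hT : almost_periodic_set setT by have := hC _ h0; rewrite setD0.
have hI A1 A2 : almost_periodic_set A1 -> almost_periodic_set A2 ->
    almost_periodic_set (A1 `&` A2).
  move=> a1 a2; pose F n : set (borel X) := if n is 0%N then ~` A1 else ~` A2.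
  have hF n : almost_periodic_set (F n).
    by case: n => [|n]; rewrite /F -setTD; exact: hC.
  have -> : A1 `&` A2 = setT `\` \bigcup_n F n.
    apply/seteqP; split=> x; first by move=> [x1 x2]; split => // -[[|n] _].
    move=> [_ h]; split; apply: contrapT => nx; apply: h.
      by exists 0%N.
    by exists 1%N.
  exact/hC/hU.
elim: s => [|t s IH]; first by rewrite cylinder_nil.
by rewrite cylinder_cons; apply: hI IH; exact: constraint_almost_periodic.
Qed.

End almost_periodic_sets.

Section eigenfunctions_of_almost_periodic_systems.
Variable R : realType.
Local Notation X := (disc_seq R).
Local Notation T := (@disc_shift R).
Variable mu : probability (borel X) R.
Hypothesis mu_inv : forall n (A : set (borel X)), measurable A ->
  pr mu (iter n T @^-1` A) = pr mu A.

(** The powers of a unimodular number other than 1 enter the left half plane: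
    otherwise doubling the angle repeatedly would double [1 - Re] forever. *)
Lemma unimodular_power_Re_lt0 (w : R[i]) : nrm w = 1 -> w != 1 ->
  exists j, complex.Re (w ^+ j) < 0.
Proof.
move=> w1 wn1; apply: contrapT => /forallNP H.
have Rege0 j : 0 <= complex.Re (w ^+ j) by rewrite leNgt; apply/negP/H.
have Re2 z : nrm z = 1 -> complex.Re (z ^+ 2) = 2 * complex.Re z ^+ 2 - 1 :> R.
  move=> z1; have := nrm_sqr z; rewrite z1 expr1n; case: z {z1} => a b /= h.
  by rewrite -!expr2 (_ : b ^+ 2 = 1 - a ^+ 2); [ring|rewrite h; ring].
pose c k := complex.Re (w ^+ (2 ^ k)).
have wk n : nrm (w ^+ n) = 1 by rewrite nrmX w1 expr1n.
have cS k : 1 - c k.+1 >= 2 * (1 - c k).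
  rewrite /c expnSr exprM Re2 //; have := Rege0 (2 ^ k)%N.
  have : complex.Re (w ^+ (2 ^ k)) <= 1.
    by apply: le_trans (ler_norm _) _; rewrite -(wk (2 ^ k)%N) abs_Re_le.
  move: (complex.Re _) => u; nra.
have c0 : 0 < 1 - c 0%N.
  rewrite /c expn0 expr1 subr_gt0 lt_neqAle; apply/andP; split; last first.
    by apply: le_trans (ler_norm _) _; rewrite -w1 abs_Re_le.
  apply: contraNneq wn1 => rw; rewrite eq_complex rw /= eqxx /=.
  have := nrm_sqr w; rewrite w1 rw expr1n => /eqP.
  by rewrite -subr_eq0 opprD addrA subrr sub0r oppr_eq0 sqrf_eq0.
have ck k : k%:R * (1 - c 0%N) <= 1 - c k.
  elim: k => [|k IH]; first by rewrite mul0r ltW // c0.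
  have := cS k; case: k IH => [|k] IH.
    by rewrite mul1r; lra.
  rewrite -natr1 mulrDl mul1r => h.
  have : 1 - c 0%N <= k.+1%:R * (1 - c 0%N).
    by rewrite ler_peMl ?ler1n // ltW.
  lra.
have := ck (Num.bound `|(1 - c 0%N)^-1|); have := Rege0 (2 ^ (Num.bound `|(1 - c 0%N)^-1|))%N.
rewrite -/(c _) => h1 h2; have := archi_boundP (normr_ge0 ((1 - c 0%N)^-1)).
have d0 : 0 <= (1 - c 0%N)^-1 by rewrite invr_ge0 ltW.
rewrite {1}(ger0_norm d0) -[X in X < _]div1r ltr_pdivrMr // => h3.
lra.
Qed.

(** A quarter plane is small enough to be moved off itself by any rotation by
    more than a right angle, and four of its rotations cover the plane minus
    the origin. *)
Definition sector (z : R[i]) := z != 0 /\ `|complex.Im z| <= complex.Re z.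

Lemma sector_rotated (w z : R[i]) : complex.Re w < 0 -> sector z -> ~ sector (w * z).
Proof.
move=> w0 [z0 hz] [_ hwz]; case: w z w0 z0 hz hwz => [w1 w2] [a b] /= w0 z0.
rewrite !ler_norml => /andP[h1 h2] /andP[h3 h4].
have a0 : 0 < a.
  rewrite lt_neqAle; apply/andP; split; last by lra.
  by apply: contra z0 => /eqP a0; rewrite eq_complex /= -a0 eqxx /=; apply/eqP; lra.
have ab : a <= b -> w1 * (a + b) + w2 * (a - b) < 0.
  move=> leab; have -> : b = a by lra.
  by rewrite subrr mulr0 addr0 nmulr_rlt0 //; lra.
have [w20|w20] := lerP 0 w2.
  have h5 : w2 * (a + b) >= 0 by apply: mulr_ge0; lra.
  have h6 : 0 <= w1 * (a - b) by lra.
  by rewrite nmulr_rge0 // in h6; have := ab; lra.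
have h5 : w2 * (a - b) <= 0 by apply: mulr_le0_ge0; lra.
have h6 : 0 <= w1 * (a + b) by lra.
rewrite nmulr_rge0 // in h6.
have : w2 * (a - b) < 0 by rewrite nmulr_rlt0 //; lra.
have : w1 * (a + b) <= 0 by apply: mulr_le0_ge0; lra.
lra.
Qed.

Lemma sector_cover (z : R[i]) : z != 0 ->
  sector z \/ sector (- z) \/ sector ('i%C * z) \/ sector (- ('i%C * z)).
Proof.
move=> z0; have i0 : 'i%C * z != 0.
  by rewrite mulf_neq0 // eq_complex /= oner_eq0 andbF.
rewrite /sector !oppr_eq0 z0 i0; case: z {z0 i0} => a b /=; rewrite !ler_norml.
rewrite !mul0r !mul1r sub0r add0r.
have [a0|a0] := lerP 0 a; have [b0|b0] := lerP 0 b.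
- by have [h|h] := lerP b a; [left|right; right; right]; split=> //; apply/andP; split; lra.
- by have [h|h] := lerP (- b) a; [left|right; right; left]; split=> //; apply/andP; split; lra.
- by have [h|h] := lerP b (- a); [right; left|right; right; right]; split=> //; apply/andP; split; lra.
- by have [h|h] := lerP (- b) (- a); [right; left|right; right; left]; split=> //; apply/andP; split; lra.
Qed.

Lemma measurable_sector (g : borel X -> R[i]) :
  measurable_fun setT (g : borel X -> borel R[i]) -> measurable [set x | sector (g x)].
Proof.
move=> mg; have mr := measurable_Re mg; have mi := measurable_Im mg.
have -> : [set x | sector (g x)] = [set x | 0 < nrm (g x)] `&`
   [set x | 0 <= complex.Re (g x) - `|complex.Im (g x)|].
  apply/seteqP; split=> x /=; rewrite /sector subr_ge0
    lt_neqAle nrm_ge0 andbT [0 == _]eq_sym nrm_eq0; exact.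
apply: measurableI.
  exact: measurable_gt_cst (measurable_nrm mr mi).
by apply/measurable_ge_cst/measurable_funB => //; apply: measurableT_comp.
Qed.

Variable P : nat -> Prop.
Hypothesis mu_almost_periodic : forall A : set (borel X), measurable A ->
  forall e : R, 0 < e -> exists Q : nat, P Q /\
    forall j, pr mu (symdiff A (iter (j * Q) T @^-1` A)) <= e.

(** If [Q alpha] were not an integer, some multiple of the period [Q] would
    turn the sector where the eigenfunction takes its values away from itself,
    which no almost invariant set of positive measure allows. *)
Lemma eigenvalue_denominator (alpha : R) (g : borel X -> R[i]) :
  measurable_fun setT (g : borel X -> borel R[i]) ->
  ~ (\forall x \ae mu, g x = 0) ->
  (\forall x \ae mu, g (T x) = circle_exp alpha * g x) ->
  exists Q : nat, P Q /\ Defs.frac (Q%:R * alpha) = 0.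
Proof.
move=> mg gn0 [N [mN muN0 NS]].
pose Z : set (borel X) := \bigcup_j (iter j T @^-1` N).
have mTN j : measurable (iter j T @^-1` N : set (borel X)).
  exact: measurable_preimage_shift.
have mZ : measurable Z by exact: bigcupT_measurable.
have prN : pr mu N = 0 by rewrite /pr muN0.
have muZ : mu Z = 0.
  apply/negligibleP => //; apply: negligible_bigcup => j.
  by apply/negligibleP => //; apply: etrans (prE mu (mTN j)) _; rewrite mu_inv // prN.
have prZ : pr mu Z = 0 by rewrite /pr muZ.
have gT x j : ~ Z x -> g (iter j T x) = circle_exp alpha ^+ j * g x.
  move=> nZ; elim: j => [|j IH]; first by rewrite mul1r.
  have -> : iter j.+1 T x = T (iter j T x) by [].
  rewrite exprS -mulrA -IH.
  apply: contrapT => h; apply: nZ; exists j => //.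
  exact: (NS (iter j T x)).
have mmul (c : R[i]) : measurable_fun setT ((fun x => c * g x) : borel X -> borel R[i]).
  have mr := measurable_Re mg; have mi := measurable_Im mg.
  apply: measurable_complex.
    rewrite (_ : (fun x => _) = (fun x => complex.Re c * complex.Re (g x) -
      complex.Im c * complex.Im (g x))).
      by apply: measurable_funB; apply: measurable_funM.
    by apply/funext => x; case: c => ? ?; case: (g x).
  rewrite (_ : (fun x => _) = (fun x => complex.Re c * complex.Im (g x) +
      complex.Im c * complex.Re (g x))).
    by apply: measurable_funD; apply: measurable_funM.
  by apply/funext => x; case: c => ? ?; case: (g x) => ? ? /=; rewrite addrC.
have [c prc] : exists c : R[i], 0 < pr mu [set x | sector (c * g x)].
  apply: contrapT => /forallNP H; apply: gn0.
  have negl c : mu.-negligible [set x | sector (c * g x)].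
    apply: contrapT => nn; apply: (H c); apply: pr_gt0_nonnegligible => //.
    exact: (measurable_sector (mmul c)).
  have := negligibleU (negligibleU (negl 1) (negl (-1)))
     (negligibleU (negl 'i%C) (negl (- 'i%C))).
  apply: negligibleS => x /= /eqP gx0.
  have [h|[h|[h|h]]] := sector_cover gx0.
  - by left; left; rewrite /= mul1r.
  - by left; right; rewrite /= mulN1r.
  - by right; left.
  - by right; right; rewrite /= mulNr.
set E := [set x | sector (c * g x)] in prc.
have mE : measurable E by exact: (measurable_sector (mmul c)).
have e0 : 0 < pr mu E / 2 by rewrite divr_gt0.
have [Q [PQ HQ]] := mu_almost_periodic mE e0.
exists Q; split => //; apply: circle_exp_eq1; rewrite circle_expMn.
apply/eqP/negPn/negP => wn1.
have w1 : nrm (circle_exp alpha ^+ Q) = 1 by rewrite nrmX nrm_circle_exp expr1n.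
have [j wj] := unimodular_power_Re_lt0 w1 wn1.
have mS : measurable (symdiff E (iter (j * Q) T @^-1` E)) by exact: measurable_symdiff.
have sub : E `<=` symdiff E (iter (j * Q) T @^-1` E) `|` Z.
  move=> x Ex; case: (pselect (Z x)) => [|nZ]; first by right.
  left; left; split => //; rewrite /E /= gT // mulnC exprM mulrCA.
  exact: sector_rotated.
have := pr_le2 mu mE mS mZ sub; have := HQ j; rewrite prZ; lra.
Qed.

End eigenfunctions_of_almost_periodic_systems.

(** * Subgroups of the circle *)

Section circle_group.
Variable R : realType.

Lemma frac_eq (x y : R) (m : int) : x = y + m%:~R -> Defs.frac x = Defs.frac y.
Proof.
move=> ->; rewrite /Defs.frac.
have -> : Num.floor (y + m%:~R) = Num.floor y + m by rewrite floorDrz ?intrKfloor // ?intr_int.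
by rewrite intrD; ring.
Qed.

Lemma frac_id (x : R) : 0 <= x < 1 -> Defs.frac x = x.
Proof.
by move=> x01; rewrite /Defs.frac (@floor_def _ x 0) ?subr0 // add0r.
Qed.

Lemma fracB (x y : R) : Defs.frac (Defs.frac x - Defs.frac y) = Defs.frac (x - y).
Proof.
symmetry; apply: (@frac_eq _ _ (Num.floor x - Num.floor y)).
by rewrite /Defs.frac intrB; ring.
Qed.

Variable H : set R.
Hypothesis gH : circle_subgroup H.

(** Subgroups of the circle are handled through their preimages in [R], which
    are closed under the operations of [R] itself. *)
Definition liftH (x : R) := H (Defs.frac x).

Lemma liftHB x y : liftH x -> liftH y -> liftH (x - y).
Proof. by case: gH => _ _ HB hx hy; rewrite /liftH -fracB; exact: HB. Qed.

Lemma liftH0 : liftH 0.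
Proof. by case: gH => _ H0 _; rewrite /liftH frac_id // lexx ltr01. Qed.

Lemma liftHD x y : liftH x -> liftH y -> liftH (x + y).
Proof.
move=> hx hy; rewrite -[y]opprK; apply: liftHB => //.
by rewrite -[- y]sub0r; apply: liftHB => //; exact: liftH0.
Qed.

Lemma liftHn n x : liftH x -> liftH (n%:R * x).
Proof.
move=> hx; elim: n => [|n IH]; first by rewrite mul0r; exact: liftH0.
by rewrite -natr1 mulrDl mul1r; exact: liftHD.
Qed.

Lemma liftHz (m : int) x : liftH x -> liftH (m%:~R * x).
Proof.
move=> hx; case: m => n; first exact: liftHn.
rewrite NegzE mulrNz mulNr -sub0r; apply: liftHB; first exact: liftH0.
exact: liftHn.
Qed.

(** By Bezout a point of order dividing [Q] is a sum of points of prime power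
    order. *)
Lemma liftH_smooth (A : nat -> Prop) :
  (forall p s, prime p -> A p -> (0 < s)%N -> liftH (p%:R ^+ s)^-1) ->
  forall (Q : nat), (0 < Q)%N -> (forall p, prime p -> (p %| Q)%N -> A p) ->
  forall x : R, Defs.frac (Q%:R * x) = 0 -> liftH x.
Proof.
move=> HA Q; have [n] := ubnP Q; elim: n Q => // n IH Q ltQ Q0 QA x Qx.
have [Q1|Q1] := leqP Q 1.
  have {}Q1 : Q = 1%N by apply/eqP; rewrite eqn_leq Q1.
  move: Qx; rewrite Q1 mul1r => Qx.
  rewrite /liftH Qx -(@frac_id 0) ?lexx ?ltr01 //; exact: liftH0.
pose p := pdiv Q; have pp : prime p by exact: pdiv_prime.
have pQ : (p %| Q)%N by exact: pdiv_dvd.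
pose s := logn p Q; have s0 : (0 < s)%N by rewrite logn_gt0 mem_primes pp Q0.
have [Q' cop QE] := pfactor_coprime pp Q0; rewrite -/s in QE.
have Q'0 : (0 < Q')%N by move: Q0; rewrite QE muln_gt0 => /andP[].
have ltQ' : (Q' < Q)%N.
  by rewrite [ltnRHS]QE -[ltnLHS]muln1 ltn_pmul2l // -{1}(expn0 p) ltn_exp2l // prime_gt1.
have pcop : coprime (p ^ s) Q' by rewrite coprimeXl.
have ps0 : (0 < p ^ s)%N by rewrite expn_gt0 prime_gt0.
have [u v uv _] := egcdnP Q' ps0.
have {}uv : (u * p ^ s = v * Q' + 1)%N by rewrite uv (eqP pcop).
have intQx : Q%:R * x = (Num.floor (Q%:R * x))%:~R :> R.
  by apply/eqP; rewrite -subr_eq0; apply/eqP.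
set k := Num.floor _ in intQx.
have QER : Q%:R = Q'%:R * p%:R ^+ s :> R by rewrite QE natrM natrX.
have pz : p%:R ^+ s != 0 :> R by rewrite expf_neq0 // pnatr_eq0 -lt0n prime_gt0.
have xE : x = u%:R * (p%:R ^+ s * x) - v%:R * (Q'%:R * x).
  have : (u%:R * p%:R ^+ s : R) = v%:R * Q'%:R + 1.
    by rewrite -natrX -natrM uv natrD natrM.
  by rewrite !mulrA => ->; ring.
rewrite xE; apply: liftHB; apply: liftHn.
  apply: (IH Q') => //; first exact: leq_trans ltQ' _.
    by move=> r pr rQ; apply: QA => //; rewrite QE dvdn_mulr.
  by rewrite mulrA -QER.
have -> : Q'%:R * x = k%:~R * (p%:R ^+ s)^-1.
  by apply: (mulIf pz); rewrite mulfVK // -intQx QER; ring.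
by apply/liftHz/HA => //; exact: QA.
Qed.

End circle_group.

Section eigenfunction_group.
Variable R : realType.
Local Notation X := (disc_seq R).
Local Notation T := (@disc_shift R).
Variable mu : probability (borel X) R.

(** Without ergodicity a product of eigenfunctions may be zero; those that vanish
    almost nowhere make their eigenvalues a group. *)
Definition strong_spectrum : set R :=
  [set alpha | 0 <= alpha < 1 /\ exists g : borel X -> R[i],
     [/\ measurable_fun setT (g : borel X -> borel R[i]),
         forall x, nrm (g x) <= 1,
         \forall x \ae mu, g x != 0 &
         \forall x \ae mu, g (T x) = circle_exp alpha * g x]].

Lemma strong_spectrum_sub : strong_spectrum `<=` spectrum mu T.
Proof.
move=> alpha [a01 [g [mg g1 gn0 gT]]]; split => //; exists g; split => //.
- split => //; have mr := measurable_Re mg; have mi := measurable_Im mg.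
  have mn := measurable_nrm mr mi.
  apply: (@le_lt_trans _ _ (\int[mu]_x (cst 1%:E x))%E); last first.
    by rewrite integral_cst //= probability_setT mule1 ltry.
  apply: ge0_le_integral => //.
  + by move=> x _; rewrite lee_fin sqr_ge0.
  + by apply/measurable_EFinP; apply: measurable_funX.
  + by move=> x _; rewrite lee_fin exprn_ile1 ?nrm_ge0 // g1.
- move=> g0; have [N [mN muN sub]] : \forall x \ae mu, False.
    by apply: filterS2 gn0 g0 => x /eqP.
  have NT : N = setT by apply/seteqP; split => // x _; apply: sub.
  move: muN; rewrite NT => muT; have := probability_setT mu; rewrite [LHS]muT.
  by move=> /eqP; rewrite eqe eq_sym oner_eq0.
Qed.

Lemma strong_spectrum_subgroup : circle_subgroup strong_spectrum.
Proof.
split.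
- by move=> x [x01 _]; rewrite /= in_itv.
- split; first by rewrite lexx ltr01.
  exists (fun=> 1); split => //; first by move=> x; rewrite nrm1.
  + by apply: aeW => x; exact: oner_neq0.
  + by apply: aeW => x; rewrite circle_exp0 mulr1.
- move=> x y [x01 [g [mg g1 gn0 gT]]] [y01 [h [mh h1 hn0 hT]]].
  split; first exact: frac_bounds.
  have mgr := measurable_Re mg; have mgi := measurable_Im mg.
  have mhr := measurable_Re mh; have mhi := measurable_Im mh.
  exists (fun t => g t * (h t)^*); split.
  + apply: measurable_complex.
      rewrite (_ : (fun t => _) = fun t => complex.Re (g t) * complex.Re (h t) +
         complex.Im (g t) * complex.Im (h t)).
        by apply: measurable_funD; apply: measurable_funM.
      by apply/funext => t; case: (g t) (h t) => a b [c d] /=; ring.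
    rewrite (_ : (fun t => _) = fun t => complex.Im (g t) * complex.Re (h t) -
         complex.Re (g t) * complex.Im (h t)).
      by apply: measurable_funB; apply: measurable_funM.
    by apply/funext => t; case: (g t) (h t) => a b [c d] /=; ring.
  + by move=> t; rewrite nrmM nrm_conj mulr_ile1 ?nrm_ge0.
  + apply: filterS2 gn0 hn0 => t gt ht.
    by rewrite mulf_neq0 // -nrm_eq0 nrm_conj nrm_eq0.
  + apply: (negligibleS _ (negligibleU gT hT)); rewrite -setCI.
    apply: subsetC => t [/= -> ->].
    rewrite circle_exp_frac circle_expD circle_expN -(conj_unit (nrm_circle_exp y)).
    by rewrite rmorphM /=; ring.
Qed.

End eigenfunction_group.

(** * Fourier averages along the shift *)

Section geometric_decay.
Variable R : realType.

Lemma cvgn_geometric_decay (u : nat -> R) n :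
  (forall i, (n <= i)%N -> `|u i - u i.+1| <= 2^-1 ^+ i) -> cvgn u.
Proof.
pose e_ i : R := 2^-1 ^+ i; rewrite -/(e_ _).
have e_gt0 i : 0 < e_ i by rewrite exprn_gt0.
have eS i : e_ i = 2 * e_ i.+1 by rewrite /e_ exprS mulrA mulfV // mul1r.
(* [w] decreases to the limit: the added term dominates all later moves. *)
move=> du; pose w k := u (k + n)%N + 2 * e_ (k + n)%N.
have dw k := du _ (leq_addl k n).
have wn : nonincreasing_seq w.
  apply/nonincreasing_seqP => k; rewrite /w addSn.
  have := dw k; rewrite ler_norml -/(e_ _) => /andP[h1 h2].
  by have := eS (k + n)%N; lra.
have wl k : u n - 2 * e_ n <= u (k + n)%N - 2 * e_ (k + n)%N.
  elim: k => [|k IH]; first by [].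
  apply: le_trans IH _; rewrite addSn.
  have := dw k; rewrite ler_norml -/(e_ _) => /andP[h1 h2].
  by have := eS (k + n)%N; lra.
have cw : cvgn w.
  apply: (nonincreasing_is_cvgn wn); exists (u n - 2 * e_ n) => _ [k _ <-].
  by have := wl k; have := e_gt0 (k + n)%N; rewrite /w; lra.
have ce : (fun k => 2 * e_ (k + n)%N) @ \oo --> (0 : R).
  rewrite -[X in _ --> X](mulr0 2); apply: cvgM; first exact: cvg_cst.
  rewrite (cvg_shiftn n e_); apply: cvg_expr.
  by rewrite ger0_norm //; lra.
have /cvg_ex [l wl'] : cvgn (fun k => w k - 2 * e_ (k + n)%N).
  by apply: is_cvgB => //; apply/cvg_ex; exists 0.
apply/cvg_ex; exists l; rewrite -(cvg_shiftn n).
rewrite (_ : (fun k => u (k + n)%N) = (fun k => w k - 2 * e_ (k + n)%N)) //.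
by apply/funext => k; rewrite /w addrK.
Qed.

End geometric_decay.

Section continuous_complex_functions.
Variables (R : realType) (T : topologicalType).
Implicit Types f g : T -> R[i].

Lemma continuous_complex f : continuous (fun x => complex.Re (f x)) ->
  continuous (fun x => complex.Im (f x)) -> continuous f.
Proof.
move=> cr ci x V /nbhs_complexP [e e0 eV].
have e2 : 0 < e / 2 by rewrite divr_gt0.
have /cvgrPdist_lt /(_ _ e2) hr := cr x.
have /cvgrPdist_lt /(_ _ e2) hi := ci x.
apply: filterS2 hr hi => y /= yr yi; apply: eV => /=.
by apply: le_lt_trans (nrm_ReIm _) _; rewrite !raddfB /=; lra.
Qed.

Lemma continuous_ReP f : continuous f -> continuous (fun x => complex.Re (f x)).
Proof. by move=> cf; exact: (continuous_compT cf (@continuous_Re R)). Qed.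

Lemma continuous_ImP f : continuous f -> continuous (fun x => complex.Im (f x)).
Proof. by move=> cf; exact: (continuous_compT cf (@continuous_Im R)). Qed.

Lemma continuous_nrmP f : continuous f -> continuous (fun x => nrm (f x)).
Proof. by move=> cf; exact: (continuous_compT cf (@continuous_nrm R)). Qed.

Lemma continuous_caddP f g : continuous f -> continuous g ->
  continuous (fun x => f x + g x).
Proof.
move=> cf cg; apply: continuous_complex.
  under eq_fun do rewrite raddfD /=.
  move=> x; apply: cvgD; [exact: continuous_ReP|exact: continuous_ReP].
under eq_fun do rewrite raddfD /=.
by move=> x; apply: cvgD; [exact: continuous_ImP|exact: continuous_ImP].
Qed.

Lemma continuous_cmulP (c : R[i]) f : continuous f -> continuous (fun x => c * f x).
Proof.
move=> cf; apply: continuous_complex.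
  rewrite (_ : (fun x => _) = fun x => complex.Re c * complex.Re (f x) -
    complex.Im c * complex.Im (f x)).
    move=> x; apply: cvgB; apply: cvgM; try exact: cvg_cst.
      exact: continuous_ReP.
    exact: continuous_ImP.
  by apply/funext => x; case: c => ? ?; case: (f x).
rewrite (_ : (fun x => _) = fun x => complex.Re c * complex.Im (f x) +
    complex.Im c * complex.Re (f x)).
  move=> x; apply: cvgD; apply: cvgM; try exact: cvg_cst.
    exact: continuous_ImP.
  exact: continuous_ReP.
by apply/funext => x; case: c => ? ?; case: (f x) => ? ?.
Qed.

Lemma continuous_csubP f g : continuous f -> continuous g ->
  continuous (fun x => f x - g x).
Proof.
move=> cf cg; rewrite (_ : (fun x => _) = fun x => f x + -1 * g x).
  exact: (continuous_caddP cf (@continuous_cmulP (-1) g cg)).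
by apply/funext => x; rewrite mulN1r.
Qed.

Lemma continuous_csumP n (F : nat -> T -> R[i]) : (forall i, continuous (F i)) ->
  continuous (fun x => \sum_(i < n) F i x).
Proof.
move=> cF; elim: n => [|n IH].
  under eq_fun do rewrite big_ord0; exact: cst_continuous.
by under eq_fun do rewrite big_ord_recr /=; exact: continuous_caddP.
Qed.

End continuous_complex_functions.

Section fourier_averages.
Variable R : realType.
Local Notation X := (disc_seq R).
Local Notation T := (@disc_shift R).

Definition fourier_avg (z : R[i]) (J : nat) (x : X) : R[i] :=
  J%:R^-1 * \sum_(j < J) z ^+ j * coord j%:Z x.

Lemma continuous_fourier_avg z J : continuous (fourier_avg z J).
Proof.
apply: continuous_cmulP; apply: (@continuous_csumP _ _ J
  (fun j x => z ^+ j * coord j%:Z x)) => j.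
by apply: continuous_cmulP; exact: continuous_coord.
Qed.

Variable z : R[i].
Hypothesis z1 : nrm z = 1.

Lemma nrm_fourier_avg J x : nrm (fourier_avg z J x) <= 1.
Proof.
rewrite /fourier_avg nrmM nrmV nrm_nat.
case: J => [|J]; first by rewrite big_ord0 nrm0 mulr0.
rewrite ler_pdivrMl ?ltr0n // mulr1; apply: le_trans (nrm_sum _ _ _) _.
rewrite -[leRHS]mulr1 -[X in X%:R]card_ord -sumr_const mulr_suml.
by apply: ler_sum => i _; rewrite mul1r nrmM nrmX z1 expr1n mul1r nrm_coord.
Qed.

Lemma fourier_avg_shift J x : (0 < J)%N ->
  nrm (fourier_avg z J (T x) - z^-1 * fourier_avg z J x) <= 2 / J%:R.
Proof.
move=> J0; have z0 : z != 0 by rewrite -nrm_eq0 z1 oner_eq0.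
have -> : fourier_avg z J (T x) - z^-1 * fourier_avg z J x =
    J%:R^-1 * (z^-1 * (z ^+ J * coord J%:Z x - coord 0 x)).
  rewrite /fourier_avg mulrCA -mulrBr; congr (_ * _).
  apply: (mulfI z0); rewrite mulrBr !mulVKf // mulr_sumr.
  have -> : \sum_(j < J) z * (z ^+ j * coord j%:Z (T x)) =
            \sum_(j < J) z ^+ j.+1 * coord j.+1%:Z x.
    by apply: eq_bigr => j _; rewrite mulrA -exprS coord_shift -addn1 PoszD.
  elim: {J0} J => [|J IH]; first by rewrite !big_ord0 expr0 mul1r !subrr.
  by rewrite !big_ord_recr /= opprD addrACA IH; ring.
rewrite nrmM nrmV nrm_nat nrmM nrmV z1 invr1 mul1r mulrC ler_pM2r ?invr_gt0 ?ltr0n //.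
apply: le_trans (nrmB _ _) _; rewrite nrmM nrmX z1 expr1n mul1r.
by have := nrm_coord J%:Z x; have := nrm_coord 0 x; lra.
Qed.

Variable mu : probability (borel X) R.
Hypothesis mu_inv : forall n (A : set (borel X)), measurable A ->
  pr mu (iter n T @^-1` A) = pr mu A.
Variable c : R.
Hypothesis c0 : 0 < c.
Hypothesis small : forall e : R, 0 < e -> exists J0 : nat, (0 < J0)%N /\
  forall J J', (0 < J)%N -> (0 < J')%N -> (J0 %| J)%N -> (J0 %| J')%N ->
    pr mu [set x | e <= nrm (fourier_avg z J x - fourier_avg z J' x)] <= e /\
    pr mu [set x | nrm (fourier_avg z J x) <= c] <= e.

(** Along a suitable divisor chain the Fourier averages converge almost
    everywhere, by the Borel-Cantelli lemma, to an eigenfunction that is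
    bounded away from zero. *)
Lemma fourier_avg_eigenfunction : exists g : borel X -> R[i],
  [/\ measurable_fun setT (g : borel X -> borel R[i]),
      forall x, nrm (g x) <= 1,
      \forall x \ae mu, g x != 0 &
      \forall x \ae mu, g (T x) = z^-1 * g x].
Proof.
pose e_ (i : nat) : R := 2^-1 ^+ i.
have e_gt0 i : 0 < e_ i by rewrite exprn_gt0.
have /choice [J0 HJ0] : forall i, exists J0 : nat, (0 < J0)%N /\
  forall J J', (0 < J)%N -> (0 < J')%N -> (J0 %| J)%N -> (J0 %| J')%N ->
    pr mu [set x | e_ i <= nrm (fourier_avg z J x - fourier_avg z J' x)] <= e_ i /\
    pr mu [set x | nrm (fourier_avg z J x) <= c] <= e_ i.
  by move=> i; exact: small.
(* The factors [J0 l] put [L i] under the hypothesis [small], and the factors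
   [l.+1] make it tend to infinity. *)
pose L i := (\prod_(l < i.+1) (J0 l * l.+1))%N.
have L0 i : (0 < L i)%N.
  by rewrite prodn_gt0 // => l; rewrite muln_gt0 andbT; have [] := HJ0 l.
have LS i : L i.+1 = (L i * (J0 i.+1 * i.+2))%N by rewrite /L big_ord_recr.
have J0L i : (J0 i %| L i)%N.
  by rewrite /L big_ord_recr /= dvdn_mull // dvdn_mulr.
have Lge i : (i < L i)%N.
  rewrite /L big_ord_recr /= mulnA; apply: leq_trans (leq_pmull _ _) => //.
  have [h _] := HJ0 i; rewrite muln_gt0 h andbT prodn_gt0 // => l.
  by rewrite muln_gt0 andbT; have [] := HJ0 l.
pose g_ i := fourier_avg z (L i).
have mg i : measurable_fun setT (g_ i : borel X -> borel R[i]).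
  exact: (continuous_measurable_borel_map (@continuous_fourier_avg _ _)).
pose D1 i : set (borel X) := [set x | e_ i <= nrm (g_ i x - g_ i.+1 x)].
pose D2 i : set (borel X) := [set x | nrm (g_ i x) <= c].
have mD1 i : measurable (D1 i).
  apply: measurable_ge_cst; apply: (@continuous_measurable_borel R X).
  by apply: continuous_nrmP; apply: continuous_csubP; exact: continuous_fourier_avg.
have mD2 i : measurable (D2 i).
  apply: measurable_le_cst; apply: (@continuous_measurable_borel R X).
  by apply: continuous_nrmP; exact: continuous_fourier_avg.
pose D i := D1 i `|` D2 i.
have mD i : measurable (D i) by exact: measurableU.
have prD i : pr mu (D i) <= 2 * e_ i.
  have [_ /(_ (L i) (L i.+1) (L0 i) (L0 i.+1) (J0L i))] := HJ0 i.
  have dv : (J0 i %| L i.+1)%N by rewrite LS dvdn_mulr.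
  move=> /(_ dv) [h1 h2].
  by have := pr_le2 mu (mD i) (mD1 i) (mD2 i) (fun x => id); rewrite -/(D1 i) -/(D2 i) in h1 h2 *; lra.
have sumD : (\sum_(n <oo) mu (D n) < +oo)%E.
  apply: (@le_lt_trans _ _ 4%:E); last by rewrite ltry.
  apply: le_trans (epsilon_trick0 xpredT (_ : 0 <= 4)) => //.
  apply: lee_nneseries => // i _; rewrite (prE mu (mD i)) lee_fin.
  apply: le_trans (prD i) _; rewrite /e_ exprVn natrX exprS invfM mulrA.
  by rewrite ler_pM2r ?invr_gt0 ?exprn_gt0 //; lra.
have mlim : measurable (lim_sup_set D).
  apply: bigcap_measurableType => n _.
  by apply: bigcup_measurable => k _; exact: mD.
have limD0 : mu (lim_sup_set D) = 0 by exact: lim_sup_set_cvg0.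
pose good := ~` lim_sup_set D.
have mgood : measurable good by exact: measurableC.
have goodP x : good x -> exists n, forall i, (n <= i)%N -> ~ D i x.
  move=> gx; apply: contrapT => /forallNP H; apply: gx => n _.
  apply: contrapT => nD; apply: (H n) => i ni Di; apply: nD; by exists i.
have decay x n : (forall i, (n <= i)%N -> ~ D i x) -> forall i, (n <= i)%N ->
    nrm (g_ i x - g_ i.+1 x) <= e_ i.
  move=> H i ni; rewrite leNgt; apply/negP => h; apply: (H i ni).
  by left; rewrite /D1 /= ltW.
(* Outside the good set the averages are replaced by 0, so that the limit
   exists everywhere and is measurable. *)
pose ind x : R := if x \in good then 1 else 0.
have mind : measurable_fun setT (ind : borel X -> R).
  by rewrite (_ : ind = \1_good); [exact: measurable_indic
    |apply/funext => x; rewrite indicE /ind; case: (x \in good)].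
have mRe i : measurable_fun setT (fun x : borel X => ind x * complex.Re (g_ i x)).
  exact: (measurable_funM mind (measurable_Re (mg i))).
have mIm i : measurable_fun setT (fun x : borel X => ind x * complex.Im (g_ i x)).
  exact: (measurable_funM mind (measurable_Im (mg i))).
have ind0 x : ~ good x -> ind x = 0 by move=> ng; rewrite /ind memNset.
have ind1 x : good x -> ind x = 1 by move=> gx; rewrite /ind mem_set.
have cpart (P : R[i] -> R) x : {morph P : z w / z - w} -> (forall w, `|P w| <= nrm w) ->
    cvgn (fun i => ind x * P (g_ i x)).
  move=> PB PL; have [gx|ng] := pselect (good x); last first.
    by rewrite ind0 //; under eq_fun do rewrite mul0r; exact: is_cvg_cst.
  have [n Hn] := goodP x gx; rewrite ind1 //; under eq_fun do rewrite mul1r.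
  apply: (@cvgn_geometric_decay _ _ n) => i ni.
  by rewrite -PB; apply: le_trans (PL _) _; exact: decay Hn i ni.
have [a Ha] : exists a : borel X -> R, forall x,
    (fun i => ind x * complex.Re (g_ i x)) @ \oo --> a x.
  suff /boolp.choice [a Ha] : forall x, exists l : R,
      (fun i => ind x * complex.Re (g_ i x)) @ \oo --> l by exists a.
  by move=> x; apply/cvg_ex; apply: cpart; [exact: raddfB|exact: abs_Re_le].
have [b Hb] : exists b : borel X -> R, forall x,
    (fun i => ind x * complex.Im (g_ i x)) @ \oo --> b x.
  suff /boolp.choice [b Hb] : forall x, exists l : R,
      (fun i => ind x * complex.Im (g_ i x)) @ \oo --> l by exists b.
  by move=> x; apply/cvg_ex; apply: cpart; [exact: raddfB|exact: abs_Im_le].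
pose g (x : borel X) : R[i] := (a x +i* b x)%C.
have glim x (e : R) : good x -> 0 < e ->
    exists n, forall i, (n <= i)%N -> nrm (g x - g_ i x) < e.
  move=> gx e0; have e2 : 0 < e / 2 by rewrite divr_gt0.
  have /cvgrPdist_lt /(_ _ e2) [n1 _ h1] := Ha x.
  have /cvgrPdist_lt /(_ _ e2) [n2 _ h2] := Hb x.
  exists (maxn n1 n2) => i; rewrite geq_max => /andP[i1 i2].
  have := h1 i i1; have := h2 i i2; rewrite /= ind1 // !mul1r => k1 k2.
  by apply: le_lt_trans (nrm_ReIm _) _; rewrite !raddfB /=; lra.
have gbad x : ~ good x -> g x = 0.
  have cvg0 (u : nat -> R) l : (fun i => 0 * u i) @ \oo --> l -> l = 0.
    under eq_fun do rewrite mul0r.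
    by move=> h; apply: (cvg_unique _ h (cvg_cst _)).
  move=> ng; have := Ha x; have := Hb x; rewrite ind0 // /g.
  by move=> /cvg0 -> /cvg0 ->.
have aegood : \forall x \ae mu, good x.
  by apply/negligibleP; [exact: measurableC|rewrite setCK].
exists g; split.
- apply: measurable_complex.
    by apply: (measurable_fun_cvg mRe) => x _; exact: Ha.
  by apply: (measurable_fun_cvg mIm) => x _; exact: Hb.
- move=> x; have [gx|ng] := pselect (good x); last by rewrite gbad // nrm0.
  apply/ler_addgt0Pl => e e0; have [n Hn] := glim x e gx e0.
  have := Hn n (leqnn n); have := nrm_fourier_avg (L n) x; rewrite -/(g_ n x).
  by have := nrm_lbound (g x) (g_ n x); lra.
- apply: filterS aegood => x gx; rewrite -nrm_eq0; apply/negP => /eqP gx0.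
  have [n Hn] := glim x c gx c0; have [m Hm] := goodP x gx.
  apply: (Hm (maxn n m)); first exact: leq_maxr.
  right; rewrite /D2 /=; have := Hn (maxn n m) (leq_maxl _ _).
  by have := nrm_lbound (g_ (maxn n m) x) (g x); rewrite nrmB_sym gx0; lra.
- have aegoodT : \forall x \ae mu, good (T x).
    have mT : measurable (T @^-1` lim_sup_set D : set (borel X)).
      exact: (measurable_preimage_shift 1).
    have : mu.-negligible (T @^-1` lim_sup_set D).
      apply/negligibleP => //; apply: etrans (prE mu mT) _.
      by rewrite (mu_inv 1 mlim) /pr limD0.
    by apply: negligibleS => x /=; apply: contrapT.
  apply: (negligibleS _ (negligibleU aegood aegoodT)); rewrite -setCI.
  apply: subsetC => x [gx gTx] /=; apply/eqP; rewrite -subr_eq0 -nrm_eq0 eq_le nrm_ge0 andbT.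
  apply/ler_addgt0Pl => e e0; rewrite addr0.
  have e4 : 0 < e / 4 by rewrite divr_gt0.
  have [n1 Hn1] := glim _ _ gx e4; have [n2 Hn2] := glim _ _ gTx e4.
  pose N := maxn (maxn n1 n2) (Num.bound `|(e / 4)^-1|).
  have h1 := Hn1 N (leq_trans (leq_maxl _ _) (leq_maxl _ _)).
  have h2 := Hn2 N (leq_trans (leq_maxr _ _) (leq_maxl _ _)).
  have h3 := fourier_avg_shift x (L0 N).
  have h4 : 2 / (L N)%:R <= 2 * (e / 4).
    rewrite ler_pM2l // -[leRHS]invrK lef_pV2 ?posrE ?invr_gt0 ?ltr0n //.
    apply: le_trans (ler_norm _) _; apply: ltW.
    apply: lt_le_trans (archi_boundP (normr_ge0 _)) _; rewrite ler_nat.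
    by apply: leq_trans (ltnW (Lge N)); exact: leq_maxr.
  have z0 : nrm z^-1 = 1 by rewrite nrmV z1 invr1.
  have h5 : nrm (z^-1 * g_ N x - z^-1 * g x) < e / 4.
    by rewrite -mulrBr nrmM z0 mul1r nrmB_sym.
  have := nrm_tri (g (T x)) (g_ N (T x)) (z^-1 * g x).
  have := nrm_tri (g_ N (T x)) (z^-1 * g_ N x) (z^-1 * g x).
  rewrite -/(g_ N _) in h3; lra.
Qed.

End fourier_averages.

(** * The Turan-Kubilius inequality *)

Section turan_kubilius.
Variable R : realType.

Lemma sum_dvdn (d N : nat) : (0 < d)%N ->
  \sum_(n < N) ((d %| n.+1)%N%:R : R) = (N %/ d)%N%:R.
Proof.
move=> d0; elim: N => [|N IH]; first by rewrite big_ord0 div0n.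
by rewrite big_ord_recr /= IH -natrD divnS // addnC.
Qed.

Lemma divn_le (d N : nat) : (0 < d)%N -> (N %/ d)%N%:R <= N%:R / d%:R :> R.
Proof. by move=> d0; rewrite ler_pdivlMr ?ltr0n // -natrM ler_nat leq_divM. Qed.

Lemma divn_gt (d N : nat) : (0 < d)%N -> N%:R / d%:R < (N %/ d)%N%:R + 1 :> R.
Proof. by move=> d0; rewrite ltr_pdivrMr ?ltr0n // natr1 -natrM ltr_nat ltn_ceil. Qed.

Lemma sum_dvdn_le (d N : nat) : (0 < d)%N ->
  \sum_(n < N) ((d %| n.+1)%N%:R : R) <= N%:R / d%:R.
Proof. by move=> d0; rewrite sum_dvdn // divn_le. Qed.

Lemma floor_sqrt_ex (N : nat) : exists y : nat, (y * y <= N < y.+1 * y.+1)%N.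
Proof.
elim: N => [|N [y /andP[h1 h2]]]; first by exists 0%N.
have [h|h] := leqP (y.+1 * y.+1) N.+1; last by exists y; rewrite h andbT (leq_trans h1).
exists y.+1; rewrite h /=; apply: leq_ltn_trans h2 _.
by rewrite ltn_mul.
Qed.

(** Divisibility by [p], centred at its density so that distinct primes are
    nearly uncorrelated. *)
Definition fluct (p n : nat) : R := (p %| n)%N%:R - p%:R^-1.

(** Both primes divide [n] exactly when their product does, so the main terms
    cancel and rounding errors remain. *)
Lemma fluct_cov (p p' N : nat) : prime p -> prime p' -> p != p' ->
  \sum_(n < N) fluct p n.+1 * fluct p' n.+1 <= 1 /\
  - 1 <= \sum_(n < N) fluct p n.+1 * fluct p' n.+1.
Proof.
move=> pp pp' pnp'; have p0 := prime_gt0 pp; have p'0 := prime_gt0 pp'.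
have cop : coprime p p' by rewrite prime_coprime // dvdn_prime2.
have -> : \sum_(n < N) fluct p n.+1 * fluct p' n.+1 =
   (N %/ (p * p'))%N%:R - (N %/ p)%N%:R / p'%:R - (N %/ p')%N%:R / p%:R
   + N%:R / (p%:R * p'%:R).
  rewrite -!sum_dvdn ?muln_gt0 ?p0 // !mulr_suml -!sumrB.
  have -> : N%:R = \sum_(n < N) (1 : R) by rewrite sumr_const card_ord.
  rewrite mulr_suml -big_split /=; apply: eq_bigr => n _.
  rewrite /fluct (Gauss_dvd _ cop) -mulnb natrM invfM; ring.
have pp0 : (0 < p * p')%N by rewrite muln_gt0 p0.
have h1 := divn_le N pp0; have h2 := divn_gt N pp0.
have ge2 (r : nat) : prime r -> r%:R^-1 <= 2^-1 :> R.
  by move=> pr; rewrite lef_pV2 ?posrE ?ltr0n ?prime_gt0 // ler_nat prime_gt1.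
have pos (r : nat) : prime r -> 0 < r%:R^-1 :> R.
  by move=> pr; rewrite invr_gt0 ltr0n prime_gt0.
have i1 := ge2 _ pp; have i2 := ge2 _ pp'; have j1 := pos _ pp; have j2 := pos _ pp'.
have k1 : (N %/ p)%N%:R / p'%:R <= N%:R / (p * p')%N%:R :> R.
  by rewrite natrM invfM mulrA ler_pM2r // divn_le.
have k2 : (N %/ p')%N%:R / p%:R <= N%:R / (p * p')%N%:R :> R.
  by rewrite natrM invfM [_^-1 * _]mulrC mulrA ler_pM2r // divn_le.
have k3 : N%:R / (p * p')%N%:R <= (N %/ p)%N%:R / p'%:R + p'%:R^-1 :> R.
  rewrite natrM invfM mulrA -[X in _ + X]mul1r -mulrDl ler_pM2r //.
  exact/ltW/divn_gt.
have k4 : N%:R / (p * p')%N%:R <= (N %/ p')%N%:R / p%:R + p%:R^-1 :> R.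
  rewrite natrM invfM [_^-1 * _]mulrC mulrA -[X in _ + X]mul1r -mulrDl ler_pM2r //.
  exact/ltW/divn_gt.
rewrite -natrM; move: (N%:R / _) h1 h2 k1 k2 k3 k4 => t.
move: ((N %/ p)%N%:R / _) ((N %/ p')%N%:R / _) (_%:R : R) => a b c.
by move: (p%:R^-1) (p'%:R^-1) i1 i2 j1 j2 => u v *; split; lra.
Qed.

Lemma fluct_var (p N : nat) : prime p ->
  \sum_(n < N) fluct p n.+1 * fluct p n.+1 <= N%:R / p%:R.
Proof.
move=> pp; have p0 := prime_gt0 pp.
have -> : \sum_(n < N) fluct p n.+1 * fluct p n.+1 =
    (N %/ p)%N%:R * (1 - 2 / p%:R) + N%:R / p%:R / p%:R.
  rewrite -!sum_dvdn // mulr_suml.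
  have -> : N%:R = \sum_(n < N) (1 : R) by rewrite sumr_const card_ord.
  rewrite !mulr_suml -big_split /=; apply: eq_bigr => n _.
  by rewrite /fluct; case: (p %| n.+1)%N => /=; ring.
have i1 : p%:R^-1 <= 2^-1 :> R.
  by rewrite lef_pV2 ?posrE ?ltr0n // ler_nat prime_gt1.
have i0 : 0 < p%:R^-1 :> R by rewrite invr_gt0 ltr0n.
apply: (@le_trans _ _ (N%:R / p%:R * (1 - 2 / p%:R) + N%:R / p%:R / p%:R)).
  by rewrite lerD2r ler_wpM2r ?divn_le //; lra.
have : 0 <= N%:R / p%:R :> R by rewrite divr_ge0.
move: (p%:R^-1) (N%:R / _) i0 i1 => u v *; nra.
Qed.

Variable b : nat -> R.
Hypothesis b_prime : forall p, ~~ prime p -> b p = 0.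

(** Off the diagonal [fluct_cov] leaves [`|b p * b p'|], which is at most half
    the sum of [p' * b p ^+ 2 / p] and [p * b p' ^+ 2 / p']. Their total is the
    sum of the [b p ^+ 2 / p] times the sum of the [p <= y], and the latter is
    at most [N] because [y * y <= N]. *)
Lemma turan_kubilius (y N : nat) : (y * y <= N)%N ->
  \sum_(n < N) (\sum_(p < y.+1) b p * fluct p n.+1) ^+ 2 <=
  2 * N%:R * \sum_(p < y.+1) b p ^+ 2 / p%:R.
Proof.
move=> yN; set S := \sum_(p < y.+1) b p ^+ 2 / p%:R.
have S0 : 0 <= S by apply: sumr_ge0 => p _; rewrite divr_ge0 // sqr_ge0.
have -> : \sum_(n < N) (\sum_(p < y.+1) b p * fluct p n.+1) ^+ 2 =
  \sum_(p < y.+1) \sum_(p' < y.+1) b p * b p' *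
     \sum_(n < N) fluct p n.+1 * fluct p' n.+1.
  under eq_bigr => n _.
    rewrite expr2 mulr_suml; under eq_bigr do rewrite mulr_sumr.
    over.
  rewrite exchange_big /=; apply: eq_bigr => p _.
  rewrite exchange_big /=; apply: eq_bigr => p' _.
  by rewrite mulr_sumr; apply: eq_bigr => n _; ring.
have bound (p p' : 'I_y.+1) : b p * b p' * (\sum_(n < N) fluct p n.+1 * fluct p' n.+1)
    <= (p == p')%:R * (b p ^+ 2 / p%:R * N%:R) +
       (b p ^+ 2 / p%:R * p'%:R + b p' ^+ 2 / p'%:R * p%:R) / 2.
  have E0 : 0 <= (b p ^+ 2 / p%:R * p'%:R + b p' ^+ 2 / p'%:R * p%:R) / 2.
    by rewrite divr_ge0 // addr_ge0 // mulr_ge0 // divr_ge0 // sqr_ge0.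
  have F0 : 0 <= (p == p')%:R * (b p ^+ 2 / p%:R * N%:R).
    by rewrite mulr_ge0 // mulr_ge0 // divr_ge0 // sqr_ge0.
  have [pp|npp] := boolP (prime p); last first.
    by apply: le_trans (addr_ge0 F0 E0); rewrite (b_prime npp) !mul0r.
  have [pp'|npp'] := boolP (prime p'); last first.
    by apply: le_trans (addr_ge0 F0 E0); rewrite (b_prime npp') mulr0 mul0r.
  have [<-|pnp'] := eqVneq p p'.
    rewrite mul1r -expr2; apply: (@le_trans _ _ (b p ^+ 2 * (N%:R / p%:R))).
      by rewrite ler_wpM2l ?sqr_ge0 // fluct_var.
    by rewrite -mulrA [_^-1 * _]mulrC lerDl divr_ge0 // addr_ge0 // mulr_ge0 // divr_ge0 // sqr_ge0.
  rewrite mul0r add0r.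
  have [c1 c2] := fluct_cov N pp pp' pnp'.
  move: (\sum_(n < N) _) c1 c2 => C c1 c2.
  have p0 : (p%:R : R) != 0 by rewrite pnatr_eq0 -lt0n prime_gt0.
  have p'0 : (p'%:R : R) != 0 by rewrite pnatr_eq0 -lt0n prime_gt0.
  have pg : 0 < (p%:R : R) by rewrite ltr0n prime_gt0.
  have p'g : 0 < (p'%:R : R) by rewrite ltr0n prime_gt0.
  apply: (@le_trans _ _ (`|b p| * `|b p'|)).
    apply: le_trans (ler_norm _) _; rewrite normrM normrM ler_piMr ?mulr_ge0 //.
    by rewrite ler_norml c1 c2.
  rewrite -(real_normK (num_real (b p))) -(real_normK (num_real (b p'))).
  move: (`|b p|) (`|b p'|) (p%:R : R) (p'%:R : R) p0 p'0 pg p'g => u v s t s0 t0 sg tg.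
  rewrite -subr_ge0 (_ : _ - _ = (u * t - v * s) ^+ 2 / (2 * s * t)).
    by rewrite divr_ge0 ?sqr_ge0 // !mulr_ge0 // ltW.
  by field; rewrite s0 t0.
apply: le_trans (ler_sum _ (fun p _ => ler_sum _ (fun p' _ => bound p p'))) _.
have -> : \sum_(p < y.+1) \sum_(p' < y.+1)
    ((p == p')%:R * (b p ^+ 2 / p%:R * N%:R) +
       (b p ^+ 2 / p%:R * p'%:R + b p' ^+ 2 / p'%:R * p%:R) / 2) =
    N%:R * S + S * \sum_(p < y.+1) p%:R.
  under eq_bigr do rewrite big_split /=.
  rewrite big_split /=; congr (_ + _).
    rewrite mulrC /S mulr_suml; apply: eq_bigr => p _.
    rewrite (bigD1 p) //= eqxx mul1r big1 ?addr0 // => i ip.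
    by rewrite eq_sym (negbTE ip) mul0r.
  under eq_bigr do rewrite -mulr_suml big_split /=.
  rewrite -mulr_suml big_split /= [X in _ + X]exchange_big /=.
  have -> : \sum_(i < y.+1) \sum_(i0 < y.+1) b i ^+ 2 / i%:R * i0%:R =
     S * \sum_(p < y.+1) p%:R.
    by rewrite /S mulr_suml; apply: eq_bigr => i _; rewrite mulr_sumr.
  by move: (S * _) => u; lra.
have sump : \sum_(p < y.+1) (p%:R : R) <= N%:R.
  rewrite -natr_sum ler_nat; apply: leq_trans yN.
  elim: y {S S0 bound} => [|y IH]; first by rewrite big_ord_recr big_ord0.
  by rewrite big_ord_recr /=; apply: leq_trans (leq_add IH (leqnn _)) _; lia.
by rewrite mulr2n mulrDl mul1r mulrDl lerD // mulrC ler_wpM2r.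
Qed.

End turan_kubilius.

(** * Concentration of additive functions *)

Section additive_concentration.
Variable R : realType.
Variable b : nat -> R.
Hypothesis b_prime : forall p, ~~ prime p -> b p = 0.

Definition additive_fun (N n : nat) : R := \sum_(p < N.+1) (p %| n)%N%:R * b p.

(** An integer up to [N] has at most one prime factor above [sqrt N]. *)
Lemma large_prime_part (y N n : nat) : (N < y.+1 * y.+1)%N -> (n < N)%N ->
  (\sum_(p < N.+1 | ~~ (p < y.+1)%N) (p %| n.+1)%N%:R * b p) ^+ 2 <=
  \sum_(p < N.+1 | ~~ (p < y.+1)%N) (p %| n.+1)%N%:R * b p ^+ 2.
Proof.
move=> Ny nN.
have pos (p : nat) : 0 <= (p %| n.+1)%N%:R * b p ^+ 2 by rewrite mulr_ge0 // sqr_ge0.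
have [/existsP [p0 /and3P[yp0 pp0 p0n]]|/existsPn H] :=
  boolP [exists p : 'I_N.+1, [&& ~~ (p < y.+1)%N, prime p & (p %| n.+1)%N]].
  rewrite (bigD1 p0) //= [leRHS](bigD1 p0) //= p0n !mul1r big1 ?addr0.
    by rewrite lerDl sumr_ge0.
  move=> p /andP[yp pp0']; have [pp|npp] := boolP (prime p); last by rewrite b_prime ?mulr0.
  have [pn|] := boolP (p %| n.+1)%N; last by rewrite mul0r.
  have cop : coprime p p0 by rewrite prime_coprime // dvdn_prime2.
  have : (p * p0 %| n.+1)%N by rewrite Gauss_dvd // pn.
  move=> /(dvdn_leq (ltn0Sn n)) le1.
  rewrite -!leqNgt in yp yp0; have := leq_mul yp yp0 => le2.
  by have := leq_trans (leq_trans le2 le1) nN; rewrite leqNgt Ny.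
rewrite big1 ?expr0n ?sumr_ge0 // => p yp.
have := H p; rewrite yp /=; have [pp|npp] := boolP (prime p); last by rewrite b_prime ?mulr0.
by move=> /= /negbTE ->; rewrite mul0r.
Qed.

Lemma le_add_sqr_div (x eta : R) : 0 < eta -> `|x| <= eta + x ^+ 2 / eta.
Proof.
move=> e0; rewrite -(real_normK (num_real x)); move: (normr_ge0 x) (`|x|) => _ u.
rewrite -subr_ge0.
have -> : eta + u ^+ 2 / eta - u = ((eta - u / 2) ^+ 2 + 3 / 4 * u ^+ 2) / eta.
  by field; rewrite gt_eqF.
apply: divr_ge0; last exact: ltW.
apply: addr_ge0; first exact: sqr_ge0.
by apply: mulr_ge0; [rewrite divr_ge0|exact: sqr_ge0].
Qed.

(** The primes up to [sqrt N] fall under [turan_kubilius]. Each [n] has at most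
    one larger prime factor, so the remaining part is small in mean square
    without being centred. *)
Lemma additive_concentration (N : nat) (S eta : R) : 0 < eta ->
  \sum_(p < N.+1) b p ^+ 2 / p%:R <= S ->
  exists m : R, \sum_(n < N) `|additive_fun N n.+1 - m| <=
    N%:R * (2 * eta + 3 * S / eta).
Proof.
move=> e0 bS; have [y /andP[yN Ny]] := floor_sqrt_ex N.
have yN1 : (y.+1 <= N.+1)%N by rewrite ltnS; apply: leq_trans yN; case: y {Ny} => // y; rewrite leq_pmulr.
have term0 (p : nat) : 0 <= b p ^+ 2 / p%:R by rewrite divr_ge0 // sqr_ge0.
exists (\sum_(p < y.+1) b p / p%:R).
pose small n := \sum_(p < y.+1) b p * fluct R p n.
pose large n := \sum_(p < N.+1 | ~~ (p < y.+1)%N) (p %| n)%N%:R * b p.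
have split n : additive_fun N n - \sum_(p < y.+1) b p / p%:R = small n + large n.
  rewrite /additive_fun (bigID (fun p : 'I_N.+1 => (p < y.+1)%N)) /= addrAC.
  rewrite -(big_ord_widen N.+1 (fun p => (p %| n)%N%:R * b p)) // -sumrB.
  by congr (_ + _); apply: eq_bigr => p _; rewrite /fluct mulrBr mulrC.
have h1 : \sum_(n < N) small n.+1 ^+ 2 <= 2 * N%:R * S.
  apply: le_trans (turan_kubilius b_prime yN) _.
  rewrite ler_wpM2l ?mulr_ge0 //; apply: le_trans bS.
  rewrite (big_ord_widen N.+1 (fun p => b p ^+ 2 / p%:R)) //.
  by rewrite [leRHS](bigID (fun p : 'I_N.+1 => (p < y.+1)%N)) /= lerDl sumr_ge0.
have h2 : \sum_(n < N) large n.+1 ^+ 2 <= N%:R * S.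
  apply: (@le_trans _ _ (\sum_(n < N) \sum_(p < N.+1 | ~~ (p < y.+1)%N)
     (p %| n.+1)%N%:R * b p ^+ 2)).
    by apply: ler_sum => n _; exact: large_prime_part.
  rewrite exchange_big /=.
  apply: (@le_trans _ _ (\sum_(p < N.+1 | ~~ (p < y.+1)%N) N%:R * (b p ^+ 2 / p%:R))).
    apply: ler_sum => p yp; rewrite -mulr_suml.
    have -> : N%:R * (b p ^+ 2 / p%:R) = N%:R / p%:R * b p ^+ 2 by ring.
    apply: ler_wpM2r; first exact: sqr_ge0.
    by apply: sum_dvdn_le; rewrite -leqNgt in yp; exact: leq_trans yp.
  rewrite -mulr_sumr ler_wpM2l //; apply: le_trans bS.
  by rewrite [leRHS](bigID (fun p : 'I_N.+1 => (p < y.+1)%N)) /= lerDr sumr_ge0.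
apply: (@le_trans _ _ (\sum_(n < N) ((eta + small n.+1 ^+ 2 / eta) +
   (eta + large n.+1 ^+ 2 / eta)))).
  apply: ler_sum => n _; rewrite split; apply: le_trans (ler_normD _ _) _.
  by apply: lerD; exact: le_add_sqr_div.
rewrite !big_split /= -!mulr_suml !sumr_const card_ord -[eta *+ N]mulr_natl.
have -> : N%:R * (2 * eta + 3 * S / eta) =
   (N%:R * eta + 2 * N%:R * S / eta) + (N%:R * eta + N%:R * S / eta) by ring.
by apply: lerD; apply: lerD => //; rewrite ler_pM2r ?invr_gt0.
Qed.

End additive_concentration.

(** * Dirichlet characters and periodic models *)

Section dirichlet_characters.
Variables (R : realType) (q : nat) (chi : nat -> R[i]).
Hypothesis chi_char : dirichlet_character q chi.

Lemma char_gt0 : (0 < q)%N. Proof. by case: chi_char. Qed.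

Lemma charM m n : chi (m * n)%N = chi m * chi n.
Proof. by case: chi_char. Qed.

Lemma char_neq0 n : (chi n != 0) = coprime n q.
Proof. by case: chi_char => _ _ _ H; apply/idP/idP => /H. Qed.

Lemma char_addM n k : chi (n + k * q)%N = chi n.
Proof.
case: chi_char => _ _ H _; elim: k => [|k IH]; first by rewrite addn0.
by rewrite mulSn [(q + _)%N]addnC addnA H.
Qed.

Lemma char_mod n : chi (n %% q)%N = chi n.
Proof. by rewrite [in RHS](divn_eq n q) addnC char_addM. Qed.

Lemma char_eqmod m n : m = n %[mod q] -> chi m = chi n.
Proof. by move=> e; rewrite -char_mod e char_mod. Qed.

Lemma char1 : chi 1 = 1.
Proof.
have n1 : chi 1%N != 0 by rewrite char_neq0 coprime1n.
by apply: (mulfI n1); rewrite -charM muln1 mulr1.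
Qed.

Lemma charX n k : chi (n ^ k)%N = chi n ^+ k.
Proof. by elim: k => [|k IH]; rewrite ?expn0 ?char1 // expnS charM IH exprS. Qed.

Lemma char_unit n : coprime n q -> nrm (chi n) = 1.
Proof.
move=> cop; have := cyclic.Euler_exp_totient cop => /char_eqmod; rewrite charX char1.
move=> /(congr1 (@nrm R)); rewrite nrmX nrm1 => /eqP.
by rewrite pexpr_eq1 ?nrm_ge0 ?totient_gt0 ?char_gt0 // => /eqP.
Qed.

Lemma char_nrm n : nrm (chi n) <= 1.
Proof.
have [cop|ncop] := boolP (coprime n q); first by rewrite char_unit.
by move: ncop; rewrite -char_neq0 negbK => /eqP ->; rewrite nrm0.
Qed.

Lemma char_prime_gt (p : nat) : prime p -> (q < p)%N -> coprime p q.
Proof.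
move=> pp qp; rewrite prime_coprime //; apply/negP => /(dvdn_leq char_gt0).
by rewrite leqNgt qp.
Qed.

End dirichlet_characters.

Section truncation.
Variables (R : realType) (f chi : nat -> R[i]) (q : nat).
Hypothesis f_nrm : forall n, (0 < n)%N -> nrm (f n) <= 1.
Hypothesis f_neq0 : forall n, (0 < n)%N -> f n != 0.
Hypothesis f_mul : completely_multiplicative f.
Hypothesis chi_char : dirichlet_character q chi.

Lemma cmul1 : f 1 = 1.
Proof. by apply: (mulfI (f_neq0 (ltn0Sn 0))); rewrite -f_mul // mulr1. Qed.

(** The periodic model of [f]: taking [chi] instead of [f] outside the divisor
    [gcdn n D] makes the function depend on [n] modulo [q * D] only. *)
Definition truncation (D n : nat) : R[i] := f (gcdn n D) * chi (n %/ gcdn n D).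

(** For a prime [p] outside the conductor, the quotient of [f p] by [chi p]. *)
Definition twist (p : nat) : R[i] := f p * (chi p)^*.

Definition exceptional (p : nat) : bool := prime p && (f p != chi p).

Definition modulus (K L : nat) : nat := \prod_(p < K.+1 | exceptional p) p ^ L.

Lemma modulus_gt0 K L : (0 < modulus K L)%N.
Proof. by apply: prodn_cond_gt0 => p /andP[pp _]; rewrite expn_gt0 prime_gt0. Qed.

Lemma modulus_dvd K L p : exceptional p -> (p <= K)%N -> (p ^ L %| modulus K L)%N.
Proof.
move=> ep pK; have pK1 : (p < K.+1)%N by [].
by rewrite /modulus (bigD1 (Ordinal pK1)) //= dvdn_mulr.
Qed.

Lemma prime_dvd_modulus K L p : prime p -> (p %| modulus K L)%N ->
  exceptional p /\ (p <= K)%N.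
Proof.
move=> pp; rewrite /modulus; elim/big_ind: _ => [|x y hx hy|i ei].
- by rewrite dvdn1 => /eqP p1; move: pp; rewrite p1.
- by rewrite Euclid_dvdM // => /orP[].
- rewrite Euclid_dvdX // => /andP[]; have /andP[pi _] := ei.
  by rewrite dvdn_prime2 // => /eqP -> _; rewrite ei; split => //; rewrite -ltnS.
Qed.

Lemma truncation_nrm D n : (0 < D)%N -> nrm (truncation D n) <= 1.
Proof.
move=> D0; rewrite nrmM mulr_ile1 ?nrm_ge0 ?(char_nrm chi_char) //.
by rewrite f_nrm // gcdn_gt0 D0 orbT.
Qed.

(** Removing one prime factor [p] of [m] at a time divides [f m] by [chi p] if
    [p] is small and by [chi p * twist p] if [p] is large, because then [chi p]
    is unimodular. *)
Lemma cmul_char_twist K B m : (q <= K)%N -> (0 < m)%N -> (m < B)%N ->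
  (forall p, prime p -> (p %| m)%N -> (p <= K)%N -> f p = chi p) ->
  (forall p, prime p -> (K < p)%N -> ~~ (p ^ 2 %| m)%N) ->
  f m = chi m * \prod_(p < B | [&& prime p, (K < p)%N & (p %| m)%N]) twist p.
Proof.
move=> qK; have [n] := ubnP m; elim: n m => // n IH m mn m0 mB fchi sqf.
have [m1|m1] := leqP m 1.
  have {}m1 : m = 1%N by apply/eqP; rewrite eqn_leq m1.
  rewrite m1 cmul1 (char1 chi_char) mul1r big1 // => p /and3P[pp _].
  by rewrite dvdn1 => /eqP p1; move: pp; rewrite p1.
pose p := pdiv m; have pp : prime p by exact: pdiv_prime.
have pm : (p %| m)%N by exact: pdiv_dvd.
have p0 := prime_gt0 pp.
pose m' := (m %/ p)%N; have mE : m = (p * m')%N by rewrite mulnC divnK.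
have m'0 : (0 < m')%N by rewrite divn_gt0 // dvdn_leq.
have m'm : (m' < m)%N by rewrite ltn_Pdiv // prime_gt1.
have dvm r : (r %| m')%N -> (r %| m)%N by move=> h; rewrite mE dvdn_mull.
have IHm' := IH m' (leq_trans m'm mn) m'0 (ltn_trans m'm mB).
have fm' : f m' = chi m' *
    \prod_(p < B | [&& prime p, (K < p)%N & (p %| m')%N]) twist p.
  apply: IHm'; first by move=> r pr /dvm; exact: fchi.
  by move=> r pr Kr; apply: contra (sqf r pr Kr) => /dvm.
rewrite {1 2}mE f_mul // fm' (charM chi_char).
have dvdE r : prime r -> (r %| m)%N = (r == p) || (r %| m')%N.
  by move=> pr; rewrite mE Euclid_dvdM // dvdn_prime2.
have [pK|Kp] := leqP p K.
  rewrite (fchi p pp pm pK) -mulrA; congr (_ * (_ * _)).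
  apply: eq_bigl => r /=; apply: andb_id2l => pr; apply: andb_id2l => Kr.
  by rewrite dvdE //; case: eqP => // rp; move: Kr; rewrite rp ltnNge pK.
have npm' : ~~ (p %| m')%N.
  by apply: contra (sqf p pp Kp) => h; rewrite mE expnS expn1 dvdn_pmul2l.
have pB : (p < B)%N by apply: leq_ltn_trans mB; exact: dvdn_leq.
rewrite [in RHS](bigD1 (Ordinal pB)) /=; last by rewrite pp Kp pm.
have chip : chi p * (chi p)^* = 1.
  rewrite mul_conj_nrm (char_unit chi_char) ?expr1n //.
  by apply: (char_prime_gt chi_char) => //; exact: leq_ltn_trans Kp.
have -> : f p = chi p * twist p by rewrite /twist mulrCA chip mulr1.
have -> : \prod_(r < B | [&& prime r, (K < r)%N & (r %| m)%N] && (r != Ordinal pB)) twist r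
   = \prod_(r < B | [&& prime r, (K < r)%N & (r %| m')%N]) twist r.
  apply: eq_bigl => r; rewrite -andbA; apply: andb_id2l => pr.
  rewrite -andbA; apply: andb_id2l => Kr; rewrite dvdE // -val_eqE /=.
  by case: eqP => [->|_]; rewrite ?andbF ?andbT // (negbTE npm').
by ring.
Qed.

(** The powers of small exceptional primes in [n] divide the modulus, so that
    the cofactor of the gcd is as in [cmul_char_twist]. *)
Lemma truncation_approx K L B n : (q <= K)%N -> (0 < n)%N -> (n < B)%N ->
  (forall p, prime p -> (p <= K)%N -> ~~ (p ^ L.+1 %| n)%N) ->
  (forall p, prime p -> (K < p)%N -> ~~ (p ^ 2 %| n)%N) ->
  f n = truncation (modulus K L) n *
        \prod_(p < B | [&& prime p, (K < p)%N & (p %| n)%N]) twist p.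
Proof.
move=> qK n0 nB small large; set D := modulus K L.
set g := gcdn n D; pose m := (n %/ g)%N.
have g0 : (0 < g)%N by rewrite gcdn_gt0 n0.
have nE : n = (g * m)%N by rewrite mulnC divnK // dvdn_gcdl.
have m0 : (0 < m)%N by rewrite divn_gt0 // dvdn_leq // dvdn_gcdl.
have mn : (m %| n)%N by rewrite nE dvdn_mull.
have mB : (m < B)%N by apply: leq_ltn_trans nB; exact: dvdn_leq.
rewrite {1}nE f_mul // (@cmul_char_twist K B m) //.
- rewrite /truncation -/D -/g -/m mulrA; congr (_ * _ * _).
  apply: eq_bigl => p; apply: andb_id2l => pp; apply: andb_id2l => Kp.
  rewrite nE Euclid_dvdM //; case: (boolP (p %| g)%N) => //= pg.
  have [_] := prime_dvd_modulus pp (dvdn_trans pg (dvdn_gcdr _ _)).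
  by rewrite leqNgt Kp.
- move=> p pp pm pK; apply/eqP/negPn/negP => fpchi.
  have ep : exceptional p by rewrite /exceptional pp.
  pose v := logn p n.
  have vL : (v <= L)%N by rewrite leqNgt -pfactor_dvdn // small.
  have vg : (p ^ v %| g)%N.
    rewrite dvdn_gcd pfactor_dvdnn /=; apply: dvdn_trans (modulus_dvd L ep pK).
    exact: dvdn_exp2l.
  have : (p ^ v.+1 %| n)%N by rewrite nE expnSr dvdn_mul.
  by rewrite pfactor_dvdn // ltnn.
- by move=> p pp Kp; apply: contra (large p pp Kp) => h; apply: dvdn_trans mn.
Qed.

End truncation.

(** * Approximation by periodic functions *)

Section unimodular_replacement.
Variable R : realType.
Implicit Types x y b : R.

Lemma abs_sin_le x : `|sin x| <= `|x|.
Proof.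
wlog x0 : x / 0 <= x.
  move=> H; have [/H//|/ltW x0] := leP 0 x.
  by rewrite -normrN -sinN -[leRHS]normrN; apply: H; rewrite oppr_ge0.
have [c _] := @MVT_segment R sin cos 0 x x0
    (fun z _ => is_derive_sin z) (continuous_subspaceT (@continuous_sin R)).
rewrite sin0 !subr0 => ->; rewrite normrM ler_piMl //.
by rewrite ler_norml cos_geN1 cos_le1.
Qed.

Lemma one_sub_cos x : 0 <= 1 - cos x <= x ^+ 2 / 2.
Proof.
have -> : x = x / 2 + x / 2 by rewrite -splitr.
rewrite cosD -!expr2 cos2sin2; have := abs_sin_le (x / 2).
rewrite -(@ler_pXn2r _ 2) ?nnegrE // !real_normK ?num_real // -splitr.
have := sqr_ge0 (sin (x / 2)); rewrite exprMn exprVn.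
by move: (sin _ ^+ 2) => u; lra.
Qed.

Lemma abs_sub_sin x : `|x| <= 1 -> `|x - sin x| <= x ^+ 2 / 2.
Proof.
wlog x0 : x / 0 <= x.
  move=> H; have [/H//|/ltW x0] := leP 0 x.
  move=> x1; have := H (- x); rewrite oppr_ge0 normrN sqrrN sinN opprK addrC distrC.
  exact.
rewrite (ger0_norm x0) => x1.
have der (z : R) : is_derive z 1 (fun u => u - sin u) (1 - cos z) by apply: is_deriveB.
have cont : continuous (fun u : R => u - sin u).
  by move=> z; apply: cvgB; [exact: cvg_id|exact: continuous_sin].
have [c /[!in_itv]/= /andP[c0 cx]] := @MVT_segment R (fun u => u - sin u)
   (fun u => 1 - cos u) 0 x x0 (fun z _ => der z) (continuous_subspaceT cont).
rewrite sin0 !subr0 => ->; have /andP[d0 d1] := one_sub_cos c.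
rewrite ger0_norm ?mulr_ge0 //; apply: (@le_trans _ _ (c ^+ 2 / 2 * x)).
  by rewrite ler_wpM2r.
have c2 : c ^+ 2 <= x by rewrite expr2; nra.
by rewrite mulrAC ler_pM2r ?invr_gt0 // expr2 [leRHS]expr2 ler_wpM2r // -expr2.
Qed.

Lemma disc_Im_sqr (z : R[i]) : nrm z <= 1 ->
  complex.Im z ^+ 2 <= 2 * (1 - complex.Re z).
Proof.
move=> z1; have := nrm_sqr z; have : nrm z ^+ 2 <= 1 by rewrite exprn_ile1 ?nrm_ge0.
move: (complex.Re z) (complex.Im z) => a b h1 h2; have := sqr_ge0 (a - 1); rewrite sqrrB1.
by rewrite h2 in h1; lra.
Qed.

(** The angle [t = Im z] has [sin t] within [t ^ 2] of [Im z] and [cos t] within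
    [t ^ 2] of 1, and [t ^ 2] is at most twice the defect [1 - Re z]. *)
Lemma disc_sub_cis (z : R[i]) : nrm z <= 1 ->
  nrm (z - cis (complex.Im z)) <= 4 * (1 - complex.Re z).
Proof.
move=> z1; apply: le_trans (nrm_ReIm _) _; rewrite !raddfB /=.
have := abs_Im_le z; have := abs_Re_le z; have := disc_Im_sqr z1.
move: (complex.Re z) (complex.Im z) => a b bb ha hb.
have a1 : a <= 1 by apply: le_trans (ler_norm _) _; apply: le_trans ha z1.
have b1 : `|b| <= 1 by apply: le_trans hb z1.
have := abs_sub_sin b1; have /andP[c0 c1] := one_sub_cos b.
have : `|a - cos b| <= (1 - a) + (1 - cos b).
  by rewrite ler_norml; apply/andP; split; lra.
lra.
Qed.

End unimodular_replacement.

Section inverse_squares.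
Variable R : realType.

Lemma sum_inv_sqr (K M : nat) : (0 < K)%N ->
  \sum_(p < M.+1 | (K < p)%N) (p ^ 2)%N%:R^-1 <= (K%:R^-1 : R).
Proof.
move=> K0; suff : \sum_(p < M.+1 | (K < p)%N) (p ^ 2)%N%:R^-1 <=
    (if (K <= M)%N then K%:R^-1 - M%:R^-1 else 0 : R).
  move/le_trans; apply; case: ifP => _; last by rewrite invr_ge0.
  by rewrite gerBl invr_ge0.
elim: M => [|M IH].
  rewrite big_pred0 => [|p]; last by rewrite (ord1 p).
  by rewrite leqNgt K0.
rewrite big_mkcond big_ord_recr /= -big_mkcond /=.
rewrite ltnS; case: (leqP K M) IH => [KM|MK] IH; last first.
  rewrite addr0; apply: le_trans IH _; case: ifP => // KM1.
  have -> : K = M.+1 by apply/eqP; rewrite eqn_leq KM1 MK.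
  by rewrite subrr.
rewrite (leq_trans KM (leqnSn _)); apply: le_trans (lerD IH (lexx _)) _.
have M0 : (0 < M)%N by apply: leq_trans KM.
have m0 : 0 < (M%:R : R) by rewrite ltr0n.
rewrite natrX -natr1 -addrA lerD2l; move: (M%:R : R) m0 => m m0.
rewrite -subr_ge0; have -> : - (m + 1)^-1 - (- m^-1 + ((m + 1) ^+ 2)^-1) =
   1 / (m * (m + 1) ^+ 2).
  by field; rewrite !gt_eqF // addr_gt0.
by rewrite divr_ge0 // mulr_ge0 ?sqr_ge0 // ltW.
Qed.

End inverse_squares.

Section periodic_approximation.
Variables (R : realType) (f chi : nat -> R[i]) (q : nat).
Hypothesis f_nrm : forall n, (0 < n)%N -> nrm (f n) <= 1.
Hypothesis f_neq0 : forall n, (0 < n)%N -> f n != 0.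
Hypothesis f_mul : completely_multiplicative f.
Hypothesis chi_char : dirichlet_character q chi.
Local Notation theta := (twist f chi).

(** The contribution of [p] to the squared distance of [f] and [chi]. *)
Definition cost (p : nat) : R := p%:R^-1 * (1 - complex.Re (theta p)).

Lemma twist_nrm p : (0 < p)%N -> nrm (theta p) <= 1.
Proof.
by move=> p0; rewrite nrmM nrm_conj mulr_ile1 ?nrm_ge0 ?f_nrm ?(char_nrm chi_char).
Qed.

Lemma cost_ge0 p : (0 < p)%N -> 0 <= cost p.
Proof.
move=> p0; rewrite mulr_ge0 // subr_ge0; apply: le_trans (ler_norm _) _.
exact: le_trans (abs_Re_le _) (twist_nrm p0).
Qed.

Lemma cost_tail : pretends f chi -> forall d : R, 0 < d -> exists K : nat, forall N,
  \sum_(p < N | prime p && (K < p)%N) cost p <= d.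
Proof.
rewrite /pretends /pretentious_dist2 => fin d d0.
have c0 (k : nat) : (0 <= k)%N -> prime k -> (0 <= (cost k)%:E)%E.
  by move=> _ /prime_gt0 k0; rewrite lee_fin cost_ge0.
have : (\sum_(N <= k <oo | prime k) (cost k)%:E)%E @[N --> \oo] --> 0%E.
  by apply: nneseries_tail_cvg => // k pk; exact: c0.
move=> /fine_cvgP [fine_tail] /cvgrPdist_lt /(_ d d0) tail.
near \oo => K; exists K => N.
have h1 : (\sum_(K <= k <oo | prime k) (cost k)%:E)%E \is a fin_num by near: K.
have h2 : fine (\sum_(K <= k <oo | prime k) (cost k)%:E)%E < d.
  have : `|0 - fine (\sum_(K <= k <oo | prime k) (cost k)%:E)%E| < d by near: K.
  by rewrite sub0r normrN; apply: le_lt_trans (ler_norm _).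
apply: ltW; apply: le_lt_trans h2; rewrite -lee_fin fineK //.
have [KN|NK] := leqP K N; last first.
  rewrite big1; first by apply: nneseries_ge0 => k _; exact: c0.
  by move=> p /andP[_]; rewrite ltnNge (leq_trans (ltnW (ltn_ord p))) // ltnW.
apply: (@le_trans _ _ (\sum_(K <= k < N | prime k) (cost k)%:E)%E); last first.
  apply: nneseries_lim_ge => k Kk pk; exact: c0.
rewrite sumEFin lee_fin -(big_mkord (fun p => prime p && (K < p)%N) cost).
rewrite (big_cat_nat (leq0n K) KN) /= big_nat_cond big1 ?add0r; last first.
  by move=> p /andP[/andP[_ pK]] /andP[_]; rewrite ltnNge (ltnW pK).
rewrite [leRHS](bigID (fun p => (K < p)%N)) /= lerDl sumr_ge0 // => p /andP[/prime_gt0 p0 _].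
exact: cost_ge0.
Unshelve. all: by end_near.
Qed.

(** The values at the primes of the additive function whose exponential replaces
    the product of the twists. *)
Definition phase (K p : nat) : R :=
  if prime p && (K < p)%N then complex.Im (theta p) else 0.

Lemma phase_prime K p : ~~ prime p -> phase K p = 0.
Proof. by rewrite /phase => /negbTE ->. Qed.

(** At least 1 at the integers that [truncation_approx] does not cover, and small
    on average. *)
Definition irregular (K L N n : nat) : R :=
  \sum_(p < K.+1 | prime p) (p ^ L.+1 %| n)%N%:R +
  \sum_(p < N.+1 | prime p && (K < p)%N) (p ^ 2 %| n)%N%:R.

Lemma cis_sum (I : Type) (r : seq I) (P : pred I) (F : I -> R) :
  cis (\sum_(i <- r | P i) F i) = \prod_(i <- r | P i) cis (F i).
Proof.
by elim/big_rec2: _ => [|i y1 y2 _ <-]; rewrite ?cis0 ?cisD.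
Qed.

(** Replacing each twist by a unimodular number turns their product into [cis] of
    an additive function, and [cis] is Lipschitz. At irregular integers the
    trivial bound 2 is enough. *)
Lemma approx_pointwise K L N n (m : R) : (q <= K)%N -> (n < N)%N ->
  nrm (f n.+1 - cis m * truncation f chi (modulus f chi K L) n.+1) <=
  \sum_(p < N.+1 | prime p && (K < p)%N) (p %| n.+1)%N%:R * (4 * (1 - complex.Re (theta p)))
  + 2 * `|additive_fun (phase K) N n.+1 - m| + 2 * irregular K L N n.+1.
Proof.
move=> qK nN; set t := truncation _ _ _ _.
have t1 : nrm t <= 1 by apply: (truncation_nrm f_nrm chi_char); exact: modulus_gt0.
have re0 p : (0 < p)%N -> 0 <= 1 - complex.Re (theta p).
  move=> p0; rewrite subr_ge0; apply: le_trans (ler_norm _) _.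
  exact: le_trans (abs_Re_le _) (twist_nrm p0).
have s1 : 0 <= \sum_(p < N.+1 | prime p && (K < p)%N)
   (p %| n.+1)%N%:R * (4 * (1 - complex.Re (theta p))).
  by apply: sumr_ge0 => p /andP[/prime_gt0 p0 _]; rewrite !mulr_ge0 // re0.
have ir0 : 0 <= irregular K L N n.+1 by rewrite addr_ge0 // sumr_ge0.
have [/existsP [p /andP[pp pn]]|/existsPn small] :=
    boolP [exists p : 'I_K.+1, prime p && (p ^ L.+1 %| n.+1)%N].
  have : 1 <= irregular K L N n.+1.
    rewrite /irregular (bigD1 p) //= pn -addrA lerDl addr_ge0 ?sumr_ge0 //.
  have : nrm (f n.+1 - cis m * t) <= 2.
    by apply: le_trans (nrmB _ _) _; rewrite nrmM nrm_cis mul1r; have := f_nrm (ltn0Sn n); lra.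
  have := normr_ge0 (additive_fun (phase K) N n.+1 - m); lra.
have [/existsP [p /and3P[pp Kp pn]]|/existsPn large] :=
    boolP [exists p : 'I_N.+1, [&& prime p, (K < p)%N & (p ^ 2 %| n.+1)%N]].
  have : 1 <= irregular K L N n.+1.
    rewrite /irregular addrC (bigD1 p) /= ?pp ?Kp // pn -addrA lerDl addr_ge0 ?sumr_ge0 //.
  have : nrm (f n.+1 - cis m * t) <= 2.
    by apply: le_trans (nrmB _ _) _; rewrite nrmM nrm_cis mul1r; have := f_nrm (ltn0Sn n); lra.
  have := normr_ge0 (additive_fun (phase K) N n.+1 - m); lra.
rewrite (@truncation_approx _ f chi q f_neq0 f_mul chi_char K L N.+1 n.+1) //; first last.
- move=> p pp Kp; have [pN|Np] := ltnP p N.+1.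
    by have := large (Ordinal pN); rewrite /= pp Kp.
  apply/negP => /(dvdn_leq (ltn0Sn n)) h.
  have := leq_trans (leq_trans (leq_pmulr p (prime_gt0 pp)) (_ : (p * p <= n.+1)%N)) nN.
  by rewrite -mulnn in h; move/(_ h); rewrite leqNgt Np.
- by move=> p pp pK; have := small (Ordinal (pK : (p < K.+1)%N)); rewrite /= pp.
rewrite -/t; set P := \prod_(_ < _ | _) _.
have -> : t * P - cis m * t = t * (P - cis m) by ring.
rewrite nrmM; apply: (@le_trans _ _ (nrm (P - cis m))).
  by rewrite ler_piMl ?nrm_ge0.
pose U := \prod_(p < N.+1 | [&& prime p, (K < p)%N & (p %| n.+1)%N]) cis (phase K p).
have hU : U = cis (additive_fun (phase K) N n.+1).
  rewrite /U -cis_sum; congr cis; rewrite /additive_fun big_mkcond /=.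
  apply: eq_bigr => p _; rewrite /phase.
  by case: (prime p) (K < p)%N (p %| n.+1)%N => [] [] []; rewrite ?mul1r ?mul0r.
apply: le_trans (nrm_tri _ U _) _; rewrite -addrA; apply: lerD; last first.
  rewrite hU; apply: le_trans (cis_lip _ _) _; lra.
apply: le_trans (nrm_prod_lip _ _ _) _.
- by move=> p /andP[/prime_gt0 p0 _]; exact: twist_nrm.
- by move=> p _; rewrite nrm_cis.
rewrite [leRHS](bigID (fun p : 'I_N.+1 => (p %| n.+1)%N)) /=.
rewrite [X in _ + X]big1 ?addr0; last by move=> p /andP[_ /negbTE ->]; rewrite mul0r.
under [leRHS]eq_bigl => p do rewrite -andbA.
apply: ler_sum => p /and3P[pp Kp pn]; rewrite pn mul1r /phase pp Kp.
by apply: disc_sub_cis; exact/twist_nrm/prime_gt0.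
Qed.

Lemma approx_mean (K L N : nat) (S eta : R) : (q <= K)%N -> (0 < K)%N -> 0 < eta ->
  (forall M, \sum_(p < M | prime p && (K < p)%N) cost p <= S) ->
  exists2 W : R[i], nrm W = 1 &
    \sum_(n < N) nrm (f n.+1 - W * truncation f chi (modulus f chi K L) n.+1) <=
    N%:R * (4 * S + 2 * (2 * eta + 3 * (2 * S) / eta) +
            2 * (K.+1%:R / (2 ^ L.+1)%N%:R + K%:R^-1)).
Proof.
move=> qK K0 e0 HS.
have phS : \sum_(p < N.+1) phase K p ^+ 2 / p%:R <= 2 * S.
  apply: (@le_trans _ _ (2 * \sum_(p < N.+1 | prime p && (K < p)%N) cost p)); last first.
    by rewrite ler_pM2l.
  rewrite mulr_sumr [leRHS]big_mkcond /=; apply: ler_sum => p _.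
  rewrite /phase; case: ifP => [/andP[/prime_gt0 p0 _]|_]; last by rewrite expr0n mul0r.
  rewrite /cost mulrCA [leLHS]mulrC ler_wpM2l ?invr_ge0 //.
  exact/disc_Im_sqr/twist_nrm.
have [m Hm] := additive_concentration (@phase_prime K) e0 phS.
exists (cis m); first exact: nrm_cis.
apply: (@le_trans _ _ (\sum_(n < N) (\sum_(p < N.+1 | prime p && (K < p)%N)
    (p %| n.+1)%N%:R * (4 * (1 - complex.Re (theta p)))
  + 2 * `|additive_fun (phase K) N n.+1 - m| + 2 * irregular K L N n.+1))).
  by apply: ler_sum => n _; exact: approx_pointwise.
rewrite !big_split /= !mulrDr; apply: lerD; first apply: lerD.
- rewrite exchange_big /=.
  apply: (@le_trans _ _ (N%:R * (4 * \sum_(p < N.+1 | prime p && (K < p)%N) cost p))); last first.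
    by rewrite ler_wpM2l // ler_pM2l.
  rewrite !mulr_sumr; apply: ler_sum => p /andP[/prime_gt0 p0 _].
  rewrite -mulr_suml /cost.
  have -> : N%:R * (4 * (p%:R^-1 * (1 - complex.Re (theta p)))) =
     N%:R / p%:R * (4 * (1 - complex.Re (theta p))) by ring.
  apply: ler_wpM2r; last exact: sum_dvdn_le.
  have := cost_ge0 p0; rewrite /cost pmulr_rge0 ?invr_gt0 ?ltr0n // => h.
  by rewrite mulr_ge0.
- rewrite -mulr_sumr -!mulrDr [leRHS]mulrCA ler_pM2l //.
- rewrite -!mulrDr -mulr_sumr [leRHS]mulrCA ler_pM2l // /irregular big_split /= mulrDr.
  apply: lerD.
    rewrite exchange_big /=.
    apply: (@le_trans _ _ (\sum_(p < K.+1 | prime p) N%:R / (2 ^ L.+1)%N%:R)).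
      apply: ler_sum => p pp; apply: le_trans (sum_dvdn_le _ _ _) _.
        by rewrite expn_gt0 prime_gt0.
      rewrite ler_wpM2l // lef_pV2 ?posrE ?ltr0n ?expn_gt0 ?prime_gt0 // ler_nat.
      by rewrite leq_exp2r // prime_gt1.
    apply: (@le_trans _ _ (\sum_(p < K.+1) N%:R / (2 ^ L.+1)%N%:R)).
      by rewrite [leRHS](bigID (fun p : 'I_K.+1 => prime p)) /= lerDl sumr_ge0.
    by rewrite sumr_const card_ord -[leLHS]mulr_natr -mulrA [_^-1 * _]mulrC.
  rewrite exchange_big /=.
  apply: (@le_trans _ _ (\sum_(p < N.+1 | (K < p)%N) N%:R * (p ^ 2)%N%:R^-1)).
    rewrite [leRHS](bigID (fun p : 'I_N.+1 => prime p)) /= ler_wpDr ?sumr_ge0 //.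
    under [leRHS]eq_bigl => p do rewrite andbC.
    apply: ler_sum => p /andP[pp _]; apply: sum_dvdn_le.
    by rewrite expn_gt0 prime_gt0.
  by rewrite -mulr_sumr ler_wpM2l // sum_inv_sqr.
Qed.

(** The phase [W] varies with the range [N], because the centre of the
    additive function need not converge; the model does not vary. *)
Lemma periodic_approx : pretends f chi -> forall (e : R) (K1 : nat), 0 < e ->
  exists K L1 : nat, (K1 <= K)%N /\ forall L N, (L1 <= L)%N ->
  exists2 W : R[i], nrm W = 1 &
    \sum_(n < N) nrm (f n.+1 - W * truncation f chi (modulus f chi K L) n.+1) <=
    e * N%:R.
Proof.
(* [eta], then [d], then [K] and [L1] together make one group of error terms of
   [approx_mean] at most [e / 4]. *)
move=> fchi e K1 e0; pose eta := e / 16.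
have eta0 : 0 < eta by rewrite divr_gt0.
pose d := e / 4 / (4 + 12 / eta).
have d0 : 0 < d.
  by rewrite divr_gt0 ?divr_gt0 // addr_gt0 // divr_gt0.
have [K0 HK0] := cost_tail fchi d0.
pose K := maxn (maxn K0 K1) (maxn q.+1 (Num.bound (16 / e))).
have K0K : (K0 <= K)%N by rewrite !leq_max leqnn.
have K1K : (K1 <= K)%N by rewrite !leq_max leqnn orbT.
have qK : (q < K)%N by rewrite !leq_max leqnn !orbT.
have Kg : (0 < K)%N by apply: leq_ltn_trans qK.
have KV : K%:R^-1 <= e / 16.
  rewrite -[leRHS]invrK lef_pV2 ?posrE ?invr_gt0 ?ltr0n ?divr_gt0 // invf_div.
  apply: ltW; apply: lt_le_trans (archi_boundP _) _; first by rewrite divr_ge0 // ltW.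
  by rewrite ler_nat !leq_max leqnn !orbT.
have HS M : \sum_(p < M | prime p && (K < p)%N) cost p <= d.
  apply: le_trans (HK0 M).
  rewrite [leRHS](bigID (fun p : 'I_M => (K < p)%N)) /= ler_wpDr //.
    by apply: sumr_ge0 => p /andP[/andP[/prime_gt0 p0 _] _]; exact: cost_ge0.
  rewrite le_eqVlt; apply/orP; left; apply/eqP; apply: eq_bigl => p.
  by case: (prime p) => //=; case: ltnP => Kp; rewrite ?andbF // andbT (leq_ltn_trans K0K).
pose L1 := Num.bound (16 * K.+1%:R / e).
exists K, L1; split => // L N L1L.
have [W W1 HW] := approx_mean L N (ltnW qK) Kg eta0 HS.
exists W => //; apply: le_trans HW _; rewrite mulrC ler_wpM2r //.
have LV : K.+1%:R / (2 ^ L.+1)%N%:R <= e / 16.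
  have pos : 0 <= 16 * K.+1%:R / e by rewrite divr_ge0 ?(ltW e0) // mulr_ge0.
  have B := archi_boundP pos; rewrite -/L1 in B.
  have C : L1%:R <= (2 ^ L.+1)%N%:R :> R.
    rewrite ler_nat; apply: leq_trans L1L _; apply: ltnW.
    by apply: leq_trans (ltn_expl L (ltnSn 1)) _; rewrite leq_exp2l.
  have := lt_le_trans B C; rewrite ltr_pdivrMr // ler_pdivrMr ?ltr0n ?expn_gt0 //.
  by move: (K.+1%:R : R) ((2 ^ L.+1)%N%:R : R) => u v; lra.
have dE : 4 * d + 2 * (3 * (2 * d) / eta) = e / 4.
  rewrite (_ : _ + _ = d * (4 + 12 / eta)); last by ring.
  by rewrite /d mulfVK // gt_eqF // addr_gt0 // divr_gt0.
by rewrite /eta in dE *; lra.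
Qed.

End periodic_approximation.

(** * Fourier coefficients of periodic functions *)

Section periodic_sums.
Variable R : realType.
Implicit Types (G P : nat -> R[i]) (z : R[i]).

Definition periodic (M : nat) (G : nat -> R[i]) := forall n, G (n + M)%N = G n.

Lemma periodicM M k G : periodic M G -> periodic (M * k) G.
Proof.
by move=> per n; elim: k => [|k IH]; rewrite ?muln0 ?addn0 // mulnS addnCA addnC per.
Qed.

Lemma periodic_dvd M M' G : periodic M G -> (M %| M')%N -> periodic M' G.
Proof. by move=> per /dvdnP [k ->]; rewrite mulnC; exact: periodicM. Qed.

Lemma periodic_mod M G n : periodic M G -> G (n %% M)%N = G n.
Proof.
by move=> per; rewrite [in RHS](divn_eq n M) addnC mulnC (periodicM (n %/ M) per).
Qed.

Lemma periodic_reindex M G (h : nat -> nat) : (0 < M)%N -> periodic M G ->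
  (forall i j : nat, (i < M)%N -> (j < M)%N -> h i = h j %[mod M] -> i = j) ->
  \sum_(n < M) G (h n) = \sum_(n < M) G n.
Proof.
move=> M0 per inj; pose h' (i : 'I_M) : 'I_M := Ordinal (ltn_pmod (h i) M0).
rewrite [RHS](reindex_inj (h := h')).
  by apply: eq_bigr => i _; rewrite /= periodic_mod.
by move=> i j /(congr1 val) /= e; apply: val_inj; exact: (inj _ _ (ltn_ord i) (ltn_ord j) e).
Qed.

Lemma periodic_shift M G k : (0 < M)%N -> periodic M G ->
  \sum_(n < M) G (n + k)%N = \sum_(n < M) G n.
Proof.
move=> M0 per; apply: (periodic_reindex (h := addn^~ k) M0 per) => i j iM jM /eqP.
by rewrite eqn_modDr !modn_small // => /eqP.
Qed.

Lemma periodic_mul M G u : (0 < M)%N -> coprime u M -> periodic M G ->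
  \sum_(n < M) G (u * n)%N = \sum_(n < M) G n.
Proof.
move=> M0 cop per; apply: (periodic_reindex (h := muln u) M0 per).
have main i j : (i <= j)%N -> (j < M)%N -> (u * i = u * j %[mod M])%N -> i = j.
  move=> ij jM /eqP; rewrite eq_sym eqn_mod_dvd ?leq_mul // -mulnBr Gauss_dvdr; last first.
    by rewrite coprime_sym.
  have [|lt0] := posnP (j - i); first by move=> /eqP; rewrite subn_eq0 => ji _; apply/eqP; rewrite eqn_leq ij.
  by move=> /(dvdn_leq lt0); rewrite leqNgt (leq_ltn_trans (leq_subr _ _)).
move=> i j iM jM e; have [ij|ji] := leqP i j; first exact: main.
by apply/esym/main => //; exact: ltnW.
Qed.

Lemma periodic_sum_mul M k G : periodic M G ->
  \sum_(n < M * k) G n = k%:R * \sum_(n < M) G n.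
Proof.
move=> per; elim: k => [|k IH]; first by rewrite muln0 big_ord0 mul0r.
rewrite mulnSr big_split_ord /= IH -natr1 mulrDl mul1r; congr (_ + _).
by apply: eq_bigr => i _; rewrite addnC (periodicM k per).
Qed.

Lemma sum_multiples d k (H : nat -> R[i]) : (0 < d)%N ->
  \sum_(n < d * k) (d %| n.+1)%N%:R * H (n.+1 %/ d)%N = \sum_(m < k) H m.+1.
Proof.
move=> d0; elim: k => [|k IH]; first by rewrite muln0 !big_ord0.
rewrite mulnSr big_split_ord /= IH big_ord_recr /=; congr (_ + _).
case: d d0 {IH} => // d _; rewrite big_ord_recr /= big1 ?add0r.
  by rewrite -addnS -mulnSr dvdn_mulr // mul1r mulKn.
move=> i _; rewrite -addnS dvdn_addr ?dvdn_mulr //.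
by rewrite gtnNdvd ?mul0r // ltnS.
Qed.

(** The frequency is recorded by the root of unity [z]. The sum starts at 1
    because arithmetic functions are controlled at positive integers only. *)
Definition fcoef (M : nat) P z : R[i] := M%:R^-1 * \sum_(n < M) P n.+1 * z ^+ n.+1.

Lemma natC_neq0 n : (0 < n)%N -> (n%:R : R[i]) != 0.
Proof. by rewrite pnatr_eq0 lt0n. Qed.

Lemma fcoefE M P z : (0 < M)%N -> periodic M P -> z ^+ M = 1 ->
  fcoef M P z = M%:R^-1 * \sum_(n < M) P n * z ^+ n.
Proof.
move=> M0 per zM; congr (_ * _); rewrite -(periodic_shift 1 M0 (G := fun n => P n * z ^+ n)).
  by apply: eq_bigr => n _; rewrite addn1.
by move=> n; rewrite per exprD zM mulr1.
Qed.

Lemma periodic_exp M P z : periodic M P -> z ^+ M = 1 ->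
  periodic M (fun n => P n.+1 * z ^+ n.+1).
Proof. by move=> per zM n; rewrite -addSn per exprD zM mulr1. Qed.

Lemma fcoef_period M M' P z : (0 < M)%N -> periodic M P -> z ^+ M = 1 ->
  (M %| M')%N -> (0 < M')%N -> fcoef M' P z = fcoef M P z.
Proof.
move=> M0 per zM /dvdnP [k ->]; rewrite muln_gt0 => /andP[k0 _]; rewrite /fcoef mulnC.
rewrite (periodic_sum_mul k (periodic_exp per zM)) natrM.
by rewrite invfM -mulrA mulKf // natC_neq0.
Qed.

(** Shifting by the period [M] multiplies the coefficient by [z ^+ M]. *)
Lemma fcoef_eq0 M M' P z : (0 < M)%N -> periodic M P -> (M %| M')%N ->
  (0 < M')%N -> z ^+ M' = 1 -> z ^+ M != 1 -> fcoef M' P z = 0.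
Proof.
move=> M0 per MM' M'0 zM' zM; rewrite /fcoef.
set S := \sum_(_ < _) _; suff -> : S = 0 by rewrite mulr0.
have perM' : periodic M' (fun n => P n.+1 * z ^+ n.+1).
  exact: periodic_exp (periodic_dvd per MM') zM'.
have : z ^+ M * S = S.
  rewrite -[RHS](periodic_shift M M'0 perM') mulr_sumr; apply: eq_bigr => n _.
  by rewrite -addSn per exprD; ring.
move=> /eqP; rewrite -subr_eq0 -{2}[S]mul1r -mulrBl mulf_eq0 subr_eq0 (negbTE zM) /=.
by move/eqP.
Qed.

(** Dilation by a unit [u] permutes the residues. *)
Lemma fcoef_unit M P z (u : nat) (c : R[i]) : (0 < M)%N -> periodic M P ->
  z ^+ M = 1 -> coprime u M -> (forall n, P (u * n)%N = c * P n) ->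
  fcoef M P z = c * fcoef M P (z ^+ u).
Proof.
move=> M0 per zM cop Pu; rewrite !fcoefE //; last by rewrite exprAC zM expr1n.
rewrite -(periodic_mul M0 cop (G := fun n => P n * z ^+ n)); last first.
  by move=> n; rewrite per exprD zM mulr1.
rewrite mulrCA; congr (_ * _); rewrite mulr_sumr; apply: eq_bigr => n _.
by rewrite Pu exprM mulrA.
Qed.

End periodic_sums.

Section truncation_fourier.
Variables (R : realType) (f chi : nat -> R[i]) (q : nat).
Hypothesis f_neq0 : forall n, (0 < n)%N -> f n != 0.
Hypothesis f_mul : completely_multiplicative f.
Hypothesis chi_char : dirichlet_character q chi.
Local Notation trunc := (truncation f chi).
Local Notation q_gt0 := (char_gt0 chi_char).

Lemma truncation_periodic D : (0 < D)%N -> periodic (q * D) (trunc D).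
Proof.
move=> D0 n; rewrite /truncation mulnC.
have -> : gcdn (n + D * q) D = gcdn n D by rewrite gcdnC addnC mulnC gcdnMDl gcdnC.
set g := gcdn n D; have g0 : (0 < g)%N by rewrite gcdn_gt0 D0 orbT.
have -> : ((n + D * q) %/ g = n %/ g + (D %/ g) * q)%N.
  by rewrite divnDr ?dvdn_mulr ?dvdn_gcdr // divn_mulAC ?dvdn_gcdr.
by rewrite (char_addM chi_char).
Qed.

Lemma truncation_unit D u n : coprime u D -> trunc D (u * n)%N = chi u * trunc D n.
Proof.
move=> cop; rewrite /truncation.
have -> : gcdn (u * n) D = gcdn n D.
  by rewrite gcdnC Gauss_gcdr 1?coprime_sym // gcdnC.
by rewrite -muln_divA ?dvdn_gcdl // (charM chi_char); ring.
Qed.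

Lemma cmulX p k : (0 < p)%N -> f (p ^ k)%N = f p ^+ k.
Proof.
move=> p0; elim: k => [|k IH]; first by rewrite expn0 (cmul1 f_neq0 f_mul).
by rewrite expnS f_mul ?expn_gt0 ?p0 // IH exprS.
Qed.

(** The Dirichlet convolution of [f] and the inverse of [chi], at [p ^ j]. *)
Definition local_coef (p j : nat) : R[i] :=
  if j is j'.+1 then f p ^+ j' * (f p - chi p) else 1.

Lemma local_coef_sum p v m : (m <= v)%N ->
  \sum_(j < m.+1) local_coef p j * chi p ^+ (v - j) = f p ^+ m * chi p ^+ (v - m).
Proof.
elim: m => [|m IH] mv; first by rewrite big_ord_recl big_ord0 addr0 /= !mul1r subn0.
rewrite big_ord_recr /= IH ?(ltnW mv) //.
by rewrite -(subnSK mv) !exprS; ring.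
Qed.

(** As [f] is the convolution of [chi] with [local_coef] at [p], stopping the
    convolution at [p ^ L] freezes [f] there. *)
Lemma truncation_local D p L n : (0 < D)%N -> prime p -> coprime p D -> (0 < n)%N ->
  trunc (D * p ^ L) n =
  \sum_(j < L.+1) local_coef p j * ((p ^ j %| n)%N%:R * trunc D (n %/ p ^ j)%N).
Proof.
move=> D0 pp cop n0; have p0 := prime_gt0 pp.
have [n' cn' nE] := pfactor_coprime pp n0; set v := logn p n in nE.
have n'0 : (0 < n')%N by move: n0; rewrite nE muln_gt0 => /andP[].
pose m := minn v L.
have gE : gcdn n (D * p ^ L) = (p ^ m * gcdn n' D)%N.
  have cn k : coprime n' (p ^ k) by rewrite coprime_sym coprimeXl.
  have cD k : coprime D (p ^ k) by rewrite coprime_sym coprimeXl.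
  rewrite {1}nE mulnC [(D * _)%N]mulnC /m; have [vL|Lv] := leqP v L.
    by rewrite -(subnKC vL) expnD -mulnA -muln_gcdr Gauss_gcdr.
  by rewrite -(subnKC (ltnW Lv)) expnD -mulnA -muln_gcdr gcdnC Gauss_gcdr // gcdnC.
have g'0 : (0 < gcdn n' D)%N by rewrite gcdn_gt0 n'0.
have mv : (m <= v)%N by rewrite geq_minl.
have quo k j : (k <= j)%N -> (p ^ j * n' %/ p ^ k = p ^ (j - k) * n')%N.
  by move=> kj; rewrite -{1}(subnKC kj) expnD -mulnA mulKn // expn_gt0 p0.
have tn' k : trunc D (p ^ k * n')%N = chi p ^+ k * trunc D n'.
  by rewrite truncation_unit ?coprimeXl // (charX chi_char).
have nE' : n = (p ^ v * n')%N by rewrite mulnC.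
transitivity (f p ^+ m * chi p ^+ (v - m) * trunc D n').
  rewrite /truncation gE f_mul ?expn_gt0 ?p0 // cmulX //.
  have -> : (n %/ (p ^ m * gcdn n' D) = p ^ (v - m) * (n' %/ gcdn n' D))%N.
    by rewrite divnMA nE' quo // muln_divA ?dvdn_gcdl.
  by rewrite (charM chi_char) (charX chi_char); ring.
rewrite -local_coef_sum // mulr_suml.
rewrite (big_ord_widen L.+1 (fun j => local_coef p j * chi p ^+ (v - j) * trunc D n')).
  rewrite big_mkcond /=; apply: eq_bigr => j _.
  have jL : (j <= L)%N by rewrite -ltnS.
  rewrite pfactor_dvdn // -/v ltnS leq_min jL andbT.
  by case: leqP => jv; rewrite ?mul0r ?mulr0 // mul1r nE' quo // tn' mulrA.
by rewrite ltnS geq_minr.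
Qed.

(** On the multiples of [p ^ j] the frequency is multiplied by [p ^ j]. *)
Lemma fcoef_local M D p L z : (0 < D)%N -> prime p -> coprime p D ->
  (q * (D * p ^ L) %| M)%N -> (0 < M)%N -> z ^+ M = 1 ->
  fcoef M (trunc (D * p ^ L)) z =
  \sum_(j < L.+1) local_coef p j * (p ^ j)%N%:R^-1 * fcoef M (trunc D) (z ^+ (p ^ j)).
Proof.
move=> D0 pp cop dM M0 zM; have p0 := prime_gt0 pp.
rewrite {1}/fcoef; under eq_bigr => n _ do rewrite truncation_local // mulr_suml.
rewrite exchange_big /= mulr_sumr; apply: eq_bigr => j _.
have pj0 : (0 < p ^ j)%N by rewrite expn_gt0 p0.
have pjL : (p ^ j %| p ^ L)%N by rewrite dvdn_exp2l // -ltnS.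
have [k Mk] : exists k, M = (p ^ j * k)%N.
  have /dvdnP [k ->] : (p ^ j %| M)%N.
    by apply: dvdn_trans dM; rewrite dvdn_mull // dvdn_mull.
  by exists k; rewrite mulnC.
have k0 : (0 < k)%N by move: M0; rewrite Mk muln_gt0 => /andP[].
have qDk : (q * D %| k)%N.
  rewrite -(dvdn_pmul2l pj0) -Mk; apply: dvdn_trans dM.
  by rewrite [X in (X %| _)%N]mulnC mulnA dvdn_mul.
have zk : (z ^+ (p ^ j)) ^+ k = 1 by rewrite -exprM -Mk.
have qD0 : (0 < q * D)%N by rewrite muln_gt0 q_gt0.
have perk : periodic k (trunc D) := periodic_dvd (truncation_periodic D0) qDk.
have -> : fcoef M (trunc D) (z ^+ (p ^ j)) = fcoef k (trunc D) (z ^+ (p ^ j)).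
  by apply: (fcoef_period k0 perk zk) => //; rewrite Mk dvdn_mull.
have -> : \sum_(n < M) local_coef p j *
    ((p ^ j %| n.+1)%N%:R * trunc D (n.+1 %/ p ^ j)%N) * z ^+ n.+1 =
    local_coef p j * \sum_(m < k) trunc D m.+1 * (z ^+ (p ^ j)) ^+ m.+1.
  rewrite -(sum_multiples k (fun n => trunc D n * (z ^+ (p ^ j)) ^+ n) pj0) -Mk.
  rewrite mulr_sumr; apply: eq_bigr => n _.
  case: (boolP (p ^ j %| n.+1)%N) => [dv|_]; last by rewrite !mul0r !mulr0 mul0r.
  by rewrite !mul1r -exprM [(p ^ j * _)%N]mulnC divnK // mulrA.
by rewrite /fcoef Mk natrM invfM; ring.
Qed.

End truncation_fourier.

(** * Primitive characters and Gauss sums *)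

Section unit_lifting.

Lemma coprime_prime_test (u n : nat) : (0 < n)%N ->
  (forall p, prime p -> (p %| u)%N -> (p %| n)%N -> False) -> coprime u n.
Proof.
move=> n0 H; rewrite /coprime; apply/negPn/negP => g1.
have g0 : (0 < gcdn u n)%N by rewrite gcdn_gt0 n0 orbT.
have pg : prime (pdiv (gcdn u n)) by rewrite pdiv_prime // ltn_neqAle eq_sym g1.
have := pdiv_dvd (gcdn u n); rewrite dvdn_gcd => /andP[]; exact: H.
Qed.

(** Chinese remainder theorem, with residue 1 at the primes that divide [D] but
    not [q]. *)
Lemma unit_lift (q D x : nat) : (0 < q)%N -> (0 < D)%N -> coprime x q ->
  exists2 u : nat, u = x %[mod q] & coprime u (q * D).
Proof.
move=> q0 D0 xq; pose D' := (\prod_(p <- primes D | ~~ (p %| q)) p)%N.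
have cop : coprime q D'.
  rewrite /D' big_seq_cond; elim/big_ind: _ => [|a b ha hb|p].
  - exact: coprimen1.
  - by rewrite coprimeMr ha.
  - by rewrite mem_primes => /andP[/and3P[pp _ _] pq]; rewrite coprime_sym prime_coprime.
have D'0 : (0 < D')%N.
  rewrite /D' big_seq_cond; apply: prodn_cond_gt0 => p /andP[].
  by rewrite mem_primes => /andP[/prime_gt0].
pose u := chinese q D' x 1.
have uq : u = x %[mod q] by exact: chinese_modl.
have uD : u = 1 %[mod D'] by exact: chinese_modr.
exists u => //; apply: coprime_prime_test => [|p pp pu]; first by rewrite muln_gt0 q0.
have npq : ~~ (p %| q)%N.
  apply/negP => pq; have px : (p %| x)%N.
    have := congr1 (modn^~ p) uq; rewrite !modn_dvdm // => up.
    by rewrite /dvdn -up.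
  have : (p %| gcdn x q)%N by rewrite dvdn_gcd px.
  by rewrite (eqP xq) dvdn1 => /eqP p1; move: pp; rewrite p1.
rewrite Euclid_dvdM // (negbTE npq) /= => pD.
have pD' : (p %| D')%N.
  by rewrite /D' (big_rem p) ?mem_primes ?pp ?D0 //= npq dvdn_mulr.
have := congr1 (modn^~ p) uD; rewrite !modn_dvdm // (eqP pu) modn_small ?prime_gt1 //.
Qed.

End unit_lifting.

Section primitive_characters.
Variables (R : realType) (chi : nat -> R[i]) (q : nat).
Hypothesis chi_prim : primitive_dirichlet_character q chi.

Lemma prim_char : dirichlet_character q chi. Proof. by case: chi_prim. Qed.

(** Otherwise [chi] would depend on [n] modulo [q %/ p] only and descend to a
    character of that modulus. *)
Lemma primitive_nontrivial (p : nat) : prime p -> (p %| q)%N ->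
  exists x : nat, [/\ coprime x q, x = 1 %[mod q %/ p] & chi x != 1].
Proof.
move=> pp pq; set d := (q %/ p)%N; apply: contrapT => /forallNP H.
have chi_char := prim_char; have q0 := char_gt0 chi_char.
have triv x : coprime x q -> x = 1 %[mod d] -> chi x = 1.
  by move=> xq x1; apply/eqP/negPn/negP => nx; apply: (H x).
have qE : q = (d * p)%N by rewrite divnK.
have dq : (d %| q)%N by rewrite qE dvdn_mulr.
have d0 : (0 < d)%N by move: q0; rewrite qE muln_gt0 => /andP[].
have ltdq : (d < q)%N by rewrite qE -[ltnLHS]muln1 ltn_pmul2l // prime_gt1.
have descend x y : coprime x q -> coprime y q -> x = y %[mod d] -> chi x = chi y.
  move=> xq yq xy; pose y' := (y ^ (totient q).-1)%N.
  have yy' : (y * y')%N = 1 %[mod q].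
    by rewrite -expnS prednK ?totient_gt0 //; exact: cyclic.Euler_exp_totient.
  have y'q : coprime y' q by rewrite coprimeXl.
  have y'0 : chi y' != 0 by rewrite (char_neq0 chi_char).
  apply: (mulIf y'0); rewrite -!(charM chi_char) (char_eqmod chi_char yy') (char1 chi_char).
  apply: triv; first by rewrite coprimeMl xq.
  have := congr1 (modn^~ d) yy'; rewrite !modn_dvdm // => <-.
  by rewrite -modnMml xy modnMml.
have /boolp.choice [lift Hlift] : forall n, exists u : nat, coprime n d ->
    u = n %[mod d] /\ coprime u q.
  move=> n; have [nd|] := boolP (coprime n d); last by exists 0%N.
  have [u un ucop] := unit_lift d0 q0 nd; exists u => _; split => //.
  by move: ucop; rewrite coprimeMr => /andP[].
pose psi n : R[i] := if coprime n d then chi (lift n) else 0.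
have psi_char : dirichlet_character d psi.
  split => //.
  - move=> m n; rewrite /psi coprimeMl.
    have [md|] := boolP (coprime m d); last by rewrite mul0r.
    have [nd|] := boolP (coprime n d); last by rewrite mulr0.
    have [m1 m2] := Hlift _ md; have [n1 n2] := Hlift _ nd.
    have [k1 k2] : lift (m * n)%N = (m * n)%N %[mod d] /\ coprime (lift (m * n)%N) q.
      by apply: Hlift; rewrite coprimeMl md.
    rewrite /= -(charM chi_char); apply: descend => //; first by rewrite coprimeMl m2.
    by rewrite k1 -modnMm -m1 -n1 modnMm.
  - move=> n; rewrite /psi.
    have -> : coprime (n + d) d = coprime n d by rewrite -coprime_modl modnDr coprime_modl.
    have [nd|//] := boolP (coprime n d).
    have nd' : coprime (n + d) d by rewrite -coprime_modl modnDr coprime_modl.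
    have [n1 n2] := Hlift _ nd; have [m1 m2] := Hlift _ nd'.
    by apply: descend => //; rewrite m1 n1 modnDr.
  - move=> n; rewrite /psi; have [nd|_] := boolP (coprime n d); last by rewrite eqxx.
    by split => // _; rewrite (char_neq0 chi_char); have [] := Hlift _ nd.
have [_ /(_ d psi dq ltdq psi_char)] := chi_prim; apply => n nq.
have nd : coprime n d by apply: coprime_dvdr dq nq.
rewrite /psi nd; have [n1 n2] := Hlift _ nd.
by apply: descend.
Qed.

Variable f : nat -> R[i].
Hypothesis f_neq0 : forall n, (0 < n)%N -> f n != 0.
Hypothesis f_mul : completely_multiplicative f.
Local Notation trunc := (truncation f chi).
Local Notation chi_char := prim_char.
Local Notation q_gt0 := (char_gt0 chi_char).
Variable zeta : R[i].
Hypothesis zeta_prim : q.-primitive_root zeta.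

Lemma zetaX_q k D : (zeta ^+ k) ^+ (q * D) = 1.
Proof. by rewrite exprAC exprM (prim_expr_order zeta_prim) !expr1n. Qed.

(** Dilation by a unit congruent to 1 modulo [q %/ p] preserves the frequency
    but multiplies the coefficient by a value of [chi] other than 1. *)
Lemma fcoef_noncoprime D (p a : nat) : (0 < D)%N -> prime p -> (p %| q)%N ->
  (p %| a)%N -> fcoef (q * D) (trunc D) (zeta ^+ a) = 0.
Proof.
move=> D0 pp pq pa; have [x [xq x1 chix]] := primitive_nontrivial pp pq.
have [u ux ucop] := unit_lift q_gt0 D0 xq.
have qD0 : (0 < q * D)%N by rewrite muln_gt0 q_gt0.
have /= := fcoef_unit qD0 (truncation_periodic f chi_char D0) (zetaX_q a D) ucop
  (fun n => truncation_unit f chi_char n (proj2 (andP (etrans (esym (coprimeMr _ _ _)) ucop)))).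
have -> : (zeta ^+ a) ^+ u = zeta ^+ a.
  rewrite -exprM; apply/eqP; rewrite (eq_prim_root_expr zeta_prim).
  have /dvdnP [a' aE] := pa.
  have ud : u = 1 %[mod q %/ p].
    have dq : (q %/ p %| q)%N by rewrite -{2}(divnK pq) dvdn_mulr.
    by have := congr1 (modn^~ (q %/ p)%N) ux; rewrite !modn_dvdm // x1.
  rewrite aE mulnAC -{1 2}(divnK pq) -!muln_modl.
  by rewrite -modnMmr ud modnMmr muln1.
rewrite (char_eqmod chi_char ux) => /eqP; rewrite -subr_eq0 -{1}[fcoef _ _ _]mul1r -mulrBl.
by rewrite mulf_eq0 subr_eq0 eq_sym (negbTE chix) => /eqP.
Qed.

Lemma fcoef_coprime D u : (0 < D)%N -> coprime u (q * D) ->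
  fcoef (q * D) (trunc D) zeta = chi u * fcoef (q * D) (trunc D) (zeta ^+ u).
Proof.
move=> D0 ucop; have qD0 : (0 < q * D)%N by rewrite muln_gt0 q_gt0.
have := zetaX_q 1 D; rewrite expr1 => zM.
apply: (fcoef_unit qD0 (truncation_periodic f chi_char D0) zM ucop) => n.
by apply: (truncation_unit f chi_char); move: ucop; rewrite coprimeMr => /andP[].
Qed.

(** If [p] divides [q] both sides vanish for [0 < i]; otherwise [p ^ i] is a unit
    modulo the period. *)
Lemma fcoef_prime_power D p i : (0 < D)%N -> prime p -> coprime p D ->
  fcoef (q * D) (trunc D) (zeta ^+ (p ^ i)) =
  ((chi p)^*) ^+ i * fcoef (q * D) (trunc D) zeta.
Proof.
move=> D0 pp cop; have [cpq|npq] := boolP (coprime p q).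
  have ucop : coprime (p ^ i) (q * D) by rewrite coprimeXl // coprimeMr cpq.
  rewrite (fcoef_coprime D0 ucop) (charX chi_char) mulrA -exprMn [_^* * _]mulrC.
  by rewrite mul_conj_nrm (char_unit chi_char cpq) !expr1n mul1r.
have chip : chi p = 0 by move: npq; rewrite -(char_neq0 chi_char) negbK => /eqP.
rewrite chip; have -> : (0 : R[i])^* = 0 by rewrite rmorph0.
case: i => [|i]; first by rewrite expn0 expr1 mul1r.
rewrite expr0n mul0r; apply: (@fcoef_noncoprime D p) => //.
  by move: npq; rewrite prime_coprime // negbK.
by rewrite expnS dvdn_mulr.
Qed.

(** Otherwise all Fourier coefficients of [chi] would vanish: at the frequencies
    prime to [q] by dilation, at the others by primitivity. *)
Lemma gauss_neq0 : fcoef q chi zeta != 0.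
Proof.
have t1 n : trunc 1 n = chi n.
  by rewrite /truncation gcdn1 divn1 (cmul1 f_neq0 f_mul) mul1r.
have tE : trunc 1 = chi by apply/funext.
apply/eqP => g0.
have all0 a : fcoef q chi (zeta ^+ a) = 0.
  have [aq|naq] := boolP (coprime a q).
    have := @fcoef_coprime 1 a isT; rewrite muln1 tE => /(_ aq).
    rewrite g0 => /esym/eqP; rewrite mulf_eq0 => /orP[/eqP c0|/eqP//].
    by have := char_neq0 chi_char a; rewrite aq c0 eqxx.
  have ga : (1 < gcdn a q)%N.
    by rewrite ltn_neqAle eq_sym naq gcdn_gt0 q_gt0 orbT.
  have := pdiv_dvd (gcdn a q); rewrite dvdn_gcd => /andP[pa pq].
  have := @fcoef_noncoprime 1 _ a isT (pdiv_prime ga) pq pa.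
  by rewrite muln1 tE.
have qz : (q%:R : R[i]) != 0 by rewrite natC_neq0 // q_gt0.
have sum0 a : \sum_(n < q) chi n.+1 * (zeta ^+ a) ^+ n.+1 = 0.
  by have /eqP := all0 a; rewrite /fcoef mulf_eq0 invr_eq0 (negbTE qz) => /eqP.
(* Fourier inversion at the residue 1, where [chi] equals 1. *)
have : \sum_(a < q) (zeta ^+ a) ^+ q.-1 * \sum_(n < q) chi n.+1 * (zeta ^+ a) ^+ n.+1 = q%:R.
  under eq_bigr do rewrite mulr_sumr.
  rewrite exchange_big /=.
  transitivity (\sum_(n < q) chi n.+1 * \sum_(a < q) (zeta ^+ n) ^+ a).
    apply: eq_bigr => n _; rewrite mulr_sumr; apply: eq_bigr => a _.
    rewrite mulrCA; congr (_ * _); rewrite -!exprM -exprD.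
    rewrite -mulnDr addnC addSnnS prednK ?q_gt0 // mulnDr exprD [(a * q)%N]mulnC.
    by rewrite [zeta ^+ (q * a)]exprM (prim_expr_order zeta_prim) expr1n mulr1 mulnC.
  rewrite (bigD1 (Ordinal q_gt0)) //= [X in _ + X]big1 ?addr0.
    rewrite (char1 chi_char) mul1r; under eq_bigr => a _ do rewrite expr1n.
    by rewrite sumr_const card_ord.
  move=> n n0; suff -> : \sum_(a < q) (zeta ^+ n) ^+ a = 0 by rewrite mulr0.
  have : (zeta ^+ n - 1) * \sum_(a < q) (zeta ^+ n) ^+ a = 0.
    by rewrite -subrX1 exprAC (prim_expr_order zeta_prim) expr1n subrr.
  move=> /eqP; rewrite mulf_eq0 subr_eq0 -(prim_order_dvd zeta_prim) => /orP[|/eqP//].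
  by rewrite gtnNdvd // lt0n; apply: contra n0 => /eqP h; apply/eqP/val_inj.
rewrite big1 => [/esym/eqP|a _]; last by rewrite sum0 mulr0.
by rewrite (negbTE qz).
Qed.

End primitive_characters.

(** * A uniform lower bound for Fourier coefficients *)

Section geometric_sums.
Variable R : realType.

Lemma geom_sum_mul (x : R[i]) n : (1 - x) * \sum_(i < n) x ^+ i = 1 - x ^+ n.
Proof. by rewrite -[LHS]opprK -mulNr opprB -subrX1 opprB. Qed.

Lemma nrm_exp_le (x : R[i]) (t : R) n : nrm x <= t -> t <= 1 -> (0 < n)%N ->
  nrm (x ^+ n) <= t.
Proof.
move=> xt t1; case: n => // n _; rewrite nrmX exprS.
have t0 : 0 <= t by apply: le_trans (nrm_ge0 x) xt.
by rewrite -[leRHS]mulr1 ler_pM ?exprn_ge0 ?nrm_ge0 // exprn_ile1 ?nrm_ge0 // (le_trans xt).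
Qed.

Lemma geom_sum_ge (x : R[i]) n : nrm x <= 2^-1 -> (0 < n)%N ->
  3^-1 <= nrm (\sum_(i < n) x ^+ i).
Proof.
move=> x2 n0; have := congr1 (@nrm R) (geom_sum_mul x n); rewrite nrmM => E.
have h1 : nrm (1 - x) <= 3 / 2 by apply: le_trans (nrmB _ _) _; rewrite nrm1; lra.
have h2 : 2^-1 <= nrm (1 - x ^+ n).
  have := nrm_lbound 1 (x ^+ n); rewrite nrm1.
  by have : nrm (x ^+ n) <= 2^-1 by [apply: nrm_exp_le => //; lra]; lra.
rewrite -E in h2; have := nrm_ge0 (\sum_(i < n) x ^+ i); nra.
Qed.

Lemma geom_sum_le (x : R[i]) n : nrm x <= 2^-1 -> nrm (\sum_(i < n) x ^+ i) <= 2.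
Proof.
move=> x2; apply: le_trans (nrm_sum _ _ _) _.
apply: (@le_trans _ _ (2 - 2 * 2^-1 ^+ n)); last by rewrite gerBl mulr_ge0 // exprn_ge0.
elim: n => [|n IH]; first by rewrite big_ord0 expr0; lra.
rewrite big_ord_recr /=; apply: le_trans (lerD IH (_ : _ <= 2^-1 ^+ n)) _.
  by rewrite nrmX lerXn2r ?nnegrE ?nrm_ge0.
by rewrite exprS; lra.
Qed.

End geometric_sums.

Section fourier_lower_bound.
Variables (R : realType) (f chi : nat -> R[i]) (q : nat).
Hypothesis f_nrm : forall n, (0 < n)%N -> nrm (f n) <= 1.
Hypothesis f_neq0 : forall n, (0 < n)%N -> f n != 0.
Hypothesis f_mul : completely_multiplicative f.
Hypothesis chi_prim : primitive_dirichlet_character q chi.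
Local Notation chi_char := (prim_char chi_prim).
Local Notation trunc := (truncation f chi).
Local Notation q_gt0 := (char_gt0 chi_char).
Local Notation theta := (twist f chi).

(** The Euler factor at [r] of the Fourier coefficients of the model. *)
Definition local_factor (r L : nat) : R[i] :=
  \sum_(j < L.+1) local_coef f chi r j * (r ^ j)%N%:R^-1 * ((chi r)^*) ^+ j.

Lemma local_factorE r L : (0 < r)%N ->
  local_factor r L = 1 + (f r - chi r) * (chi r)^* / r%:R *
    \sum_(j < L) (theta r / r%:R) ^+ j.
Proof.
move=> r0; have rz := natC_neq0 R r0; rewrite /local_factor big_ord_recl.
rewrite expn0 expr0 invr1 !mulr1; congr (_ + _); rewrite mulr_sumr.
apply: eq_bigr => j _; rewrite /= /bump /= add1n /= natrX exprS invfM exprS /twist.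
by rewrite !exprMn exprVn; ring.
Qed.

Lemma twist_div r : prime r -> nrm (theta r / r%:R) <= r%:R^-1 /\ (r%:R^-1 : R) <= 2^-1.
Proof.
move=> pr; have r0 := prime_gt0 pr; split.
  rewrite nrmM nrmV nrm_nat ler_piMl ?invr_ge0 //.
  exact: (twist_nrm f_nrm chi_char).
by rewrite lef_pV2 ?posrE ?ltr0n // ler_nat prime_gt1.
Qed.

Lemma char_trivial_factor r : coprime r q -> (f r - chi r) * (chi r)^* = theta r - 1.
Proof.
move=> rq; rewrite mulrBl mul_conj_nrm (char_unit chi_char rq) expr1n.
by rewrite rmorph1.
Qed.

Lemma local_factor_ramified r L : (0 < r)%N -> ~~ coprime r q -> local_factor r L = 1.
Proof.
move=> r0; rewrite -(char_neq0 chi_char) negbK => /eqP c0.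
by rewrite local_factorE // c0 rmorph0 mulr0 !mul0r addr0.
Qed.

(** If [r] does not divide [q] and [x = theta r / r], the factor times [1 - x] is
    [1 - 1 / r] up to an error of at most [2 / r^3]. Its modulus is therefore at
    least [1 / 4], while that of [1 - x] is at most [3 / 2]. *)
Lemma local_factor_ge r L : prime r -> (1 < L)%N -> 6^-1 <= nrm (local_factor r L).
Proof.
move=> pr L2; have r0 := prime_gt0 pr.
have [rq|nrq] := boolP (coprime r q); last first.
  by rewrite local_factor_ramified // nrm1; lra.
have [xt t2] := twist_div pr; set x := theta r / r%:R in xt.
set t : R := r%:R^-1 in xt t2.
have t0 : 0 <= t by rewrite invr_ge0.
have E : (1 - x) * local_factor r L = (1 - r%:R^-1) - (x - r%:R^-1) * x ^+ L.
  rewrite local_factorE // char_trivial_factor // mulrDr mulr1 mulrCA -/x geom_sum_mul.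
  by rewrite mulrBl -/x mul1r; ring.
have nt : nrm (r%:R^-1 : R[i]) = t by rewrite nrmV nrm_nat.
have h1 : nrm (1 - x) <= 3 / 2 by apply: le_trans (nrmB _ _) _; rewrite nrm1; lra.
have h2 : 1 - t <= nrm (1 - r%:R^-1 : R[i]).
  by have := nrm_lbound 1 (r%:R^-1 : R[i]); rewrite nrm1 nt.
have h3 : nrm (x - r%:R^-1) <= 2 * t by apply: le_trans (nrmB _ _) _; rewrite nt; lra.
have h4 : nrm (x ^+ L) <= t ^+ 2.
  rewrite nrmX; apply: (@le_trans _ _ (nrm x ^+ 2)).
    by rewrite ler_wiXn2l ?nrm_ge0 //; lra.
  by rewrite lerXn2r ?nnegrE ?nrm_ge0.
have h5 : nrm ((x - r%:R^-1) * x ^+ L) <= 2 * t * t ^+ 2.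
  by rewrite nrmM ler_pM ?nrm_ge0.
have h6 := nrm_lbound (1 - r%:R^-1 : R[i]) ((x - r%:R^-1) * x ^+ L).
have := congr1 (@nrm R) E; rewrite nrmM => E'; rewrite -E' in h6.
have h7 : 2 * t * t ^+ 2 <= 4^-1.
  have : t ^+ 2 <= 4^-1 by rewrite expr2; nra.
  by have := sqr_ge0 t; move: (t ^+ 2) => u; nra.
have := nrm_ge0 (local_factor r L); nra.
Qed.

(** The first order term of the factor has real part [- cost r], and the other
    terms are of size [1 / r^2]. *)
Lemma local_factor_near1 r L : prime r -> (0 < L)%N -> coprime r q ->
  1 - (cost f chi r + 4 * (r ^ 2)%N%:R^-1) <= nrm (local_factor r L).
Proof.
move=> pr L0 rq; have r0 := prime_gt0 pr.
apply: le_trans (abs_Re_le _); apply: le_trans (ler_norm _).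
have [xt t2] := twist_div pr; rewrite local_factorE // char_trivial_factor //.
set x := theta r / r%:R in xt *; set t : R := r%:R^-1 in xt t2.
have nt : nrm (r%:R^-1 : R[i]) = t by rewrite nrmV nrm_nat.
case: L L0 => // L _; rewrite big_ord_recl expr0 mulrDr mulr1.
have -> : \sum_(i < L) x ^+ lift ord0 i = x * \sum_(i < L) x ^+ i.
  by rewrite mulr_sumr; apply: eq_bigr => i _; rewrite /= /bump /= add1n exprS.
set k := (theta r - 1) / r%:R.
have Rek : complex.Re k = - cost f chi r.
  have rE : (r%:R : R[i])^-1 = (r%:R^-1 : R)%:C%C by rewrite fmorphV rmorph_nat.
  rewrite /k /cost rE mulrC; case: (theta r) => a b /=; ring.
have nk : nrm k <= 2 * t.
  rewrite /k nrmM nt ler_wpM2r ?invr_ge0 //; apply: le_trans (nrmB _ _) _.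
  by rewrite nrm1; have := twist_nrm f_nrm chi_char r0; lra.
have h : nrm (k * (x * \sum_(i < L) x ^+ i)) <= 2 * t * (t * 2).
  rewrite nrmM ler_pM ?nrm_ge0 // nrmM ler_pM ?nrm_ge0 // geom_sum_le //.
  exact: le_trans t2.
have := abs_Re_le (k * (x * \sum_(i < L) x ^+ i)).
rewrite ler_norml => /andP[h' _].
have -> : (r ^ 2)%N%:R^-1 = t ^+ 2 :> R by rewrite natrX exprVn.
rewrite !raddfD /= Rek expr2; lra.
Qed.

Lemma fcoef_add_prime M D r L zeta : q.-primitive_root zeta -> (0 < D)%N ->
  prime r -> coprime r D -> (q * (D * r ^ L) %| M)%N -> (0 < M)%N ->
  fcoef M (trunc (D * r ^ L)) zeta = local_factor r L * fcoef M (trunc D) zeta.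
Proof.
move=> zp D0 pr cop dM M0; have zM : zeta ^+ M = 1.
  apply/eqP; rewrite -(prim_order_dvd zp).
  by apply: dvdn_trans dM; rewrite dvdn_mulr.
rewrite (fcoef_local f_neq0 f_mul chi_char) // /local_factor mulr_suml.
apply: eq_bigr => j _.
have qD0 : (0 < q * D)%N by rewrite muln_gt0 q_gt0.
have qDM : (q * D %| M)%N by apply: dvdn_trans dM; rewrite mulnA dvdn_mulr.
have red k : fcoef M (trunc D) (zeta ^+ k) = fcoef (q * D) (trunc D) (zeta ^+ k).
  apply: (fcoef_period qD0 (truncation_periodic f chi_char D0)) => //.
  exact: zetaX_q.
have := red 1%N; rewrite expr1 => ->.
by rewrite red (fcoef_prime_power chi_prim f zp) // mulrA.
Qed.

(** At the frequency [1 / (q p^s)] only the powers [p^j] with [j >= s] bring the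
    frequency back to the frequencies of the model without [p]. *)
Lemma fcoef_last_prime M D p s L z : (q * p ^ s).-primitive_root z ->
  (0 < D)%N -> prime p -> coprime p D -> (0 < s)%N -> (s <= L)%N ->
  (q * (D * p ^ L) %| M)%N -> (0 < M)%N ->
  fcoef M (trunc (D * p ^ L)) z =
  f p ^+ s.-1 * (f p - chi p) * (p ^ s)%N%:R^-1 *
   (\sum_(i < (L - s).+1) (theta p / p%:R) ^+ i) * fcoef M (trunc D) (z ^+ (p ^ s)).
Proof.
move=> zp D0 pp cop s0 sL dM M0; have p0 := prime_gt0 pp.
have ps0 : (0 < p ^ s)%N by rewrite expn_gt0 p0.
have zM : z ^+ M = 1.
  apply/eqP; rewrite -(prim_order_dvd zp); apply: dvdn_trans dM.
  by rewrite dvdn_pmul2l ?q_gt0 // dvdn_mull // dvdn_exp2l.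
have zetap : q.-primitive_root (z ^+ (p ^ s)).
  have := exp_prim_root zp (p ^ s); rewrite gcdnMl.
  by rewrite mulnK.
rewrite (fcoef_local f_neq0 f_mul chi_char) //.
have qD0 : (0 < q * D)%N by rewrite muln_gt0 q_gt0.
have qDM : (q * D %| M)%N by apply: dvdn_trans dM; rewrite mulnA dvdn_mulr.
have perD := truncation_periodic f chi_char D0.
have zero j : (j < s)%N -> fcoef M (trunc D) (z ^+ (p ^ j)) = 0.
  move=> js; apply: (fcoef_eq0 qD0 perD) => //; first by rewrite exprAC zM expr1n.
  rewrite -exprM -(prim_order_dvd zp) mulnCA dvdn_pmul2l ?q_gt0 //.
  rewrite Gauss_dvdl ?coprimeXl // dvdn_Pexp2l ?prime_gt1 //.
  by rewrite -ltnNge.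
have high i : fcoef M (trunc D) (z ^+ (p ^ (s + i))) =
    ((chi p)^*) ^+ i * fcoef M (trunc D) (z ^+ (p ^ s)).
  have red k : fcoef M (trunc D) ((z ^+ (p ^ s)) ^+ k) =
      fcoef (q * D) (trunc D) ((z ^+ (p ^ s)) ^+ k).
    apply: (fcoef_period qD0 perD) => //; exact: (zetaX_q zetap).
  have := red 1%N; rewrite expr1 => red1.
  by rewrite expnD exprM red red1 (fcoef_prime_power chi_prim f zetap).
have -> : L.+1 = (s + (L - s).+1)%N by rewrite addnS subnKC.
rewrite big_split_ord /= big1 ?add0r; last by move=> j _; rewrite zero ?mulr0.
rewrite mulr_sumr mulr_suml; apply: eq_bigr => i _; rewrite high.
have -> : local_coef f chi p (s + i) = f p ^+ s.-1 * f p ^+ i * (f p - chi p).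
  by rewrite -{1}(prednK s0) addSn /= exprD.
rewrite expnD natrM invfM.
have -> : (p ^ i)%N%:R^-1 = p%:R^-1 ^+ i :> R[i] by rewrite natrX exprVn.
by rewrite /twist !exprMn; ring.
Qed.

(** Built up one prime at a time for the product formula [fcoef_partial]. The
    prime [p] of the frequency is set aside, as its factor is of another kind. *)
Definition partial_modulus (p L N : nat) : nat :=
  \prod_(r < N | exceptional f chi r && ((r : nat) != p)) r ^ L.

Lemma partial_modulus_gt0 p L N : (0 < partial_modulus p L N)%N.
Proof. by apply: prodn_cond_gt0 => r /andP[/andP[pr _] _]; rewrite expn_gt0 prime_gt0. Qed.

Lemma partial_modulusS p L N : partial_modulus p L N.+1 =
  (partial_modulus p L N * (if exceptional f chi N && (N != p) then N ^ L else 1))%N.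
Proof.
rewrite /partial_modulus big_mkcond big_ord_recr /= -big_mkcond /=.
by [].
Qed.

Lemma prime_dvd_partial p L N r : prime r -> (r %| partial_modulus p L N)%N ->
  (r < N)%N /\ r != p.
Proof.
move=> pr; rewrite /partial_modulus; elim/big_ind: _ => [|x y hx hy|i /andP[/andP[pi _] ip]].
- by rewrite dvdn1 => /eqP r1; move: pr; rewrite r1.
- by rewrite Euclid_dvdM // => /orP[].
- by rewrite Euclid_dvdX // dvdn_prime2 // => /andP[/eqP -> _].
Qed.

Lemma modulus_partial K L p : exceptional f chi p -> (p <= K)%N ->
  modulus f chi K L = (partial_modulus p L K.+1 * p ^ L)%N.
Proof.
move=> ep pK; rewrite /modulus (bigD1 (Ordinal (pK : (p < K.+1)%N))) //= mulnC.
by congr (_ * _)%N; apply: eq_bigl => r; rewrite -val_eqE.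
Qed.

Definition factor_product (p L N : nat) : R :=
  \prod_(r < N | exceptional f chi r && ((r : nat) != p)) nrm (local_factor r L).

Lemma fcoef_partial M p L N zeta : q.-primitive_root zeta ->
  (q * partial_modulus p L N %| M)%N -> (0 < M)%N ->
  nrm (fcoef M (trunc (partial_modulus p L N)) zeta) =
  factor_product p L N * nrm (fcoef q chi zeta).
Proof.
move=> zp; elim: N => [|N IH] dM M0.
  have -> : trunc (partial_modulus p L 0) = chi.
    apply/funext => n; rewrite /partial_modulus big_ord0.
    by rewrite /truncation gcdn1 divn1 (cmul1 f_neq0 f_mul) mul1r.
  rewrite /factor_product big_ord0 mul1r; congr nrm.
  have per : periodic q chi by move=> n; have := char_addM chi_char n 1; rewrite mul1n.
  apply: (fcoef_period q_gt0 per (prim_expr_order zp)) => //.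
  by apply: dvdn_trans dM; rewrite dvdn_mulr.
have D0 := partial_modulus_gt0 p L N.
have dM' : (q * partial_modulus p L N %| M)%N.
  by apply: dvdn_trans dM; rewrite partial_modulusS mulnA dvdn_mulr.
rewrite /factor_product big_mkcond big_ord_recr /= -big_mkcond /= -/(factor_product p L N).
move: dM; rewrite partial_modulusS; case: ifP => [/andP[eN Np]|_] dM; last first.
  by rewrite muln1 mulr1; exact: IH.
have [pN _] := andP eN.
have cop : coprime N (partial_modulus p L N).
  rewrite prime_coprime //; apply/negP => /(prime_dvd_partial pN) [].
  by rewrite ltnn.
by rewrite (fcoef_add_prime zp D0 pN cop dM M0) nrmM IH // mulrA [_ * factor_product _ _ _]mulrC.
Qed.

(** Finitely many local factors are bounded below one by one; the others are so
    close to 1 that their product is at least one half. *)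
Lemma factor_product_ge (p L K0 : nat) : (1 < L)%N -> (q <= K0)%N ->
  (forall N, \sum_(r < N | prime r && (K0 < r)%N)
     (cost f chi r + 4 * (r ^ 2)%N%:R^-1) <= 2^-1) ->
  forall N, 6^-1 ^+ K0.+1 / 2 <= factor_product p L N.
Proof.
move=> L2 qK0 tail N.
pose y r := cost f chi r + 4 * (r ^ 2)%N%:R^-1.
(* Bernoulli: [sigma] bounds the product of the [1 - y r] from below. *)
pose sigma N := 1 - \sum_(r < N | prime r && (K0 < r)%N) y r.
have y0 r : prime r -> 0 <= y r.
  move=> /prime_gt0 r0; apply: addr_ge0; first exact: (cost_ge0 f_nrm chi_char).
  by rewrite mulr_ge0.
have sg M : 2^-1 <= sigma M by have := tail M; rewrite /sigma -/(y _); lra.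
have sgS M : sigma M.+1 = sigma M - (if prime M && (K0 < M)%N then y M else 0).
  by rewrite /sigma big_mkcond big_ord_recr /= -big_mkcond /= opprD addrA.
suff main M : 6^-1 ^+ (minn M K0.+1) * sigma M <= factor_product p L M.
  apply: le_trans (main N); apply: ler_pM; rewrite ?invr_ge0 ?exprn_ge0 ?invr_ge0 //.
  by apply: ler_wiXn2l; rewrite ?geq_minr //; lra.
elim: M => [|M IH].
  by rewrite min0n expr0 mul1r /factor_product big_ord0 /sigma big_ord0 subr0.
have FS : factor_product p L M.+1 = factor_product p L M *
   (if exceptional f chi M && (M != p) then nrm (local_factor M L) else 1).
  by rewrite /factor_product big_mkcond big_ord_recr /= -big_mkcond.
have a0 n : 0 < (6^-1 : R) ^+ n by rewrite exprn_gt0.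
have amono : (6^-1 : R) ^+ minn M.+1 K0.+1 <= 6^-1 ^+ minn M K0.+1.
  by apply: ler_wiXn2l => //; [lra|lia].
have sle : sigma M.+1 <= sigma M.
  by rewrite sgS gerBl; case: ifP => // /andP[/y0].
have F0 : 0 <= factor_product p L M by apply: prodr_ge0 => r _; exact: nrm_ge0.
rewrite FS; case: ifP => [/andP[/andP[pM _] _]|_]; last first.
  rewrite mulr1; apply: le_trans IH; apply: ler_pM => //.
  by apply: le_trans (sg _); rewrite invr_ge0.
have [MK|KM] := leqP M K0.
  have -> : minn M.+1 K0.+1 = M.+1 by apply/minn_idPl.
  have mE : minn M K0.+1 = M by apply/minn_idPl; exact: leqW.
  rewrite mE in IH.
  rewrite exprSr mulrAC; apply: ler_pM => //.
  - by rewrite mulr_ge0 ?(ltW (a0 _)) //; apply: le_trans (sg _); rewrite invr_ge0.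
  - by apply: le_trans IH; rewrite ler_pM2l.
  - exact: local_factor_ge.
have mE : minn M.+1 K0.+1 = minn M K0.+1.
  by rewrite !(minn_idPr _) // ltnW.
have Mq : coprime M q by apply: (char_prime_gt chi_char) => //; exact: leq_ltn_trans KM.
have near1 := local_factor_near1 pM (ltnW L2) Mq; rewrite -/(y M) in near1.
rewrite mE sgS pM KM /=; have yM := y0 _ pM; have sM := sg M.
set a := 6^-1 ^+ _ in IH *; have {}a0 : 0 < a by exact: a0.
have s1 : sigma M <= 1.
  by rewrite gerBl; apply: sumr_ge0 => r /andP[/y0].
have sy : 2^-1 <= sigma M - y M by have := sg M.+1; rewrite sgS pM KM.
apply: (@le_trans _ _ (a * sigma M * (1 - y M))).
  rewrite -subr_ge0 (_ : _ - _ = a * (y M * (1 - sigma M))); last by ring.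
  by rewrite mulr_ge0 ?(ltW a0) // mulr_ge0 // subr_ge0.
apply: ler_pM => //; last by lra.
by rewrite mulr_ge0 ?(ltW a0) //; lra.
Qed.

(** The bound depends on neither [K] nor [L]: it is the product of the bounds for
    the factor at [p], for the factors at the other exceptional primes and for
    the Gauss sum of [chi]. *)
Lemma fourier_lower_bound p s z : pretends f chi -> exceptional f chi p ->
  (0 < s)%N -> (q * p ^ s).-primitive_root z ->
  exists2 c : R, 0 < c & forall K L, (p <= K)%N -> (1 < L)%N -> (s <= L)%N ->
    c <= nrm (fcoef (q * modulus f chi K L) (trunc (modulus f chi K L)) z).
Proof.
move=> fchi ep s0 zp; have [pp fp] := andP ep; have p0 := prime_gt0 pp.
have d0 : 0 < 4^-1 :> R by [].
have [K1 HK1] := cost_tail f_nrm chi_char fchi d0.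
(* The tail of the inverse squares beyond 16 is at most [1 / 16], and the
   factor 4 turns it into [1 / 4]. *)
pose K0 := maxn (maxn q 16) K1.
have qK0 : (q <= K0)%N by rewrite !leq_max leqnn.
have K016 : (16 <= K0)%N by rewrite !leq_max leqnn orbT.
have K1K0 : (K1 <= K0)%N by rewrite !leq_max leqnn orbT.
have tail N : \sum_(r < N | prime r && (K0 < r)%N)
     (cost f chi r + 4 * (r ^ 2)%N%:R^-1) <= 2^-1.
  rewrite big_split /= -mulr_sumr.
  have h1 : \sum_(r < N | prime r && (K0 < r)%N) cost f chi r <= 4^-1.
    apply: le_trans (HK1 N).
    rewrite [leRHS](bigID (fun r : 'I_N => (K0 < r)%N)) /= ler_wpDr //.
      by apply: sumr_ge0 => r /andP[/andP[/prime_gt0 r0 _] _]; exact: (cost_ge0 f_nrm chi_char).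
    rewrite le_eqVlt; apply/orP; left; apply/eqP; apply: eq_bigl => r.
    by case: (prime r) => //=; case: ltnP => Kr; rewrite ?andbF // andbT (leq_ltn_trans K1K0).
  have h2 : \sum_(r < N | prime r && (K0 < r)%N) (r ^ 2)%N%:R^-1 <= K0%:R^-1 :> R.
    apply: (@le_trans _ _ (\sum_(r < N.+1 | (K0 < r)%N) (r ^ 2)%N%:R^-1)).
      rewrite [leRHS]big_mkcond big_ord_recr /= ler_wpDr //; first by case: ifP.
      rewrite big_mkcond /=; apply: ler_sum => r _.
      by case: (prime r) => //=; case: ifP.
    by apply: sum_inv_sqr; apply: leq_trans K016.
  have h3 : K0%:R^-1 <= 16^-1 :> R.
    by rewrite lef_pV2 ?posrE ?ltr0n ?ler_nat // (leq_trans _ K016).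
  by have := ler_wpM2l (ler0n R 4) h2; lra.
pose zeta := z ^+ (p ^ s).
have zetap : q.-primitive_root zeta.
  have := exp_prim_root zp (p ^ s); rewrite gcdnMl.
  by rewrite mulnK // expn_gt0 p0.
have g0 : 0 < nrm (fcoef q chi zeta).
  by rewrite lt_neqAle nrm_ge0 andbT eq_sym nrm_eq0 (gauss_neq0 chi_prim f_neq0 f_mul zetap).
have fp0 : 0 < nrm (f p).
  by rewrite lt_neqAle nrm_ge0 andbT eq_sym nrm_eq0 f_neq0.
have fc0 : 0 < nrm (f p - chi p).
  by rewrite lt_neqAle nrm_ge0 andbT eq_sym nrm_eq0 subr_eq0.
have psV : 0 < nrm ((p ^ s)%N%:R^-1 : R[i]).
  by rewrite nrmV nrm_nat invr_gt0 ltr0n expn_gt0 p0.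
pose c1 := nrm (f p) ^+ s.-1 * nrm (f p - chi p) * nrm ((p ^ s)%N%:R^-1 : R[i]).
have c10 : 0 < c1 by rewrite !mulr_gt0 // exprn_gt0.
exists (c1 * 3^-1 * ((6^-1 ^+ K0.+1 / 2) * nrm (fcoef q chi zeta))).
  by rewrite !mulr_gt0 ?exprn_gt0 // ?invr_gt0.
move=> K L pK L2 sL; rewrite (modulus_partial L ep pK).
set D := partial_modulus p L K.+1.
have D0 : (0 < D)%N by exact: partial_modulus_gt0.
have cop : coprime p D.
  rewrite prime_coprime //; apply/negP => /(prime_dvd_partial pp) [_].
  by rewrite eqxx.
have M0 : (0 < q * (D * p ^ L))%N by rewrite !muln_gt0 q_gt0 D0 expn_gt0 p0.
rewrite (fcoef_last_prime zp D0 pp cop s0 sL (dvdnn _) M0).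
rewrite nrmM nrmM nrmM nrmM nrmX -/c1.
rewrite (fcoef_partial zetap) //; last by rewrite mulnA dvdn_mulr.
have [xt t2] := twist_div pp.
apply: ler_pM; rewrite ?mulr_ge0 ?exprn_ge0 ?nrm_ge0 ?invr_ge0 ?(ltW c10) //.
  by rewrite ler_pM2l // geom_sum_ge //; exact: le_trans t2.
by apply: ler_pM; rewrite ?mulr_ge0 ?exprn_ge0 ?nrm_ge0 ?invr_ge0 // factor_product_ge.
Qed.

End fourier_lower_bound.

(** * The spectrum of a Furstenberg system *)

Section assembly.
Variables (R : realType) (f chi : nat -> R[i]) (q : nat).
Hypothesis f_nrm : forall n, (0 < n)%N -> nrm (f n) <= 1.
Hypothesis f_neq0 : forall n, (0 < n)%N -> f n != 0.
Hypothesis f_mul : completely_multiplicative f.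
Hypothesis chi_prim : primitive_dirichlet_character q chi.
Hypothesis f_chi : pretends f chi.
Local Notation chi_char := (prim_char chi_prim).
Local Notation trunc := (truncation f chi).
Local Notation q_gt0 := (char_gt0 chi_char).
Local Notation X := (disc_seq R).
Local Notation T := (@disc_shift R).
Local Notation modulus := (modulus f chi).

(** All shifts [i <= m] share one phase, namely the phase of the range [N + m]. *)
Lemma approx_window (e : R) (K1 : nat) : 0 < e ->
  exists K L1 : nat, (K1 <= K)%N /\ forall L N m, (L1 <= L)%N ->
  exists2 W : R[i], nrm W = 1 & forall i, (i <= m)%N ->
    \sum_(n < N) nrm (f (n.+1 + i)%N - W * trunc (modulus K L) (n.+1 + i)%N) <=
    e * (N + m)%:R.
Proof.
move=> e0; have [K [L1 [K1K H]]] := periodic_approx f_nrm f_neq0 f_mul chi_char f_chi K1 e0.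
exists K, L1; split => // L N m L1L; have [W W1 HW] := H L (N + m)%N L1L.
exists W => // i im; apply: le_trans HW.
pose G n := nrm (f n.+1 - W * trunc (modulus K L) n.+1).
apply: (@le_trans _ _ (\sum_(n < i + N) G n)).
  rewrite big_split_ord /= ler_wpDl ?sumr_ge0 // => [n _|]; first exact: nrm_ge0.
  by apply: ler_sum => n _; rewrite /G -addnS addnC.
have iN : (i + N <= N + m)%N by rewrite addnC leq_add2l.
rewrite (big_ord_widen _ G iN) [leRHS](bigID (fun n : 'I_(N + m) => (n < i + N)%N)) /=.
by rewrite lerDl sumr_ge0 // => n _; exact: nrm_ge0.
Qed.

Definition smooth_modulus (Q : nat) : Prop :=
  (0 < Q)%N /\ forall p, prime p -> (p %| Q)%N -> exceptional f chi p.

Lemma smooth1 : smooth_modulus 1.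
Proof. by split => // p pp; rewrite dvdn1 => /eqP p1; move: pp; rewrite p1. Qed.

Lemma smoothM m n : smooth_modulus m -> smooth_modulus n -> smooth_modulus (m * n)%N.
Proof.
move=> [m0 mP] [n0 nP]; split; first by rewrite muln_gt0 m0.
by move=> p pp; rewrite Euclid_dvdM // => /orP[]; [exact: mP|exact: nP].
Qed.

Lemma exceptional_dvd p : prime p -> (p %| q)%N -> exceptional f chi p.
Proof.
move=> pp pq; rewrite /exceptional pp /=.
have -> : chi p = 0.
  by apply/eqP; rewrite -[_ == _]negbK (char_neq0 chi_char) prime_coprime // negbK.
exact/f_neq0/prime_gt0.
Qed.

Lemma smooth_period K L : smooth_modulus (q * modulus K L).
Proof.
apply: smoothM; split; [exact: q_gt0|exact: exceptional_dvd|exact: modulus_gt0|].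
by move=> p pp /(prime_dvd_modulus pp) [].
Qed.

Variables (a : X) (mu : probability (borel X) R).
Hypothesis a_f : extends_to_int f a.
Hypothesis mu_le : forall (F : X -> R) (B c : R), continuous F ->
  (forall x, 0 <= F x <= B) -> 0 <= c ->
  cesaro_limsup_le (fun n => F (iter n T a)) c ->
  (\int[mu]_x (F x)%:E <= c%:E)%E.

Let mu_inv := pr_iter_shift mu_le.

Lemma coord_orbit (j n : nat) : coord j%:Z (iter n.+1 T a) = f (n.+1 + j)%N.
Proof. by rewrite coord_iter -PoszD addnC /coord a_f // addSn. Qed.

(** For [m <= N] the shift costs a factor 2. *)
Lemma cesaro_bound (b : nat -> R) (e : R) (m : nat) : 0 < e ->
  (forall N, \sum_(n < N) b n.+1 <= e * (N + m)%:R) ->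
  cesaro_limsup_le b (2 * e).
Proof.
move=> e0 H d d0; exists m => N mN; apply: le_trans (H N) _.
have : (N + m)%:R <= 2 * N%:R :> R by rewrite -natrM ler_nat mul2n -addnn leq_add2l.
have N0 : 0 <= N%:R :> R by [].
have dN : 0 <= d * N%:R by rewrite mulr_ge0 // ltW.
move=> /(ler_wpM2l (ltW e0)) h; rewrite [leRHS]mulrDl.
move: h dN; rewrite mulrA [e * 2]mulrC; move: (d * _) (2 * e * _) (e * _) => u v w; lra.
Qed.

(** The model takes the same value at [n] and [n + j * Q], and the phase is the
    same, so the values of [f] there are close to the same number. *)
Lemma coord_recurrent (e : R) : 0 < e -> exists Q : nat, smooth_modulus Q /\
  forall j (eta : R), 0 < eta ->
    pr mu [set x | eta <= nrm (coord 0 (iter (j * Q) T x) - coord 0 x)] <= e / eta.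
Proof.
move=> e0; have e4 : 0 < e / 4 by rewrite divr_gt0.
have [K [L [_ H]]] := approx_window 0 e4.
exists (q * modulus K L)%N; split; first exact: smooth_period.
move=> j eta eta0; set Q := (q * _)%N; set m := (j * Q)%N.
have per : periodic m (trunc (modulus K L)).
  apply: (periodic_dvd (truncation_periodic f chi_char (modulus_gt0 _ _ _ _))).
  by rewrite /m dvdn_mull.
pose F x := nrm (coord 0 (iter m T x) - coord 0 x).
have cF : continuous F.
  apply: continuous_nrmP; apply: continuous_csubP; last exact: continuous_coord.
  exact: (continuous_compT (@continuous_iter_shift R m) (@continuous_coord R 0)).
have F0 x : 0 <= F x by exact: nrm_ge0.
have F2 x : 0 <= F x <= 2.
  rewrite F0; apply: le_trans (nrmB _ _) _.
  by have := nrm_coord 0 (iter m T x); have := nrm_coord 0 x; lra.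
apply: (@pr_markov _ _ _ mu F) => //; first exact: continuous_measurable_borel cF.
apply: (mu_le cF F2); first exact: ltW.
have -> : e = 2 * (e / 2) by lra.
apply: (@cesaro_bound _ _ m) => [|N]; first by rewrite divr_gt0.
have [W W1 HW] := H L N m (leqnn L).
have h1 := HW m (leqnn m); have h0 := HW 0%N (leq0n m).
have -> : e / 2 * (N + m)%:R = e / 4 * (N + m)%:R + e / 4 * (N + m)%:R :> R by lra.
apply: le_trans (lerD h1 h0); rewrite -big_split /=; apply: ler_sum => n _.
rewrite /F coord_iter add0r !coord_orbit addn0 per.
apply: le_trans (nrm_tri _ (W * trunc (modulus K L) n.+1) _) _.
by rewrite lerD2l nrmB_sym.
Qed.

Lemma primitive_circle_exp n : (0 < n)%N ->
  n.-primitive_root (circle_exp (- n%:R^-1 : R)).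
Proof.
move=> n0; have nz : (n%:R : R) != 0 by rewrite pnatr_eq0 -lt0n.
have zn : circle_exp (- n%:R^-1 : R) ^+ n = 1.
  rewrite -circle_expMn mulrN mulfV // -(circle_exp_int R (-1 : int)).
  by rewrite mulrN1z.
have [m mp mn] := prim_order_exists n0 zn.
have m0 := prim_order_gt0 mp.
suff nm : n = m by rewrite {1}nm.
apply/eqP; rewrite eqn_leq (dvdn_leq n0 mn) andbT leqNgt; apply/negP => ltmn.
have := prim_expr_order mp; rewrite -circle_expMn mulrN circle_expN => /eqP.
rewrite invr_eq1 => /eqP /circle_exp_eq1; rewrite frac_id; last first.
  by rewrite divr_ge0 // ltr_pdivrMr ?ltr0n // mul1r ltr_nat.
by move=> /eqP; rewrite mulf_eq0 invr_eq0 (negbTE nz) orbF pnatr_eq0 -leqn0 leqNgt m0.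
Qed.

(** Over a multiple of its period the average of the model is a Fourier
    coefficient, and starting the average at [n.+1] only rotates it. *)
Lemma fourier_avg_orbit D z J (W : R[i]) n : (0 < D)%N -> nrm z = 1 ->
  (q * D %| J)%N -> (0 < J)%N -> z ^+ (q * D) = 1 ->
  nrm (fourier_avg z J (iter n.+1 T a) - W * (z^-1 ^+ n.+1 * fcoef (q * D) (trunc D) z)) <=
  J%:R^-1 * \sum_(j < J) nrm (f (n.+1 + j)%N - W * trunc D (n.+1 + j)%N).
Proof.
move=> D0 z1 dJ J0 zM; have z0 : z != 0 by rewrite -nrm_eq0 z1 oner_eq0.
have qD0 : (0 < q * D)%N by rewrite muln_gt0 q_gt0.
have perD := truncation_periodic f chi_char D0.
have perJ := periodic_dvd perD dJ.
have zJ : z ^+ J = 1 by move: dJ => /dvdnP [k ->]; rewrite mulnC exprM zM expr1n.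
have -> : z^-1 ^+ n.+1 * fcoef (q * D) (trunc D) z =
    J%:R^-1 * \sum_(j < J) z ^+ j * trunc D (n.+1 + j)%N.
  rewrite -(fcoef_period qD0 perD zM dJ J0) fcoefE // mulrCA; congr (_ * _).
  rewrite -(@periodic_shift R J (fun k => trunc D k * z ^+ k) n.+1) //; last first.
    by move=> k; rewrite perJ exprD zJ mulr1.
  rewrite mulr_sumr; apply: eq_bigr => j _.
  by rewrite exprD exprVn [(j + _)%N]addnC; field; rewrite expf_neq0.
rewrite /fourier_avg mulrCA -mulrBr nrmM nrmV nrm_nat ler_wpM2l ?invr_ge0 //.
rewrite mulr_sumr -sumrB; apply: le_trans (nrm_sum _ _ _) _.
apply: ler_sum => j _; rewrite coord_orbit mulrCA -mulrBr nrmM nrmX z1 expr1n mul1r.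
by [].
Qed.

(** The unknown phase [W] cancels in the difference of two Fourier averages and
    disappears in the modulus of one, so that the hypotheses of
    [fourier_avg_eigenfunction] follow from the approximation. *)
Lemma eigenvalue_exceptional p s : exceptional f chi p -> (0 < s)%N ->
  strong_spectrum mu ((q * p ^ s)%N%:R^-1).
Proof.
move=> ep s0; have [pp _] := andP ep; set n0 := (q * p ^ s)%N.
have n0g : (0 < n0)%N by rewrite muln_gt0 q_gt0 expn_gt0 prime_gt0.
have n1 : (1 < n0)%N.
  apply: (@leq_trans (p ^ s)); last by rewrite leq_pmull ?q_gt0.
  by rewrite -{1}(expn0 p) ltn_exp2l // prime_gt1.
split; first by rewrite invr_ge0 invf_lt1 ?ltr0n // ltr1n ler0n.
pose z := circle_exp (- n0%:R^-1 : R).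
have zp : n0.-primitive_root z by exact: primitive_circle_exp.
have z1 : nrm z = 1 by exact: nrm_circle_exp.
have zV : z^-1 = circle_exp (n0%:R^-1) by rewrite -circle_expN opprK.
rewrite -zV.
have [c c0 Hc] := fourier_lower_bound f_nrm f_neq0 f_mul chi_prim f_chi ep s0 zp.
have c2 : 0 < c / 2 by rewrite divr_gt0.
apply: (fourier_avg_eigenfunction z1 mu_inv c2) => e e0.
(* The first bound serves the differences of averages, the second one their
   lower bound. *)
pose e' := Num.min (e ^+ 2 / 4) (e * c / 8).
have e'0 : 0 < e' by rewrite lt_min !divr_gt0 ?mulr_gt0 ?exprn_gt0.
have e'1 : e' <= e ^+ 2 / 4 by rewrite ge_min lexx.
have e'2 : e' <= e * c / 8 by rewrite ge_min lexx orbT.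
have [K [L1 [pK H]]] := approx_window p e'0.
pose L := maxn L1 (maxn 2 s).
have LL : (L1 <= L)%N by rewrite leq_max leqnn.
have L2 : (1 < L)%N by rewrite !leq_max leqnn orbT.
have Ls : (s <= L)%N by rewrite !leq_max leqnn !orbT.
set D := modulus K L; have D0 : (0 < D)%N by exact: modulus_gt0.
have qD0 : (0 < q * D)%N by rewrite muln_gt0 q_gt0.
exists (q * D)%N; split => // J J' J0 J'0 dJ dJ'.
have zM : z ^+ (q * D) = 1.
  apply/eqP; rewrite -(prim_order_dvd zp) dvdn_pmul2l ?q_gt0 //.
  apply: dvdn_trans (dvdn_exp2l p Ls) _; exact: modulus_dvd.
set h := fcoef (q * D) (trunc D) z; have ch : c <= nrm h by exact: Hc.
pose Er W n j := nrm (f (n.+1 + j)%N - W * trunc D (n.+1 + j)%N).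
have mean W N m I : (0 < I)%N -> (I <= m)%N ->
    (forall i, (i <= m)%N -> \sum_(n < N) Er W n i <= e' * (N + m)%:R) ->
    \sum_(n < N) I%:R^-1 * \sum_(j < I) Er W n j <= e' * (N + m)%:R.
  move=> I0 Im HW; rewrite -mulr_sumr exchange_big /= ler_pdivrMl ?ltr0n //.
  apply: (@le_trans _ _ (\sum_(j < I) e' * (N + m)%:R)).
    by apply: ler_sum => j _; apply: HW; apply: leq_trans Im; exact: ltnW.
  by rewrite sumr_const card_ord -[leLHS]mulr_natl.
split.
- pose F x := nrm (fourier_avg z J x - fourier_avg z J' x).
  have cF : continuous F.
    by apply: continuous_nrmP; apply: continuous_csubP; exact: continuous_fourier_avg.
  have F2 x : 0 <= F x <= 2.
    rewrite nrm_ge0; apply: le_trans (nrmB _ _) _.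
    by have := nrm_fourier_avg z1 J x; have := nrm_fourier_avg z1 J' x; lra.
  apply: (@le_trans _ _ ((4 * e') / e)); last first.
    by rewrite ler_pdivrMr //; rewrite expr2 in e'1; lra.
  apply: (@pr_markov _ _ _ mu F) => //; first exact: continuous_measurable_borel cF.
    by move=> x; exact: nrm_ge0.
  apply: (mu_le cF F2); first by rewrite mulr_ge0 // ltW.
  have -> : 4 * e' = 2 * (2 * e') by lra.
  apply: (@cesaro_bound _ _ (maxn J J')) => [|N]; first by rewrite mulr_gt0.
  have [W W1 HW] := H L N (maxn J J') LL.
  have h1 := mean W N _ J J0 (leq_maxl J J') HW.
  have h2 := mean W N _ J' J'0 (leq_maxr J J') HW.
  have -> : 2 * e' * (N + maxn J J')%:R = e' * (N + maxn J J')%:R + e' * (N + maxn J J')%:R :> R by lra.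
  apply: le_trans (lerD h1 h2); rewrite -big_split /=; apply: ler_sum => n _.
  apply: le_trans (nrm_tri _ (W * (z^-1 ^+ n.+1 * h)) _) _; apply: lerD.
    exact: fourier_avg_orbit.
  by rewrite nrmB_sym; exact: fourier_avg_orbit.
- pose F x := Num.max (c - nrm (fourier_avg z J x)) 0.
  have cg : continuous (fun x : X => nrm (fourier_avg z J x)).
    by apply: continuous_nrmP; exact: continuous_fourier_avg.
  have cF : continuous F.
    apply: (continuous_compT cg (g := fun u : R => Num.max (c - u) 0)).
    move=> u; apply: (@continuous_max _ R (fun u => c - u) (cst 0)); last exact: cvg_cst.
    by apply: cvgB; [exact: cvg_cst|exact: cvg_id].
  have F0 x : 0 <= F x by rewrite le_max lexx orbT.
  have Fc x : 0 <= F x <= c.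
    by rewrite F0 ge_max (ltW c0) gerBl nrm_ge0.
  have mge : measurable ([set x | c / 2 <= F x] : set (borel X)).
    exact: measurable_ge_cst (continuous_measurable_borel cF).
  have mle : measurable ([set x | nrm (fourier_avg z J x) <= c / 2] : set (borel X)).
    exact: measurable_le_cst (continuous_measurable_borel cg).
  apply: (@le_trans _ _ (pr mu [set x | c / 2 <= F x])).
    by apply: pr_mono => // x /= hx; rewrite /F le_max; apply/orP; left; lra.
  apply: (@le_trans _ _ ((2 * e') / (c / 2))); last first.
    by rewrite ler_pdivrMr //; lra.
  apply: (@pr_markov _ _ _ mu F) => //; first exact: continuous_measurable_borel cF.
  apply: (mu_le cF Fc); first by rewrite mulr_ge0 // ltW.
  apply: (@cesaro_bound _ _ J) => // N.
  have [W W1 HW] := H L N J LL.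
  apply: le_trans (mean W N _ J J0 (leqnn J) HW); apply: ler_sum => n _.
  rewrite /F ge_max; apply/andP; split; last first.
    by rewrite mulr_ge0 ?invr_ge0 // sumr_ge0 // => j _; exact: nrm_ge0.
  apply: le_trans (fourier_avg_orbit W n D0 z1 dJ J0 zM).
  have := nrm_lbound (W * (z^-1 ^+ n.+1 * h)) (fourier_avg z J (iter n.+1 T a)).
  have -> : nrm (W * (z^-1 ^+ n.+1 * h)) = nrm h.
    by rewrite nrmM nrmM nrmX nrmV z1 W1 invr1 expr1n !mul1r.
  rewrite nrmB_sym; move: ch; move: (nrm h) (nrm (_ - _)) (nrm _) => u v w; lra.
Qed.

(** The coordinates, and with them all Borel sets, are almost periodic with
    periods composed of exceptional primes, and such a period is a denominator
    of the eigenvalue. *)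
Lemma eigenvalue_generated (H : set R) alpha : circle_subgroup H ->
  (forall p s, exceptional f chi p -> (0 < s)%N -> H (p%:R ^+ s)^-1) ->
  spectrum mu T alpha -> H alpha.
Proof.
move=> gH HG [a01 [g [[mg _] gn0 gT]]].
have ap (A : set (borel X)) : measurable A -> almost_periodic_set mu smooth_modulus A.
  exact: (all_almost_periodic mu_inv smooth1 smoothM coord_recurrent).
have [Q [[Q0 QP] Qa]] := eigenvalue_denominator mu_inv
  (fun A mA => (ap A mA).2) mg gn0 gT.
have frac_inv p s : prime p -> (0 < s)%N -> Defs.frac ((p%:R ^+ s)^-1 : R) = (p%:R ^+ s)^-1.
  move=> pp s0; apply: frac_id; rewrite invr_ge0 exprn_ge0 //= invf_lt1.
    by rewrite exprn_egt1 // ?ltr1n ?prime_gt1 // -lt0n.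
  by rewrite exprn_gt0 // ltr0n prime_gt0.
have : liftH H alpha.
  apply: (liftH_smooth gH (A := exceptional f chi) _ Q0 QP Qa) => p s pp ep s0.
  by rewrite /liftH frac_inv //; exact: HG.
by rewrite /liftH frac_id.
Qed.

End assembly.

Theorem theorem2p12 (R : realType) (f chi : nat -> R[i]) (q : nat)
    (mu : probability (borel (disc_seq R)) R)
    (f_disc : forall n : nat, (0 < n)%N -> `|f n| <= 1)
    (f_neq0 : forall n : nat, (0 < n)%N -> f n != 0)
    (f_mul : completely_multiplicative f)
    (chi_primitive : primitive_dirichlet_character q chi)
    (f_chi : pretends f chi)
    (mu_furstenberg :
       furstenberg_system (@cesaro_mean _ _ R) f mu \/
       furstenberg_system (@log_mean _ _ R) f mu) :
  let A := [set p : nat | prime p /\ ((p %| q)%N \/ f p != chi p)] in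
  spectrum mu (@disc_shift R) =
  circle_generated [set x : R | exists p s : nat,
    [/\ A p, (0 < s)%N & x = (p%:R ^+ s)^-1]].
Proof.
move=> A; have f_nrm n : (0 < n)%N -> nrm (f n) <= 1.
  by move=> n0; rewrite -nrm_le1 f_disc.
have [a a_f mu_le] := furstenberg_integral_le mu_furstenberg.
have AE p : A p <-> exceptional f chi p.
  split=> [[pp [pq|fp]]|/andP[pp fp]]; last by split => //; right.
    exact: (exceptional_dvd f_neq0 chi_primitive pp pq).
  by rewrite /exceptional pp.
apply/seteqP; split.
- move=> alpha Sa H [gH GH].
  apply: (eigenvalue_generated f_nrm f_neq0 f_mul chi_primitive f_chi a_f mu_le gH) Sa.
  by move=> p s /AE Ap s0; apply: GH; exists p, s.
- apply: subset_trans (@strong_spectrum_sub R mu).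
  apply: smallest_sub; first exact: strong_spectrum_subgroup.
  move=> _ [p [s [/AE ep s0 ->]]]; have [pp _] := andP ep.
  have st := eigenvalue_exceptional f_nrm f_neq0 f_mul chi_primitive f_chi a_f mu_le ep s0.
  have q0 := char_gt0 (prim_char chi_primitive).
  have gS := @strong_spectrum_subgroup R mu.
  have ps0 : 0 < p%:R ^+ s :> R by rewrite exprn_gt0 // ltr0n prime_gt0.
  have [st01 _] := st.
  have st' : liftH (strong_spectrum mu) ((q * p ^ s)%N%:R^-1) by rewrite /liftH frac_id.
  (* [1 / p^s] is the [q]-th multiple of the eigenvalue [1 / (q * p^s)]. *)
  have := liftHn gS q st'; rewrite /liftH.
  have -> : q%:R * (q * p ^ s)%N%:R^-1 = (p%:R ^+ s)^-1 :> R.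
    by rewrite natrM natrX invfM mulrA mulfV ?mul1r // pnatr_eq0 -lt0n.
  rewrite frac_id // invr_ge0 (ltW ps0) invf_lt1 //.
  by rewrite exprn_egt1 // ?ltr1n ?prime_gt1 // -lt0n.
Qed.
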